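(* Let $\mathcal A=M_k(O_{nc})$ ($k\ge 1$) and let $(\mathcal A,\mathcal H,\mathcal D)$ be the $(1,\infty)$-summable modular spectral triple of the Cuntz algebra described in the context. Let $u\in\mathcal A$ be a modular unitary such that the difference of eta terms $\eta_\epsilon(u\mathcal D u^* )-\eta_\epsilon(\mathcal D)$ (for all $\epsilon>0$) and the difference of kernel terms $\widehat\tau([\ker \mathcal D])-\widehat\tau([\ker u\mathcal D u^*])$ both vanish. Then for any Dixmier trace $\widehat\tau_{\tilde\omega}$ associated to $\widehat\tau$ the spectral flow is given by an actual limit: $$sf_{\widehat\tau}(\mathcal D,u\mathcal D u^* )=\frac12\lim_{s\to1^+}(s-1)\,\widehat\tau\big(u[\mathcal D,u^*](1+\mathcal D^2)^{-s/2}\big)=\frac12\,\widehat\tau_{\tilde\omega}\big(u[\mathcal D,u^*](1+\mathcal D^2)^{-1/2}\big)=\tau\circ\Phi(u[\mathcal D,u^*]).$$ Moreover, the functional $\theta$ on $\mathcal A\otimes\mathcal A$ defined by $$\theta(a_0,a_1)=\frac12\lim_{s\to1^+}(s-1)\,\tau_\Delta\big(a_0[\mathcal D,a_1](1+\mathcal D^2)^{-s/2}\big)$$ is a $\sigma$-twisted $b,B$-cocycle, i.e. $b^\sigma\theta=0$ and $B^\sigma\theta=0$, where $$b^\sigma\theta(a_0,a_1,a_2)=\theta(a_0a_1,a_2)-\theta(a_0,a_1a_2)+\theta(\sigma(a_2)a_0,a_1),\qquad B^\sigma\theta(a_0)=\theta(1,a_0).$$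
   Context: Fix $n\ge2$. $O_n$ is the Cuntz algebra generated by isometries $S_1,\dots,S_n$ with $\sum_iS_iS_i^*=1$. For a multi-index $\mu=(\mu_1,\dots,\mu_k)\in\{1,\dots,n\}^k$ put $|\mu|=k$, $S_\mu=S_{\mu_1}\cdots S_{\mu_k}$ ($S_\mu=1$ if $|\mu|=0$), $P_\mu=S_\mu S_\mu^*$. $O_{nc}=\mathrm{span}\{S_\mu S_\nu^*\}$. The gauge action of the circle is $\gamma_z(S_j)=zS_j$, $F$ is its fixed point algebra in $O_n$, and $\Phi(a)=\frac1{2\pi}\int_0^{2\pi}\gamma_{e^{i\theta}}(a)\,d\theta$ is the expectation $O_n\to F$. $\tau$ is the unique faithful tracial state on $F$ and $\psi=\tau\circ\Phi$. $\mathcal H=L^2(O_n,\psi)$ is the GNS space with $\langle a,b\rangle=\psi(a^*b)$, with $O_n\subset\mathcal H$ and $\pi$ the left multiplication representation (elements $a$ are also written for $\pi(a)$). $\Phi_k$ is the projection onto the $k$-th spectral subspace: $\Phi_k(S_\alpha S_\beta^* )=S_\alpha S_\beta^*$ if $|\alpha|-|\beta|=k$ and $0$ otherwise. $\mathcal D=\sum_{k\in\mathbb Z}k\Phi_k$ (self-adjoint), $\Delta=n^{-\mathcal D}$, so $\Delta(S_\mu S_\nu^* )=n^{|\nu|-|\mu|}S_\mu S_\nu^*$. The algebra automorphism $\sigma$ of $O_{nc}$ is $\sigma(a)=\Delta^{-1}(a)$, i.e. $\sigma(S_\mu S_\nu^* )=n^{|\mu|-|\nu|}S_\mu S_\nu^*$;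 its fixed points are $F\cap O_{nc}$. $X$ is the right Hilbert $F$-module completion of $O_n$ for $(x|y)_R=\Phi(x^*y)$; $\Theta^R_{x,y}z=x(y|z)_R$. $\mathcal N$ is the von Neumann algebra on $\mathcal H$ generated by the (extensions to $\mathcal H$ of) $\Theta^R_{x,y}$, $x,y\in O_{nc}$; it has a faithful normal semifinite trace $\tilde\tau$ with $\tilde\tau(\Theta^R_{x,y})=\psi(y^*x)$. On $\mathcal N_+$, $\tau_\Delta(T)=\sup_{N}\tilde\tau(\Delta_NT)$ with $\Delta_N=\Delta\sum_{|k|\le N}\Phi_k$. $\mathcal M=\{T\in\mathcal N: T\Phi_k=\Phi_kT\ \forall k\}$, $\Psi(T)=\sum_k\Phi_kT\Phi_k$ is the expectation $\mathcal N\to\mathcal M$, and $\widehat\tau=\sum_kn^{-k}\tilde\tau|_{\Phi_k\mathcal N\Phi_k}$ is a faithful normal semifinite trace on $\mathcal M$, with $\tau_\Delta=\widehat\tau\circ\Psi$. For $T\in\mathcal N$, $B\in L^1(\mathcal M,\widehat\tau)$, $\tau_\Delta(TB)$ means $\widehat\tau(\Psi(T)B)$. For $\mathcal A=M_k(O_{nc})$ one uses $\mathcal H\otimes\mathbb C^k$, $\mathcal D\otimes 1_k$ (still written $\mathcal D$), $M_k(\mathcal N)$, $M_k(\mathcal M)$ (still written $\mathcal N,\mathcal M$), with $\sigma,\Phi,\Psi,\pi$ applied entrywise and $\tau,\tilde\tau,\tau_\Delta,\widehat\tau$ tensored with the unnormalised matrix trace. A unitary $u\in\mathcal A$ is modular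 if $u\sigma(u^* )$ and $u^*\sigma(u)$ are matrices over $F$. For such $u$, $u[\mathcal D,u^*]$ extends to an element of $\mathcal M_{sa}$ and $u\mathcal Du^*=\mathcal D+u[\mathcal D,u^*]$. $\eta_\epsilon(\mathcal D')=\frac1{\sqrt\pi}\int_\epsilon^\infty\widehat\tau(\mathcal D'e^{-t\mathcal D'^2})t^{-1/2}dt$, and $[\ker \mathcal D']$ is the projection onto the kernel of $\mathcal D'$. Spectral flow $sf_{\widehat\tau}(\mathcal D,u\mathcal Du^* )$ is the semifinite spectral flow in $(\mathcal M,\widehat\tau)$ of the path $\mathcal D_t=\mathcal D+tu[\mathcal D,u^*]$, $t\in[0,1]$: with $P_t=\chi_{[0,\infty)}(\mathcal D_t)$ and a sufficiently fine partition $0=t_0<\dots<t_m=1$ it is $\sum_{i}\mathrm{ind}(P_{t_{i-1}}P_{t_i})$, the Breuer–Fredholm ($\widehat\tau$-)index of $P_{t_{i-1}}P_{t_i}$ as an operator from the range of $P_{t_i}$ to the range of $P_{t_{i-1}}$. Dixmier traces: $L^{(1,\infty)}(\mathcal M,\widehat\tau)$ is the set of $T\in\mathcal M$ with $\sup_{t>0}\frac1{\log(1+t)}\int_0^t\mu_s(T)ds<\infty$ ($\mu_s$ the generalised singular values for $\widehat\tau$); a Dixmier trace is the linear extension of $T\mapsto\tilde\omega\big(t\mapsto\frac1{\log(1+t)}\int_0^t\mu_s(T)ds\big)$, $T\ge0$, for a state $\tilde\omega$ on $L^\infty(\mathbb R_+^* )$ which agrees with the limit at infinity when that exists and for which this functional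 is additive on positive elements (a trace). *)

(* Defs.v *)
From HB Require Import structures.
From mathcomp Require Import all_boot all_order all_algebra.
From mathcomp Require Import complex.
From mathcomp Require Import all_classical all_reals all_analysis.

Set Implicit Arguments.
Unset Strict Implicit.
Unset Printing Implicit Defensive.

Import Order.TTheory GRing.Theory Num.Theory.
Import numFieldNormedType.Exports.

Local Open Scope classical_set_scope.
Local Open Scope complex_scope.
Local Open Scope ring_scope.

HB.instance Definition _ (R : realType) := NormedModule.copy R[i] R[i]^o.

HB.mixin Record Algebra_isCstar (R : realType) A of GRing.Algebra R[i] A := {
  cnorm : A -> R;
  star : A -> A;
  cnorm_eq0 : forall a, cnorm a = 0 -> a = 0;
  cnormD : forall a b, cnorm (a + b) <= cnorm a + cnorm b;
  cnormZ : forall (c : R[i]) a, cnorm (c *: a) = Normc.normc c * cnorm a;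
  cnormM : forall a b, cnorm (a * b) <= cnorm a * cnorm b;
  starK : involutive star;
  starD : forall a b, star (a + b) = star a + star b;
  starZ : forall (c : R[i]) a, star (c *: a) = c^* *: star a;
  starM : forall a b, star (a * b) = star b * star a;
  cnorm_starM : forall a, cnorm (star a * a) = cnorm a ^+ 2;
  cnorm_complete : forall x : nat -> A,
    (forall e : R, 0 < e -> exists N, forall p q, (N <= p)%N -> (N <= q)%N ->
       cnorm (x p - x q) < e) ->
    exists l, cnorm (x p - l) @[p --> \oo] --> (0 : R)
}.
#[short(type="cstarType")]
HB.structure Definition Cstar (R : realType) :=
  {A of Algebra_isCstar R A & GRing.Algebra R[i] A}.

(* Complex inner product spaces; inner products are linear in the second
   variable.  Hilbert spaces are those satisfying [complete_inner] below. *)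
HB.mixin Record Lmodule_isInner (R : realType) V of GRing.Lmodule R[i] V := {
  dot : V -> V -> R[i];
  dotDr : forall x y z, dot x (y + z) = dot x y + dot x z;
  dotZr : forall (c : R[i]) x y, dot x (c *: y) = c * dot x y;
  dot_conj : forall x y, dot y x = (dot x y)^*;
  dot_ge0 : forall x, 0 <= dot x x;
  dot_eq0 : forall x, dot x x = 0 -> x = 0
}.
#[short(type="innerType")]
HB.structure Definition Inner (R : realType) :=
  {V of Lmodule_isInner R V & GRing.Lmodule R[i] V}.

Section direct_sum.
Context {R : realType} (k : nat) (V : innerType R).
Local Notation Vk := {ffun 'I_k -> V}.
Let dotk (x y : Vk) : R[i] := \sum_(i < k) dot (x i) (y i).

Let dotkDr x y z : dotk x (y + z) = dotk x y + dotk x z.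
Proof. by rewrite -big_split; apply: eq_bigr => i _; rewrite ffunE dotDr. Qed.

Let dotkZr (c : R[i]) x y : dotk x (c *: y) = c * dotk x y.
Proof. by rewrite mulr_sumr; apply: eq_bigr => i _; rewrite ffunE dotZr. Qed.

Let dotk_conj x y : dotk y x = (dotk x y)^*.
Proof. by rewrite rmorph_sum; apply: eq_bigr => i _; rewrite dot_conj. Qed.

Let dotk_ge0 x : 0 <= dotk x x.
Proof. by apply: sumr_ge0 => i _; apply: dot_ge0. Qed.

Let dotk_eq0 x : dotk x x = 0 -> x = 0.
Proof.
move=> x0; apply/ffunP => i; rewrite ffunE; apply: dot_eq0.
by apply: (psumr_eq0P _ x0) => // j _; apply: dot_ge0.
Qed.

HB.instance Definition _ :=
  Lmodule_isInner.Build R Vk dotkDr dotkZr dotk_conj dotk_ge0 dotk_eq0.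
End direct_sum.

Section partitions.
Context {R : realType}.

Definition mesh_lt (a : R) (s : seq R) (d : R) : Prop :=
  forall i, (i < size s)%N -> nth 0 (a :: s) i.+1 - nth 0 (a :: s) i < d.

Definition riemann_integral (A : cstarType R) (f : R -> A) (a b : R) (v : A)
    : Prop :=
  forall e : R, 0 < e -> exists2 d : R, 0 < d &
    forall (s : seq R) (xi : nat -> R), itv_partition a b s -> mesh_lt a s d ->
      (forall i, (i < size s)%N ->
         nth 0 (a :: s) i <= xi i <= nth 0 (a :: s) i.+1) ->
      cnorm (\sum_(i < size s)
               (nth 0 (a :: s) i.+1 - nth 0 (a :: s) i)%:C *: f (xi i) - v) < e.
End partitions.

Section operators.
Context {R : realType} {V : innerType R}.
Implicit Types (T P Q : V -> V) (S : set (V -> V)).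

Definition vnorm (x : V) : R := Num.sqrt (complex.Re (dot x x)).

Definition complete_inner : Prop := forall x : nat -> V,
  (forall e : R, 0 < e -> exists N : nat, forall p q : nat, (N <= p)%N -> (N <= q)%N ->
     vnorm (x p - x q) < e) ->
  exists l, vnorm (x p - l) @[p --> \oo] --> (0 : R).

Definition bounded_op T : Prop :=
  linear T /\ exists M : R, forall x, vnorm (T x) <= M * vnorm x.

Definition opnorm T : R :=
  inf [set c : R | 0 <= c /\ forall x, vnorm (T x) <= c * vnorm x].

Definition adjoint_of T T' : Prop := forall x y, dot (T x) y = dot x (T' y).

Definition pos_op T : Prop := forall x, 0 <= dot x (T x).

Definition projection P : Prop :=
  [/\ bounded_op P, P \o P = P & adjoint_of P P].

Definition commutant S : set (V -> V) :=
  [set T | bounded_op T /\ forall A, S A -> T \o A = A \o T].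

(* The von Neumann algebra generated by S, by the bicommutant theorem. *)
Definition vN_generated S : set (V -> V) :=
  commutant (commutant [set T | S T \/ exists2 A, S A & adjoint_of A T]).

Implicit Types N K : set (V -> V).

Definition pos_part N : set (V -> V) := [set T | N T /\ pos_op T].

Definition proj_onto (W : set V) : V -> V :=
  xget 0 [set P | bounded_op P /\
    forall x, W (P x) /\ forall y, W y -> dot y (x - P x) = 0].

(* Partially defined operators; [app] is meaningful on [dom] only. *)
Record partial_op := PartialOp { dom : set V; app :> V -> V }.
Implicit Types D : partial_op.

Definition conj_partial T T' D : partial_op :=
  PartialOp [set x | dom D (T' x)] (fun x => T (D (T' x))).

Definition add_partial D T : partial_op :=
  PartialOp (dom D) (fun x => D x + T x).

Definition kernel_proj D : V -> V := proj_onto [set x | dom D x /\ D x = 0].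

(* The bounded extension of the commutator [D, T]. *)
Definition commutator D T : V -> V :=
  xget 0 [set C | bounded_op C /\
    forall x, dom D x -> dom D (T x) /\ C x = D (T x) - T (D x)].

(* The sum of (A j) over j in int, in the strong sense, on the domain of all
   vectors for which it converges. *)
Definition strong_sum_at (A : int -> V -> V) (x y : V) : Prop :=
  vnorm (\sum_(i < m.*2.+1) A (i%:Z - m%:Z) x - y) @[m --> \oo] --> (0 : R).

Definition strong_sum (A : int -> V -> V) : partial_op :=
  PartialOp [set x | exists y, strong_sum_at A x y]
            (fun x => xget 0 [set y | strong_sum_at A x y]).

(* E is the projection valued spectral measure of the self-adjoint operator D,
   and m x is the measure B |-> <x, E(B) x>. *)
Definition spectral_measure (E : set R -> V -> V)
    (m : V -> {measure set (measurableTypeR R) -> \bar R}) D : Prop :=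
  [/\ [/\ forall B : set R, measurable B -> projection (E B),
          E setT = id,
          forall B B' : set R, measurable B -> measurable B' ->
            E (B `&` B') = E B \o E B'
        & forall x (B : set R), measurable B ->
            m x B = (complex.Re (dot x (E B x)))%:E],
      dom D = [set x | (\int[m x]_l (l ^+ 2)%:E < +oo)%E]
    & forall x, dom D x -> dot x (D x) = (\int[m x]_l l)%:C].

(* The bounded operator f(D), for f a bounded Borel function. *)
Definition fcalc D (f : R -> R) : V -> V :=
  xget 0 [set A | bounded_op A /\ exists E m, spectral_measure E m D /\
    forall x, dot x (A x) = (\int[m x]_l f l)%:C].

(* Faithful normal semifinite traces on a von Neumann algebra N; only the
   values of phi on the positive part of N are relevant. *)
Definition fns_trace N (phi : (V -> V) -> \bar R) : Prop :=
  [/\ [/\ forall A, pos_part N A -> (0 <= phi A)%E,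
          forall A B, pos_part N A -> pos_part N B ->
            phi (A + B) = (phi A + phi B)%E,
          forall (c : R) A, 0 <= c -> pos_part N A ->
            phi (c%:C *: A) = (c%:E * phi A)%E
        & forall A A', N A -> N A' -> adjoint_of A A' ->
            phi (A' \o A) = phi (A \o A')],
      (* faithful *)
      forall A, pos_part N A -> phi A = 0%E -> A = 0,
      (* normal *)
      forall (F : set (V -> V)) T, F !=set0 -> F `<=` pos_part N ->
        (forall A B, F A -> F B ->
           exists C, [/\ F C, pos_op (C - A) & pos_op (C - B)]) ->
        pos_part N T -> (forall A, F A -> pos_op (T - A)) ->
        (forall B, pos_part N B -> (forall A, F A -> pos_op (B - A)) ->
           pos_op (B - T)) ->
        phi T = ereal_sup (phi @` F)
    & (* semifinite *)
      forall A, pos_part N A -> A <> 0 ->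
        exists B, [/\ pos_part N B, B <> 0, pos_op (A - B)
                    & (phi B < +oo)%E] ].

(* z is the value at T of the linear extension of f from the cone K of
   positive operators to the complex span of K. *)
Definition lin_ext_at K (f : (V -> V) -> R) T (z : R[i]) : Prop :=
  exists T1 T2 T3 T4,
    [/\ [/\ K T1, K T2, K T3 & K T4], T = T1 - T2 + 'i *: (T3 - T4)
      & z = (f T1 - f T2) +i* (f T3 - f T4)].

Definition lin_ext K f T : R[i] := xget 0 [set z | lin_ext_at K f T z].

(* The trace phi on its ideal of definition, the span of the positive elements
   of finite trace. *)
Definition trace_cone N (phi : (V -> V) -> \bar R) : set (V -> V) :=
  [set T | pos_part N T /\ (phi T < +oo)%E].

Definition trace_at N phi := lin_ext_at (trace_cone N phi) (fine \o phi).

Definition trace N phi := lin_ext (trace_cone N phi) (fine \o phi).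

(* The projection onto the kernel of P Q regarded as an operator from the range
   of Q to the range of P.  Its adjoint is Q P, from the range of P to the
   range of Q. *)
Definition corner_kernel P Q : V -> V :=
  proj_onto [set x | Q x = x /\ P (Q x) = 0].

Definition breuer_fredholm N (phi : (V -> V) -> \bar R) P Q : Prop :=
  [/\ (phi (corner_kernel P Q) < +oo)%E, (phi (corner_kernel Q P) < +oo)%E
    & exists E, [/\ N E, projection E, P \o E = E, (phi (P - E)%R < +oo)%E
                  & forall x, exists y, E x = P (Q y)] ].

Definition breuer_index (phi : (V -> V) -> \bar R) P Q : R :=
  fine (phi (corner_kernel P Q)) - fine (phi (corner_kernel Q P)).

Definition nonneg_proj D : V -> V := fcalc D \1_(`[0, +oo[ : set R).

(* The spectral flow of the path (D t), t in [0, 1]: the common value of the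
   index sums over all sufficiently fine partitions. *)
Definition spectral_flow N (phi : (V -> V) -> \bar R) (D : R -> partial_op)
    : R :=
  xget 0 [set v | exists2 d : R, 0 < d &
    forall s : seq R, itv_partition 0 1 s -> mesh_lt 0 s d ->
      let P i := nonneg_proj (D (nth 0 (0 :: s) i)) in
      (forall i, (i < size s)%N -> breuer_fredholm N phi (P i) (P i.+1)) /\
      v = \sum_(i < size s) breuer_index phi (P i) (P i.+1)].

Definition sing_value N (phi : (V -> V) -> \bar R) T (s : R) : R :=
  inf [set c | exists E, [/\ N E, projection E, (phi (id - E)%R <= s%:E)%E
                           & c = opnorm (T \o E)] ].

Definition log_mean N phi T (t : R) : R :=
  (ln (1 + t))^-1 * \int[lebesgue_measure]_(s in `[0, t]) sing_value N phi T s.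

Definition L1oo N (phi : (V -> V) -> \bar R) : set (V -> V) :=
  [set T | N T /\ exists M : R, forall t, 0 < t -> log_mean N phi T t <= M].

Definition L1oo_pos N phi : set (V -> V) := [set T | L1oo N phi T /\ pos_op T].

Definition dixmier_trace N phi (omega : (R -> R) -> R) T : R[i] :=
  lin_ext (L1oo_pos N phi) (fun A => omega (log_mean N phi A)) T.
End operators.

Arguments complete_inner {R} V.
Arguments partial_op {R} V.

(* Real L^oo(]0, +oo[).  A state on the complex L^oo is determined by its
   restriction to real functions; positivity makes it compatible with almost
   everywhere equality. *)
Definition Linfty (R : realType) : set (R -> R) :=
  [set f : R -> R | measurable_fun (`]0, +oo[ : set R) f /\
     exists M : R, {ae lebesgue_measure, forall t : R, 0 < t -> `|f t| <= M}].

Definition dixmier_state (R : realType) (V : innerType R) (N : set (V -> V))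
    (phi : (V -> V) -> \bar R) (omega : (R -> R) -> R) : Prop :=
  [/\ [/\ forall f g, Linfty f -> Linfty g ->
            omega (f + g) = omega f + omega g,
          forall (c : R) f, Linfty f ->
            omega (fun t => c * f t) = c * omega f,
          forall f, Linfty f ->
            {ae lebesgue_measure, forall t : R, 0 < t -> 0 <= f t} ->
            0 <= omega f
        & omega (fun=> 1) = 1],
      forall f (l : R), Linfty f -> f t @[t --> +oo] --> l -> omega f = l
    & forall A B, L1oo_pos N phi A -> L1oo_pos N phi B ->
        omega (log_mean N phi (A + B)) =
        omega (log_mean N phi A) + omega (log_mean N phi B)].

Section cuntz.
Context {R : realType} {n : nat} {O : cstarType R}.
Variable S : 'I_n -> O.

Definition word (mu : seq 'I_n) : O := \prod_(i <- mu) S i.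

Definition word2 (mu nu : seq 'I_n) : O := word mu * star (word nu).

Definition degree (mu nu : seq 'I_n) : int := (size mu)%:Z - (size nu)%:Z.

Definition Onc : set O :=
  [set a | exists s : seq (R[i] * (seq 'I_n * seq 'I_n)),
     a = \sum_(x <- s) x.1 *: word2 x.2.1 x.2.2].

Definition is_cuntz_algebra : Prop :=
  [/\ forall i, star (S i) * S i = 1, \sum_(i < n) S i * star (S i) = 1
    & forall B : set O,
        (forall i, B (S i)) ->
        (forall a b, B a -> B b -> B (a + b) /\ B (a * b)) ->
        (forall (c : R[i]) a, B a -> B (c *: a) /\ B (star a)) ->
        (forall a, (forall e : R, 0 < e -> exists2 b, B b & cnorm (a - b) < e) ->
           B a) ->
        B = setT].

Definition unit_circle (z : R[i]) : Prop := Normc.normc z = 1.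

Definition circle_pt (t : R) : R[i] := cos t +i* sin t.

(* The group law makes each gamma z bijective; automorphisms of C*-algebras are
   isometric. *)
Definition is_gauge_action (gamma : R[i] -> O -> O) : Prop :=
  [/\ forall z, unit_circle z ->
        [/\ linear (gamma z), forall a b, gamma z (a * b) = gamma z a * gamma z b,
            forall a, gamma z (star a) = star (gamma z a)
          & forall a, cnorm (gamma z a) = cnorm a],
      gamma 1 = id,
      forall z w, unit_circle z -> unit_circle w ->
        gamma (z * w) = gamma z \o gamma w,
      forall a (t0 : R),
        cnorm (gamma (circle_pt t) a - gamma (circle_pt t0) a) @[t --> t0]
          --> (0 : R)
    & forall z j, unit_circle z -> gamma z (S j) = z *: S j].

Definition fixed_algebra (gamma : R[i] -> O -> O) : set O :=
  [set a | forall z, unit_circle z -> gamma z a = a].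

Definition is_expectation (gamma : R[i] -> O -> O) (Phi : O -> O) : Prop :=
  forall a, exists2 v,
    riemann_integral (fun t => gamma (circle_pt t) a) 0 (2 * pi) v &
    Phi a = ((2 * pi)^-1)%:C *: v.

(* Faithful tracial states on the subalgebra F; only the values of tau on F are
   relevant. *)
Definition is_faithful_tracial_state (F : set O) (tau : O -> R[i]) : Prop :=
  [/\ forall (c : R[i]) a b, F a -> F b -> tau (c *: a + b) = c * tau a + tau b,
      tau 1 = 1 /\ forall a, F a -> Normc.normc (tau a) <= cnorm a,
      forall a, F a -> 0 <= tau (star a * a),
      forall a, F a -> tau (star a * a) = 0 -> a = 0
    & forall a b, F a -> F b -> tau (a * b) = tau (b * a)].

(* (H, iota, pi) is the GNS space of psi with the canonical map O -> H and the
   left multiplication representation. *)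
Definition is_gns (psi : O -> R[i]) (H : innerType R) (iota : O -> H)
    (pi : O -> H -> H) : Prop :=
  [/\ complete_inner H, linear iota,
      forall a b, dot (iota a) (iota b) = psi (star a * b),
      forall x (e : R), 0 < e -> exists a, vnorm (x - iota a) < e
    & forall a, bounded_op (pi a) /\ forall b, pi a (iota b) = iota (a * b)].

Definition is_Theta (Phi : O -> O) (H : innerType R) (iota : O -> H)
    (x y : O) (T : H -> H) : Prop :=
  bounded_op T /\ forall z, T (iota z) = iota (x * Phi (star y * z)).

Definition Theta_vN (Phi : O -> O) (H : innerType R) (iota : O -> H)
    : set (H -> H) :=
  vN_generated [set T | exists x y, [/\ Onc x, Onc y & is_Theta Phi iota x y T]].
End cuntz.

(* The Cuntz algebra with its gauge action, the KMS state psi = tau o Phi, the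
   GNS space, the spectral subspace projections and the trace on N.  All of it
   is determined up to isomorphism by n. *)
Record cuntz_system (R : realType) (n : nat) := CuntzSystem {
  cs_O : cstarType R;
  cs_S : 'I_n -> cs_O;
  cs_gauge : R[i] -> cs_O -> cs_O;
  cs_Phi : cs_O -> cs_O;
  cs_tau : cs_O -> R[i];
  cs_H : innerType R;
  cs_iota : cs_O -> cs_H;
  cs_pi : cs_O -> cs_H -> cs_H;
  cs_Phik : int -> cs_H -> cs_H;
  cs_ttau : (cs_H -> cs_H) -> \bar R;
  cs_cuntz : is_cuntz_algebra cs_S;
  cs_gaugeP : is_gauge_action cs_S cs_gauge;
  cs_PhiP : is_expectation cs_gauge cs_Phi;
  cs_tauP : is_faithful_tracial_state (fixed_algebra cs_gauge) cs_tau;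
  cs_gns : is_gns (cs_tau \o cs_Phi) cs_iota cs_pi;
  cs_PhikP : forall j, bounded_op (cs_Phik j) /\
    forall mu nu, cs_Phik j (cs_iota (word2 cs_S mu nu)) =
      if degree mu nu == j then cs_iota (word2 cs_S mu nu) else 0;
  cs_ttauP : fns_trace (Theta_vN cs_S cs_Phi cs_iota) cs_ttau;
  cs_ttau_Theta : forall x y T, Onc cs_S x -> Onc cs_S y ->
    is_Theta cs_Phi cs_iota x y T ->
    trace_at (Theta_vN cs_S cs_Phi cs_iota) cs_ttau T
      (cs_tau (cs_Phi (star y * x)))
}.

Arguments cs_S {R n} c.
Arguments cs_gauge {R n} c.
Arguments cs_Phi {R n} c.
Arguments cs_tau {R n} c.
Arguments cs_iota {R n} c.
Arguments cs_pi {R n} c.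
Arguments cs_Phik {R n} c.
Arguments cs_ttau {R n} c.

Section matrices.
Context {R : realType} {n : nat} (G : cuntz_system R n) (k : nat).
Local Notation O := (cs_O G).
Local Notation H := (cs_H G).
Local Notation Hk := {ffun 'I_k -> H}.
Implicit Types (T B : Hk -> Hk) (a b u : 'M[O]_k).

Definition ampl (T : H -> H) : Hk -> Hk := fun x => [ffun i => T (x i)].

Definition entry T (i j : 'I_k) : H -> H :=
  fun x => T [ffun l => if l == j then x else 0] i.

(* sigma a = Delta^-1 (a), where Delta^-1 = sum_j n^j Phi_j. *)
Definition sigma (a : O) : O :=
  xget 0 [set b | Onc (cs_S G) b /\ forall j : int,
    cs_Phik G j (cs_iota G b) =
    (n%:R ^ j : R)%:C *: cs_Phik G j (cs_iota G a)].

Definition in_MOnc a : Prop := forall i j, Onc (cs_S G) (a i j).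
Definition in_MF a : Prop :=
  forall i j, fixed_algebra (cs_gauge G) (a i j).
Definition mstar a : 'M[O]_k := \matrix_(i, j) star (a j i).
Definition msigma a : 'M[O]_k := \matrix_(i, j) sigma (a i j).

Definition modular_unitary u : Prop :=
  [/\ in_MOnc u, u *m mstar u = 1%:M /\ mstar u *m u = 1%:M,
      in_MF (u *m msigma (mstar u)) & in_MF (mstar u *m msigma u)].

Definition mrep a : Hk -> Hk :=
  fun x => [ffun i => \sum_(j < k) cs_pi G (a i j) (x j)].

Definition mpsi a : R[i] := \sum_(i < k) cs_tau G (cs_Phi G (a i i)).

Definition mPhik (j : int) : Hk -> Hk := ampl (cs_Phik G j).

Definition mD : partial_op Hk := strong_sum (fun j => (j%:~R : R[i]) *: mPhik j).

Definition mN : set (Hk -> Hk) :=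
  [set T | bounded_op T /\
     forall i j, Theta_vN (cs_S G) (cs_Phi G) (cs_iota G) (entry T i j)].

Definition mM : set (Hk -> Hk) :=
  [set T | mN T /\ forall j, T \o mPhik j = mPhik j \o T].

Definition mPsi T : Hk -> Hk := strong_sum (fun j => mPhik j \o T \o mPhik j).

Definition mttau T : \bar R := (\sum_(i < k) cs_ttau G (entry T i i))%E.

Definition hattau T : \bar R :=
  (\esum_(j in [set: int])
     ((n%:R ^ (- j) : R)%:E * mttau (mPhik j \o T \o mPhik j)))%E.

Definition hattau_ext T : R[i] := trace mM hattau T.

(* tau_Delta (T B), for T in N and B in L^1(M). *)
Definition tau_Delta T B : R[i] := hattau_ext (mPsi T \o B).

Definition resolvent_pow (s : R) : Hk -> Hk :=
  fcalc mD (fun x => (1 + x ^+ 2) `^ (- s / 2)).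

Definition eta_term (D : partial_op Hk) (e : R) : R :=
  (Num.sqrt pi)^-1 * \int[lebesgue_measure]_(t in `[e, +oo[)
    (complex.Re (hattau_ext (fcalc D (fun x => x * expR (- t * x ^+ 2))))
       * t `^ (- 2^-1)).

Definition uDu u : partial_op Hk := conj_partial (mrep u) (mrep (mstar u)) mD.

Definition u_comm u : Hk -> Hk := mrep u \o commutator mD (mrep (mstar u)).

Definition sf_u u : R :=
  spectral_flow mM hattau (fun t => add_partial mD (t%:C *: u_comm u)).

Definition theta_at (a0 a1 : 'M[O]_k) (s : R) : R[i] :=
  (s - 1)%:C * tau_Delta (mrep a0 \o commutator mD (mrep a1)) (resolvent_pow s).

Definition theta (a0 a1 : 'M[O]_k) : R[i] :=
  2^-1 * lim (theta_at a0 a1 s @[s --> 1^'+]).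

Definition b_sigma (f : 'M[O]_k -> 'M[O]_k -> R[i]) (a0 a1 a2 : 'M[O]_k) : R[i] :=
  f (a0 *m a1) a2 - f a0 (a1 *m a2) + f (msigma a2 *m a0) a1.

Definition B_sigma (f : 'M[O]_k -> 'M[O]_k -> R[i]) (a0 : 'M[O]_k) : R[i] :=
  f 1%:M a0.
End matrices.

Arguments mD {R n} G k.
Arguments mM {R n} G k _.
Arguments resolvent_pow {R n} G k s _.
Arguments hattau {R n G k} T.
Arguments theta {R n G k} a0 a1.

(* Main.v *)
(* The operator D has the eigenvalues j in Z, with spectral projections Phi_j, and
   hattau (f Phi_j) = tau (f) for every matrix f over F.

   Let w_l be the component of degree l of u*.  On the finite support of u* the
   indicator function of l is a polynomial in n^j, so that modularity, applied
   repeatedly, makes q_l = u w_l a matrix over F.  The q_l are mutually orthogonal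
   projections with sum 1, hence u[D, u*] = sum_l l q_l, and the path from D to
   u D u* is D_t = sum_(j, l) (j + t l) q_l Phi_j.

   - Spectral flow: for each l exactly |l| of the eigenvalues j + t l change sign,
     which contributes l tau(q_l).
   - Residue: hattau (q_l (1 + D^2)^(-s/2)) = tau(q_l) sum_j (1 + j^2)^(-s/2), and
     (s - 1) sum_j (1 + j^2)^(-s/2) tends to 2.
   - Dixmier trace: the singular values of q_l (1 + D^2)^(-1/2) give the upper
     bound 2 tau(q_l) for its Dixmier trace.  The singular values of
     (1 + D^2)^(-1/2) itself show that the sum over l is at least
     2 sum_l tau(q_l), so that each of the upper bounds is attained.
   - Cocycle: theta(a_0, a_1) = psi(a_0 d(a_1)) for the derivation d = [D, .], so
     the cocycle identities follow from the Leibniz rule, from psi o d = 0, and from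
     the KMS property psi(a b) = psi(sigma(b) a). *)

Require Import Defs.
From HB Require Import structures.
From mathcomp Require Import all_boot all_order all_algebra.
From mathcomp Require Import complex ring lra zify.
From mathcomp Require Import all_classical all_reals all_analysis.
From mathcomp Require Import measurable_realfun.

Set Implicit Arguments.
Unset Strict Implicit.
Unset Printing Implicit Defensive.

Import Order.TTheory GRing.Theory Num.Theory.
Import numFieldNormedType.Exports.

Local Open Scope classical_set_scope.
Local Open Scope complex_scope.
Local Open Scope ring_scope.


(** * Inner product spaces *)

(** Functional calculus, projections, commutators and traces are chosen by [xget], so each
    evaluation needs existence and uniqueness. The operators that occur are diagonal in a countable
    orthogonal decomposition. For such operators a spectral measure can be written down; the
    obstacle is uniqueness, because a spectral measure is prescribed only by its domain and its
    quadratic form.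

    The trace is given on the operators Theta alone. Decomposing 1 by all words of length k in
    positive degrees, and by one isometry in negative degrees, turns f Phi_j into such operators, of
    trace n^j tau(f). The weight n^(-j) in [hattau] cancels the factor, so every degree counts
    equally and the zeta sum carries no exponential weight.

    A lower bound for the singular values must face arbitrary projections E of M. These commute with
    the spectral projections of D but need not commute with q_l Phi_j. This is why only the total
    operator is bounded from below, additivity of the Dixmier trace doing the rest. *)

Section complex_facts.
Context {R : realType}.
Implicit Types z w : R[i].

Lemma normcC z : `|z| = (Normc.normc z)%:C.
Proof. by []. Qed.

Lemma normc_ge0 z : 0 <= Normc.normc z.
Proof. by case: z => a b; exact: sqrtr_ge0. Qed.

Lemma conjCD z w : (z + w)^* = z^* + w^*. Proof. exact: rmorphD. Qed.

Lemma conjCM z w : (z * w)^* = z^* * w^*. Proof. exact: rmorphM. Qed.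

Lemma conjCN z : (- z)^* = - z^*. Proof. exact: rmorphN. Qed.

Lemma ler_normcD z w : Normc.normc (z + w) <= Normc.normc z + Normc.normc w.
Proof. by rewrite -lecR rmorphD/= -!normcC ler_normD. Qed.

Lemma normcR (x : R) : Normc.normc x%:C = `|x|.
Proof. by rewrite /= expr0n/= addr0 sqrtr_sqr. Qed.

Lemma conjC_real (x : R) : (x%:C)^* = x%:C.
Proof. exact: conjc_real. Qed.

Lemma conjC_Re z : complex.Re z^* = complex.Re z.
Proof. by case: z. Qed.

Lemma ReD z w : complex.Re (z + w) = complex.Re z + complex.Re w.
Proof. by case: z; case: w. Qed.

Lemma ReB z w : complex.Re (z - w) = complex.Re z - complex.Re w.
Proof. by case: z; case: w. Qed.

Lemma ReZ (x : R) z : complex.Re (x%:C * z) = x * complex.Re z.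
Proof. by case: z => a b /=; rewrite mul0r subr0. Qed.

Lemma Re_sum (I : Type) (r : seq I) (P : pred I) (F : I -> R[i]) :
  complex.Re (\sum_(i <- r | P i) F i) = \sum_(i <- r | P i) complex.Re (F i).
Proof. by elim/big_rec2: _ => [//|i x y _ <-]; rewrite ReD. Qed.

Lemma ge0_Re z : 0 <= z -> z = (complex.Re z)%:C.
Proof. by case: z => a b; rewrite lecE => /andP[/eqP/= -> _]. Qed.

Lemma ge0_Re_ge0 z : 0 <= z -> 0 <= complex.Re z.
Proof. by rewrite lecE => /andP[]. Qed.

Lemma Re_le_normc z : complex.Re z <= Normc.normc z.
Proof.
by have := normc_ge_Re z; rewrite normcC lecR; apply: le_trans; exact: ler_norm.
Qed.

Lemma eq0_le_eps (x : R) : 0 <= x -> (forall e, 0 < e -> x < e) -> x = 0.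
Proof.
move=> x0 h; apply/eqP; rewrite eq_le x0 andbT leNgt; apply/negP => /h.
by rewrite ltxx.
Qed.

End complex_facts.

Section linear_facts.
Context {K : pzRingType} {V W : lmodType K} (f : V -> W).
Hypothesis lf : linear f.

Lemma linD x y : f (x + y) = f x + f y.
Proof. by have := lf 1 x y; rewrite !scale1r. Qed.

Lemma lin0 : f 0 = 0.
Proof. by apply: (addrI (f 0)); rewrite -linD !addr0. Qed.

Lemma linZ c x : f (c *: x) = c *: f x.
Proof. by have := lf c x 0; rewrite lin0 !addr0. Qed.

Lemma linN x : f (- x) = - f x.
Proof. by rewrite -scaleN1r linZ scaleN1r. Qed.

Lemma linB x y : f (x - y) = f x - f y.
Proof. by rewrite linD linN. Qed.

Lemma lin_sum (I : Type) (r : seq I) (P : pred I) (F : I -> V) :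
  f (\sum_(i <- r | P i) F i) = \sum_(i <- r | P i) f (F i).
Proof.
by elim/big_rec2: _ => [|i x y _ <-]; rewrite ?linD ?lin0.
Qed.
End linear_facts.

Section function_algebra.
Context {K : pzRingType} {T : Type} {V : lmodType K}.
Implicit Types A B : T -> V.

Lemma addfE A B x : (A + B) x = A x + B x. Proof. by []. Qed.

Lemma oppfE A x : (- A) x = - A x. Proof. by []. Qed.

Lemma subfE A B x : (A - B) x = A x - B x. Proof. by []. Qed.

Lemma scalefE c A x : (c *: A) x = c *: A x. Proof. by []. Qed.

Lemma sumfE (I : Type) (r : seq I) (P : pred I) (F : I -> T -> V) x :
  (\sum_(i <- r | P i) F i) x = \sum_(i <- r | P i) F i x.
Proof. by elim/big_rec2: _ => [//|i u v _ <-]. Qed.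
End function_algebra.

Section inner.
Context {R : realType} {V : innerType R}.
Implicit Types (x y z : V) (c : R[i]) (T P Q A B : V -> V).

Definition nsq x : R := complex.Re (dot x x).

Lemma dotxx x : dot x x = (nsq x)%:C.
Proof. exact: ge0_Re (dot_ge0 x). Qed.

Lemma nsq_ge0 x : 0 <= nsq x.
Proof. exact: ge0_Re_ge0 (dot_ge0 x). Qed.

Lemma dotDl x y z : dot (x + y) z = dot x z + dot y z.
Proof. by rewrite dot_conj dotDr conjCD -!dot_conj. Qed.

Lemma dotZl c x y : dot (c *: x) y = c^* * dot x y.
Proof. by rewrite dot_conj dotZr conjCM -dot_conj. Qed.

Lemma dot0r x : dot x 0 = 0.
Proof. by rewrite -(scale0r 0) dotZr mul0r. Qed.

Lemma dot0l x : dot 0 x = 0.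
Proof. by rewrite dot_conj dot0r rmorph0. Qed.

Lemma dotNr x y : dot x (- y) = - dot x y.
Proof. by rewrite -scaleN1r dotZr mulN1r. Qed.

Lemma dotNl x y : dot (- x) y = - dot x y.
Proof. by rewrite dot_conj dotNr conjCN -dot_conj. Qed.

Lemma dotBr x y z : dot x (y - z) = dot x y - dot x z.
Proof. by rewrite dotDr dotNr. Qed.

Lemma dotBl x y z : dot (x - y) z = dot x z - dot y z.
Proof. by rewrite dotDl dotNl. Qed.

Lemma dot_sumr (I : Type) (r : seq I) (P : pred I) x (F : I -> V) :
  dot x (\sum_(i <- r | P i) F i) = \sum_(i <- r | P i) dot x (F i).
Proof.
by elim/big_rec2: _ => [|i y z _ <-]; rewrite ?dot0r ?dotDr.
Qed.

Lemma dot_suml (I : Type) (r : seq I) (P : pred I) x (F : I -> V) :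
  dot (\sum_(i <- r | P i) F i) x = \sum_(i <- r | P i) dot (F i) x.
Proof.
by elim/big_rec2: _ => [|i y z _ <-]; rewrite ?dot0l ?dotDl.
Qed.

Lemma nsq0 : nsq 0 = 0.
Proof. by rewrite /nsq dot0r. Qed.

Lemma nsq_eq0 x : nsq x = 0 -> x = 0.
Proof. by move=> x0; apply: dot_eq0; rewrite dotxx x0. Qed.

Lemma vnormE x : vnorm x = Num.sqrt (nsq x). Proof. by []. Qed.

Lemma vnorm_ge0 x : 0 <= vnorm x. Proof. exact: sqrtr_ge0. Qed.

Lemma vnorm_sqr x : vnorm x ^+ 2 = nsq x.
Proof. by rewrite sqr_sqrtr ?nsq_ge0. Qed.

Lemma vnorm0 : vnorm (0 : V) = 0.
Proof. by rewrite vnormE nsq0 sqrtr0. Qed.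

Lemma vnorm_eq0 x : vnorm x = 0 -> x = 0.
Proof. by move=> h; apply: nsq_eq0; rewrite -vnorm_sqr h expr0n. Qed.

Lemma vnorm_leM (C : R) x y : 0 <= C ->
  (vnorm x <= C * vnorm y) = (nsq x <= C ^+ 2 * nsq y).
Proof.
move=> C0; rewrite -(@ler_pXn2r _ 2) ?nnegrE ?mulr_ge0 ?vnorm_ge0//.
by rewrite exprMn !vnorm_sqr.
Qed.

Lemma nsqZ c x : nsq (c *: x) = Normc.normc c ^+ 2 * nsq x.
Proof.
rewrite /nsq dotZl dotZr dotxx mulrA -normCKC normcC -rmorphXn -rmorphM/=.
by [].
Qed.

Lemma vnormZ c x : vnorm (c *: x) = Normc.normc c * vnorm x.
Proof.
by rewrite vnormE nsqZ sqrtrM ?sqr_ge0// sqrtr_sqr ger0_norm ?normc_ge0.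
Qed.

Lemma vnormN x : vnorm (- x) = vnorm x.
Proof. by rewrite !vnormE /nsq dotNl dotNr opprK. Qed.

Lemma nsqD x y : nsq (x + y) = nsq x + nsq y + 2 * complex.Re (dot x y).
Proof.
rewrite /nsq dotDl !dotDr !ReD (dot_conj x y) conjC_Re.
by rewrite mulr_natl mulr2n; ring.
Qed.

Lemma dot_CS x y : Normc.normc (dot x y) <= vnorm x * vnorm y.
Proof.
have [y0|ny0] := eqVneq (nsq y) 0.
  by rewrite (nsq_eq0 y0) dot0r Normc.normc0 vnorm0 mulr0.
have N0 : (nsq y)%:C != 0 :> R[i] by apply/eqP => /complexI /eqP; rewrite (negPf ny0).
(* [c *: y] is the orthogonal projection of [x] onto the line of [y]; the inequality is the
   positivity of the squared norm of the remainder. *)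
pose c := dot y x / (nsq y)%:C.
have cc : c^* = dot x y / (nsq y)%:C.
  by rewrite rmorphM fmorphV /= -dot_conj conjC_real.
have : 0 <= dot (x - c *: y) (x - c *: y) by exact: dot_ge0.
rewrite dotBl !dotBr !dotZl !dotZr cc (dotxx y).
rewrite (_ : _ - _ = dot x x - dot x y * dot y x / (nsq y)%:C); last first.
  by rewrite /c; field.
rewrite (dot_conj x y) -normCK dotxx normcC -rmorphXn -fmorphV -rmorphM -rmorphB/=.
rewrite ler0c subr_ge0 ler_pdivrMr; last by rewrite lt_neqAle eq_sym ny0 nsq_ge0.
move=> h; rewrite -(@ler_pXn2r _ 2) ?nnegrE ?mulr_ge0 ?vnorm_ge0 ?normc_ge0//.
by rewrite exprMn !vnorm_sqr.
Qed.

Lemma vnormD x y : vnorm (x + y) <= vnorm x + vnorm y.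
Proof.
rewrite -(@ler_pXn2r _ 2) ?nnegrE ?addr_ge0 ?vnorm_ge0//.
rewrite sqrrD !vnorm_sqr nsqD.
have := le_trans (Re_le_normc _) (dot_CS x y); rewrite -mulr_natl; lra.
Qed.

Lemma vnormB x y : vnorm (x - y) <= vnorm x + vnorm y.
Proof. by rewrite -(vnormN y); exact: vnormD. Qed.

Lemma vnormBC x y : vnorm (x - y) = vnorm (y - x).
Proof. by rewrite -vnormN opprB. Qed.

Lemma vnorm_dist z x y : vnorm (x - y) <= vnorm (x - z) + vnorm (z - y).
Proof. by rewrite -{1}(subrK z x) -addrA; exact: vnormD. Qed.

Lemma vnorm_sum (I : Type) (r : seq I) (P : pred I) (F : I -> V) :
  vnorm (\sum_(i <- r | P i) F i) <= \sum_(i <- r | P i) vnorm (F i).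
Proof.
elim/big_rec2: _ => [|i x y _ h]; first by rewrite vnorm0.
by apply: le_trans (vnormD _ _) _; rewrite lerD2l.
Qed.

Lemma vnorm_eps x : (forall e : R, 0 < e -> vnorm x < e) -> x = 0.
Proof. by move=> h; apply/vnorm_eq0/eq0_le_eps => //; exact: vnorm_ge0. Qed.

Lemma dot_ext x y : (forall z, dot z x = dot z y) -> x = y.
Proof.
by move=> h; apply/eqP; rewrite -subr_eq0; apply/eqP/dot_eq0; rewrite dotBr h subrr.
Qed.

Definition vlim (x : nat -> V) (l : V) : Prop :=
  forall e : R, 0 < e -> exists N, forall p, (N <= p)%N -> vnorm (x p - l) < e.

Lemma vlimP (x : nat -> V) l :
  (vnorm (x p - l) @[p --> \oo] --> (0 : R)) <-> vlim x l.
Proof.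
split=> [/cvgrPdist_lt h e e0|h].
  have [N _ hN] := h e e0; exists N => p Np.
  by have := hN p Np; rewrite /= sub0r normrN ger0_norm ?vnorm_ge0.
apply/cvgrPdist_lt => e e0; have [N hN] := h e e0; exists N => // p /= Np.
by rewrite sub0r normrN ger0_norm ?vnorm_ge0 ?hN.
Qed.

Lemma vlim_unique (x : nat -> V) l l' : vlim x l -> vlim x l' -> l = l'.
Proof.
move=> h h'; apply/eqP; rewrite -subr_eq0; apply/eqP/vnorm_eps => e e0.
have e2 : 0 < e / 2 by rewrite divr_gt0.
have [N hN] := h _ e2; have [N' hN'] := h' _ e2.
apply: le_lt_trans (vnorm_dist (x (maxn N N')) _ _) _; rewrite vnormBC [ltRHS]splitr.
by apply: ltrD; [exact: hN (leq_maxl _ _)|exact: hN' (leq_maxr _ _)].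
Qed.

Lemma bounded_lin T : bounded_op T -> linear T. Proof. by case. Qed.

Lemma bounded_ge0 T : bounded_op T ->
  exists2 M : R, 0 <= M & forall x, vnorm (T x) <= M * vnorm x.
Proof.
move=> [_ [M h]]; exists `|M| => // x; apply: le_trans (h x) _.
by rewrite ler_wpM2r ?vnorm_ge0// ler_norm.
Qed.

Lemma bounded_lim T (x : nat -> V) l : bounded_op T -> vlim x l ->
  vlim (T \o x) (T l).
Proof.
move=> bT h e e0; have [M M0 hM] := bounded_ge0 bT.
have M1 : 0 < M + 1 by rewrite ltr_wpDl.
have [N hN] := h (e / (M + 1)) (divr_gt0 e0 M1).
exists N => p /hN; rewrite ltr_pdivlMr// => hp.
rewrite /= -(linB (bounded_lin bT)); apply: le_lt_trans (hM _) _.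
by apply: le_lt_trans hp; rewrite mulrC ler_wpM2l ?vnorm_ge0// ler_wpDr.
Qed.

Lemma bounded_id : bounded_op (id : V -> V).
Proof. by split=> //; exists 1 => x; rewrite mul1r. Qed.

Lemma bounded_0 : bounded_op (0 : V -> V).
Proof.
split=> [c x y|]; first by rewrite /= scaler0 addr0.
by exists 0 => x; rewrite mul0r vnorm0.
Qed.

Lemma bounded_comp A B : bounded_op A -> bounded_op B -> bounded_op (A \o B).
Proof.
move=> bA bB; split=> [c x y|].
  by rewrite /= (bounded_lin bB) (bounded_lin bA).
have [M M0 hM] := bounded_ge0 bA; have [N N0 hN] := bounded_ge0 bB.
exists (M * N) => x; apply: le_trans (hM _) _; rewrite -mulrA.
by rewrite ler_wpM2l.
Qed.

Lemma bounded_add A B : bounded_op A -> bounded_op B -> bounded_op (A + B).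
Proof.
move=> bA bB; split=> [c x y|].
  by rewrite !addfE (bounded_lin bB) (bounded_lin bA) scalerDr addrACA.
have [M M0 hM] := bounded_ge0 bA; have [N N0 hN] := bounded_ge0 bB.
exists (M + N) => x; apply: le_trans (vnormD _ _) _; rewrite mulrDl.
by rewrite lerD.
Qed.

Lemma bounded_scale c A : bounded_op A -> bounded_op (c *: A).
Proof.
move=> bA; split=> [d x y|].
  by rewrite !scalefE (bounded_lin bA) scalerDr !scalerA mulrC.
have [M M0 hM] := bounded_ge0 bA.
exists (Normc.normc c * M) => x; rewrite vnormZ -mulrA ler_wpM2l ?normc_ge0//.
Qed.

Lemma bounded_opp A : bounded_op A -> bounded_op (- A).
Proof. by move=> bA; rewrite -scaleN1r; exact: bounded_scale. Qed.

Lemma bounded_sub A B : bounded_op A -> bounded_op B -> bounded_op (A - B).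
Proof. by move=> bA bB; apply/bounded_add/bounded_opp. Qed.

(** Polarization: the form at [y + x] gives the sum of the two mixed terms, the form at
    [y + 'i *: x] their difference, hence each of them. *)
Lemma bounded_polar A B : linear A -> linear B ->
  (forall x, dot x (A x) = dot x (B x)) -> A = B.
Proof.
move=> lA lB h; apply/funext => x; apply: dot_ext => y.
have h1 := h (y + x); have h2 := h (y + 'i *: x).
move: h1 h2; rewrite (linD lA) (linD lB) (linD lA) (linD lB) (linZ lA) (linZ lB).
rewrite !dotDl !dotDr !dotZl !dotZr !h => h1 h2.
have e1 : dot y (A x) + dot x (A y) = dot y (B x) + dot x (B y).
  apply: (addrI (dot y (B y))); apply: (addIr (dot x (B x))).
  by move: h1; rewrite !addrA => h1; rewrite -!addrA in h1 *; exact: h1.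
have ci : ('i : R[i])^* = - 'i.
  by apply/eqP; rewrite eq_complex /= oppr0 !eqxx.
have e2 : dot y (A x) - dot x (A y) = dot y (B x) - dot x (B y).
  have : 'i * dot y (A x) + ('i)^* * dot x (A y) =
         'i * dot y (B x) + ('i)^* * dot x (B y) :> R[i].
    apply: (addrI (dot y (B y))).
    apply: (addIr (('i)^* * ('i * dot x (B x)))).
    by rewrite -!addrA in h2 *; exact: h2.
  rewrite ci !mulNr -!mulrBr => /mulfI; apply.
  by rewrite eq_complex/= oner_eq0 andbF.
have : 2 * dot y (A x) = 2 * dot y (B x).
  rewrite !mulr_natl !mulr2n.
  transitivity ((dot y (A x) + dot x (A y)) + (dot y (A x) - dot x (A y))); first by ring.
  by rewrite e1 e2; ring.
by move/mulfI; apply; rewrite pnatr_eq0.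
Qed.

Lemma adjoint_sym A B : adjoint_of A B -> adjoint_of B A.
Proof. by move=> h x y; rewrite dot_conj -h -dot_conj. Qed.

Lemma adjoint_comp A A' B B' : adjoint_of A A' -> adjoint_of B B' ->
  adjoint_of (A \o B) (B' \o A').
Proof. by move=> h h' x y /=; rewrite h h'. Qed.

Lemma adjoint_add A A' B B' : adjoint_of A A' -> adjoint_of B B' ->
  adjoint_of (A + B) (A' + B').
Proof. by move=> h h' x y; rewrite dotDl dotDr h h'. Qed.

Lemma adjoint_0 : adjoint_of (0 : V -> V) 0.
Proof. by move=> x y; rewrite dot0l dot0r. Qed.

Lemma adjoint_sub A A' B B' : adjoint_of A A' -> adjoint_of B B' ->
  adjoint_of (A - B) (A' - B').
Proof.
by move=> h h' x y; rewrite dotBl dotBr h h'.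
Qed.

Lemma adjoint_sum (I : Type) (r : seq I) (P : pred I) (F F' : I -> V -> V) :
  (forall i, adjoint_of (F i) (F' i)) ->
  adjoint_of (\sum_(i <- r | P i) F i) (\sum_(i <- r | P i) F' i).
Proof.
move=> h; elim/big_ind2: _ => [|A A' B B'|i _]; [exact: adjoint_0| |exact: h].
exact: adjoint_add.
Qed.

Lemma pos_real A x : pos_op A -> dot x (A x) = (complex.Re (dot x (A x)))%:C.
Proof. by move=> pA; exact: ge0_Re. Qed.

Lemma pos_add A B : pos_op A -> pos_op B -> pos_op (A + B).
Proof. by move=> pA pB x; rewrite dotDr addr_ge0. Qed.

Lemma pos_0 : pos_op (0 : V -> V).
Proof. by move=> x; rewrite dot0r. Qed.

Lemma pos_adj A A' : adjoint_of A A' -> pos_op (A' \o A).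
Proof. by move=> h x; rewrite /= -h dot_ge0. Qed.

Lemma proj_lin P : projection P -> linear P. Proof. by case; case. Qed.

Lemma proj_idem P x : projection P -> P (P x) = P x.
Proof. by case=> _ h _; exact: (congr1 (@^~ x) h). Qed.

Lemma proj_pos P : projection P -> pos_op P.
Proof. by move=> [_ h aP]; rewrite -h; exact: pos_adj. Qed.

Lemma proj_dot P x : projection P -> dot x (P x) = (nsq (P x))%:C.
Proof. by move=> pP; rewrite -dotxx; case: (pP) => _ _ ->; rewrite proj_idem. Qed.

Lemma proj_id : projection (id : V -> V).
Proof. by split=> //; exact: bounded_id. Qed.

Lemma proj_compl P : projection P -> projection (id - P).
Proof.
move=> pP; have [bP _ aP] := pP; split.
- exact: bounded_sub bounded_id bP.
- apply/funext => x.
  by rewrite /= !subfE (linB (bounded_lin bP)) proj_idem// subrr subr0.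
- exact: adjoint_sub.
Qed.

(** Two candidates differ by a vector of [W] that is orthogonal to [W]; closure under subtraction
    puts the difference in [W]. *)
Lemma proj_onto_eq (W : set V) P : bounded_op P ->
  (forall x, W (P x) /\ forall y, W y -> dot y (x - P x) = 0) ->
  (forall x y, W x -> W y -> W (x - y)) ->
  proj_onto W = P.
Proof.
move=> bP hP hW; apply: xget_unique => // P' [bP' hP'].
apply/funext => x; apply/eqP; rewrite -subr_eq0; apply/eqP/dot_eq0.
have WD : W (P' x - P x) by apply: hW; [apply: (hP' x).1|apply: (hP x).1].
have {2}-> : P' x - P x = (x - P x) - (x - P' x).
  by rewrite opprB [RHS]addrC addrA subrK.
by rewrite dotBr (hP x).2 ?(hP' x).2// subrr.
Qed.

End inner.

(** * Orthogonal decompositions and functional calculus *)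

(* Orthogonality is imposed pointwise; the last clause says that the ranges
   span a dense subspace. *)
Definition odec (R : realType) (V : innerType R) (I : eqType)
    (Q : I -> V -> V) : Prop :=
  [/\ forall i, projection (Q i),
      forall i j x, i != j -> Q i (Q j x) = 0
    & forall x, (forall i, Q i x = 0) -> x = 0].

Section odec_nat.
Context {R : realType} {V : innerType R} (cV : complete_inner V).
Variable Q : nat -> V -> V.
Hypothesis oQ : odec Q.
Implicit Types (x y : V) (N : nat).

Let pQ i : projection (Q i). Proof. by case: oQ. Qed.
Let lQ i : linear (Q i). Proof. exact: proj_lin. Qed.
Let bQ i : bounded_op (Q i). Proof. by case: (pQ i). Qed.
Let aQ i : adjoint_of (Q i) (Q i). Proof. by case: (pQ i). Qed.
Let tQ x : (forall i, Q i x = 0) -> x = 0. Proof. by case: oQ => _ _; exact. Qed.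

Lemma odec_dot i j x y : i != j -> dot (Q i x) (Q j y) = 0.
Proof. by move=> ij; rewrite aQ; case: oQ => _ -> //; rewrite dot0r. Qed.

Lemma odec_inj x y : (forall i, Q i x = Q i y) -> x = y.
Proof.
move=> h; apply/eqP; rewrite -subr_eq0; apply/eqP/tQ => i.
by rewrite (linB (lQ i)) h subrr.
Qed.

Let nsq_range (y : nat -> V) m n : (forall i, Q i (y i) = y i) ->
  nsq (\sum_(m <= i < n) y i) = \sum_(m <= i < n) nsq (y i).
Proof.
move=> hy; elim: n => [|n IH]; first by rewrite !big_geq// nsq0.
have [mn|mn] := leqP m n; last by rewrite !big_geq// nsq0.
rewrite !big_nat_recr//= nsqD IH.
suff -> : dot (\sum_(m <= i < n) y i) (y n) = 0 by rewrite mulr0 addr0.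
rewrite dot_suml big_nat_cond big1// => i /andP[/andP[_ ilt] _].
by rewrite -(hy i) -(hy n) odec_dot// ltn_eqF.
Qed.

(** The sums of squared norms increase and are bounded, so the partial sums are Cauchy and
    completeness supplies the vector. Vectors and operators with prescribed components are built
    from this. *)
Lemma odec_series (y : nat -> V) (C : R) : (forall i, Q i (y i) = y i) ->
  (forall N, \sum_(0 <= i < N) nsq (y i) <= C) ->
  exists2 l, vlim (fun N => \sum_(0 <= i < N) y i) l & forall i, Q i l = y i.
Proof.
move=> hy hC; pose s N : R := \sum_(0 <= i < N) nsq (y i).
have s_nd : {homo s : m n / (m <= n)%N >-> m <= n}.
  move=> m n mn; rewrite /s [leRHS](big_cat_nat (n := m))//= lerDl.
  by rewrite sumr_ge0// => i _; exact: nsq_ge0.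
have s_ub : has_ubound (range s) by exists C => _ [N _ <-]; exact: hC.
have /cvgrPdist_lt cs := nondecreasing_cvgn s_nd s_ub.
have s_le N : s N <= sup (range s) by apply: ub_le_sup => //; exists N.
have [l /vlimP hl] : exists l,
    vnorm (\sum_(0 <= i < p) y i - l) @[p --> \oo] --> (0 : R).
  apply: cV => e e0; have [N _ hN] := cs (e ^+ 2) (exprn_gt0 2 e0).
  exists N; have main p q : (N <= q)%N -> (q <= p)%N ->
      vnorm (\sum_(0 <= i < p) y i - \sum_(0 <= i < q) y i) < e.
    move=> Nq qp; have -> : \sum_(0 <= i < p) y i - \sum_(0 <= i < q) y i =
        \sum_(q <= i < p) y i.
      by apply/eqP; rewrite subr_eq addrC -big_cat_nat.
    rewrite vnormE nsq_range// -[ltRHS]ger0_norm; last exact: ltW.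
    rewrite -sqrtr_sqr ltr_sqrt ?exprn_gt0//.
    have -> : \sum_(q <= i < p) nsq (y i) = s p - s q.
      by apply/eqP; rewrite eq_sym subr_eq addrC -big_cat_nat.
    have := hN q Nq; rewrite /= ger0_norm ?subr_ge0//; have := s_le p; lra.
  move=> p q Np Nq; have [qp|/ltnW pq] := leqP q p; first exact: main.
  by rewrite vnormBC; exact: main.
exists l => // i; apply: vlim_unique (bounded_lim (bQ i) hl) _ => e e0.
exists i.+1 => p ip; rewrite /= (lin_sum (lQ i)).
rewrite (bigD1_seq i)/= ?iota_uniq// ?mem_index_iota//.
rewrite hy big1 ?addr0 ?subrr ?vnorm0// => j ji.
by rewrite -hy; case: oQ => _ -> //; rewrite eq_sym.
Qed.

Lemma odec_bessel N x : \sum_(0 <= i < N) nsq (Q i x) <= nsq x.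
Proof.
pose s := \sum_(0 <= i < N) Q i x.
have ds : dot x s = (nsq s)%:C.
  rewrite dot_sumr nsq_range => [|i]; last exact: proj_idem.
  by rewrite rmorph_sum; apply: eq_bigr => i _; exact: proj_dot.
have := nsq_ge0 (x - s).
rewrite /nsq dotBl !dotBr !ReB ds (dot_conj x s) conjC_Re ds/= -!/(nsq _).
by rewrite subrr subr0 subr_ge0 nsq_range// => i; exact: proj_idem.
Qed.

(** Bessel's inequality gives a limit with the components of [x], and the density clause of [odec]
    identifies it with [x]. *)
Lemma odec_sum x : vlim (fun N => \sum_(0 <= i < N) Q i x) x.
Proof.
have [i|N|l hl h] := @odec_series (fun i => Q i x) (nsq x).
- exact: proj_idem.
- exact: odec_bessel.
by have := hl; rewrite (odec_inj h).
Qed.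

Lemma odec_dot_lim x y (c : nat -> R) :
  (forall i, dot (Q i x) (Q i y) = (c i)%:C) ->
  dot x y = (complex.Re (dot x y))%:C /\
  (\sum_(0 <= i < N) c i @[N --> \oo] --> complex.Re (dot x y)).
Proof.
move=> hc; pose s N := \sum_(0 <= i < N) Q i y.
have ds N : dot x (s N) = (\sum_(0 <= i < N) c i)%:C.
  rewrite dot_sumr rmorph_sum; apply: eq_bigr => i _.
  by rewrite -(proj_idem y (pQ i)) -aQ; exact: hc.
have near_s e : 0 < e -> exists N, forall p, (N <= p)%N ->
    Normc.normc (dot x y - (\sum_(0 <= i < p) c i)%:C) < e.
  move=> e0; have x1 : 0 < vnorm x + 1 by rewrite ltr_wpDl ?vnorm_ge0.
  have [N hN] := odec_sum y (divr_gt0 e0 x1); exists N => p /hN.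
  rewrite ltr_pdivlMr// vnormBC => hp; rewrite -ds -dotBr.
  apply: le_lt_trans (dot_CS _ _) _; apply: le_lt_trans hp.
  by rewrite mulrC ler_wpM2l ?vnorm_ge0// lerDl.
split.
- apply/eqP; rewrite eq_complex/= eqxx/=; apply/eqP/normr0_eq0.
  apply: eq0_le_eps => // e /near_s[N /(_ N (leqnn N))]; apply: le_lt_trans.
  case: (dot x y) => a b/=; rewrite -sqrtr_sqr oppr0 addr0 ler_sqrt ?sqr_ge0//.
    by rewrite lerDr sqr_ge0.
  by rewrite addr_ge0 ?sqr_ge0.
- apply/cvgrPdist_lt => e /near_s[N hN]; exists N => // p /hN; apply: le_lt_trans.
  case: (dot x y) => a b/=; rewrite -sqrtr_sqr ler_sqrt.
    by rewrite lerDl sqr_ge0.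
  by rewrite addr_ge0 ?sqr_ge0.
Qed.

(** No scalar series is needed for complex coefficients: the truncated sums of the two pairs
    coincide, so the difference is controlled by the two tails. *)
Lemma odec_dot_eq x y x' y' :
  (forall i, dot (Q i x) (Q i y) = dot (Q i x') (Q i y')) -> dot x y = dot x' y'.
Proof.
move=> hx; apply/eqP; rewrite -subr_eq0; apply/eqP/Normc.eq0_normc.
apply: eq0_le_eps => [|e e0]; first exact: normc_ge0.
pose K := vnorm x + vnorm x' + 1.
have K0 : 0 < K by rewrite ltr_wpDl ?addr_ge0 ?vnorm_ge0.
have [N1 h1] := odec_sum y (divr_gt0 e0 K0).
have [N2 h2] := odec_sum y' (divr_gt0 e0 K0).
pose N := maxn N1 N2; have {h1} := h1 N (leq_maxl _ _).
have {h2} := h2 N (leq_maxr _ _).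
rewrite !ltr_pdivlMr//.
set u := \sum_(0 <= i < N) Q i y' - y'; set v := \sum_(0 <= i < N) Q i y - y.
move=> h2 h1; have -> : dot x y - dot x' y' = dot x' u + dot x (- v).
  rewrite dotNr !dotBr !dot_sumr.
  have -> : \sum_(0 <= i < N) dot x' (Q i y') = \sum_(0 <= i < N) dot x (Q i y).
    have dQ a b i : dot a (Q i b) = dot (Q i a) (Q i b) by rewrite aQ proj_idem.
    by apply: eq_bigr => i _; rewrite dQ [RHS]dQ hx.
  ring.
apply: le_lt_trans (ler_normcD _ _) _.
have c1 := dot_CS x' u; have c2 := dot_CS x (- v); rewrite vnormN in c2.
have := vnorm_ge0 x; have := vnorm_ge0 x'; have := vnorm_ge0 u; have := vnorm_ge0 v.
rewrite /K in h1 h2; have [uv|/ltW vu] := leP (vnorm u) (vnorm v) => *.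
  apply: le_lt_trans h1; nra.
apply: le_lt_trans h2; nra.
Qed.

Lemma odec_nneseries x y (c : nat -> R) : (forall i, 0 <= c i) ->
  (forall i, dot (Q i x) (Q i y) = (c i)%:C) ->
  (\sum_(0 <= i <oo) (c i)%:E = (complex.Re (dot x y))%:E)%E.
Proof.
move=> c0 /odec_dot_lim[_ cc]; rewrite -(cvg_lim _ cc)//.
rewrite -EFin_lim; last by apply/cvg_ex; eexists; exact: cc.
by congr (limn _); apply/funext => N; rewrite /= -sumEFin.
Qed.

Lemma odec_nsq x : (\sum_(0 <= i <oo) (nsq (Q i x))%:E = (nsq x)%:E)%E.
Proof. by apply: odec_nneseries => i; rewrite ?nsq_ge0 ?dotxx. Qed.

Lemma odec_leM (C : R) x y : 0 <= C ->
  (forall i, vnorm (Q i y) <= C * vnorm (Q i x)) -> vnorm y <= C * vnorm x.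
Proof.
move=> C0 h; rewrite vnorm_leM// -lee_fin EFinM -!odec_nsq -nneseriesZl; last first.
  by move=> i _; rewrite lee_fin nsq_ge0.
apply: lee_nneseries => i _; rewrite ?lee_fin ?nsq_ge0//.
by rewrite -vnorm_leM.
Qed.

Lemma odec_vec x (c : nat -> R) (C : R) :
  (forall N, \sum_(0 <= i < N) c i ^+ 2 * nsq (Q i x) <= C) ->
  exists y, forall i, Q i y = (c i)%:C *: Q i x.
Proof.
move=> hC; have [i|N|y _ hy] := @odec_series (fun i => (c i)%:C *: Q i x) C.
- by rewrite (linZ (lQ i)) proj_idem.
- apply: le_trans (hC N); rewrite le_eqVlt; apply/orP; left; apply/eqP.
  by apply: eq_bigr => i _; rewrite nsqZ normcR real_normK ?num_real.
by exists y.
Qed.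

Lemma odec_diag_ex (c : nat -> R) (C : R) : (forall i, `|c i| <= C) ->
  exists2 A, bounded_op A & forall i x, Q i (A x) = (c i)%:C *: Q i x.
Proof.
move=> hc; have C0 : 0 <= C := le_trans (normr_ge0 _) (hc 0%N).
have [A hA] : exists A, forall x i, Q i (A x) = (c i)%:C *: Q i x.
  have ex x : exists y, forall i, Q i y = (c i)%:C *: Q i x.
    apply: (@odec_vec _ _ (C ^+ 2 * nsq x)) => N.
    apply: le_trans (ler_wpM2l (sqr_ge0 C) (odec_bessel N x)).
    rewrite mulr_sumr; apply: ler_sum => i _; rewrite ler_wpM2r ?nsq_ge0//.
    by rewrite -(real_normK (num_real (c i))) ler_pXn2r// nnegrE.
  exists (fun x => xget 0 [set y | forall i, Q i y = (c i)%:C *: Q i x]) => x.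
  by have [y hy] := ex x; apply: (@xgetPex _ 0 [set y | forall i, _] (ex x)).
exists A => //; split=> [d x y|].
  apply: odec_inj => i; rewrite (lQ i) !hA (lQ i) scalerDr !scalerA.
  by rewrite mulrC.
exists C => x; apply: odec_leM => // i; rewrite hA vnormZ normcR.
by rewrite ler_wpM2r ?vnorm_ge0.
Qed.

End odec_nat.

(** * Existence and uniqueness of the spectral measure of a diagonal operator *)

Section spectral.
Context {R : realType} {V : innerType R} (cV : complete_inner V).
Variables (Q : nat -> V -> V) (lam : nat -> R) (D : partial_op V).
Hypothesis oQ : odec Q.
Hypothesis domD : forall x, dom D x <-> exists y, forall i, Q i y = (lam i)%:C *: Q i x.
Hypothesis appD : forall x, dom D x -> forall i, Q i (D x) = (lam i)%:C *: Q i x.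
Implicit Types (x y z : V) (B : set R).

Let pQ i : projection (Q i). Proof. by case: oQ. Qed.
Let lQ i : linear (Q i). Proof. exact: proj_lin. Qed.
Let aQ i : adjoint_of (Q i) (Q i). Proof. by case: (pQ i). Qed.

Let mu x : {measure set (measurableTypeR R) -> \bar R} :=
  mseries (fun i => [the measure (measurableTypeR R) R of
    mscale (NngNum (nsq_ge0 (Q i x))) (dirac (lam i : measurableTypeR R))]) 0.

Let mu_integral x (f : R -> R) : measurable_fun setT f -> (forall t, 0 <= f t) ->
  (\int[mu x]_l (f l)%:E = \sum_(0 <= i <oo) (nsq (Q i x) * f (lam i))%:E)%E.
Proof.
move=> mf f0; have mfE : measurable_fun setT (fun l : measurableTypeR R => (f l)%:E).
  exact/measurable_EFinP.
rewrite ge0_integral_measure_series//=; last by move=> t _; rewrite lee_fin.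
apply: eq_eseriesr => i _; rewrite ge0_integral_mscale//=; last first.
  by move=> t _; rewrite lee_fin.
by rewrite integral_dirac//= diracT mul1e EFinM.
Qed.

Let mu_set x B : measurable B ->
  mu x B = (\sum_(0 <= i <oo) (nsq (Q i x) * \1_B (lam i))%:E)%E.
Proof. by move=> mB; apply: eq_eseriesr => i _; rewrite EFinM. Qed.

(** Positive and negative part of [f] are integrated apart, since the termwise formula is for
    nonnegative functions. Each part is dominated by the modulus of [f], so Bessel's inequality for
    [y] provides a vector with the corresponding components. *)
Let mu_vec x y (f : R -> R) : measurable_fun setT f ->
  (forall i, Q i y = (f (lam i))%:C *: Q i x) ->
  dot x y = (\int[mu x]_l f l)%:C.
Proof.
move=> mf hy.
have part (g : R -> R) : measurable_fun setT g -> (forall t, 0 <= g t) ->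
    (forall t, g t <= `|f t|) ->
    exists2 z, forall i, Q i z = (g (lam i))%:C *: Q i x &
      dot x z = (complex.Re (dot x z))%:C /\
      (\int[mu x]_l (g l)%:E = (complex.Re (dot x z))%:E)%E.
  move=> mg g0 gf.
  have [N|z hz] := @odec_vec _ _ cV _ oQ x (g \o lam) (nsq y).
    apply: le_trans (odec_bessel oQ N y); apply: ler_sum => i _.
    rewrite hy nsqZ ler_wpM2r ?nsq_ge0// normcR/=.
    by rewrite ler_pXn2r ?nnegrE.
  have hc i : dot (Q i x) (Q i z) = (nsq (Q i x) * g (lam i))%:C.
    by rewrite hz dotZr dotxx mulrC rmorphM.
  exists z => //; split; first by case: (odec_dot_lim cV oQ hc).
  rewrite mu_integral// (odec_nneseries cV oQ _ hc)// => i.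
  by rewrite mulr_ge0 ?nsq_ge0.
have [|t|t|yp hyp [rp ip]] := part (f^\+)%R.
- exact: measurable_funrpos.
- exact: funrpos_ge0.
- by rewrite /funrpos ge_max ler_norm normr_ge0.
have [|t|t|yn hyn [rn inn]] := part (f^\-)%R.
- exact: measurable_funrneg.
- exact: funrneg_ge0.
- by rewrite /funrneg ge_max -normrN ler_norm normr_ge0.
have -> : y = yp - yn.
  apply: (odec_inj oQ) => i; rewrite (linB (lQ i)) hy hyp hyn -scalerBl -rmorphB/=.
  congr (_%:C *: _); rewrite /funrpos /funrneg /=.
  have [f0|/ltW f0] := leP (f (lam i)) 0.
    by rewrite max_l ?oppr_ge0// sub0r opprK.
  by rewrite max_r ?oppr_le0// subr0.
pose fE (l : measurableTypeR R) := (f l)%:E.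
have ep : (\int[mu x]_l (fE^\+ l) = (complex.Re (dot x yp))%:E)%E.
  by rewrite -ip; apply: eq_integral => t _; rewrite funeposE /funrpos EFin_max.
have en : (\int[mu x]_l (fE^\- l) = (complex.Re (dot x yn))%:E)%E.
  by rewrite -inn; apply: eq_integral => t _; rewrite funenegE /funrneg EFin_max.
by rewrite /Rintegral integralE ep en dotBr rp rn -rmorphB.
Qed.

Let projB_ex : exists E : set R -> V -> V, forall B, bounded_op (E B) /\
  forall i x, Q i (E B x) = ((\1_B (lam i) : R))%:C *: Q i x.
Proof.
have ex B : exists A, bounded_op A /\
    forall i x, Q i (A x) = ((\1_B (lam i) : R))%:C *: Q i x.
  have [i|A bA hA] := @odec_diag_ex _ _ cV _ oQ (\1_B \o lam) 1; last by exists A.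
  by rewrite /= indicE; case: (_ \in _); rewrite ?normr1 ?normr0.
by exists (fun B => projT1 (cid (ex B))) => B; exact: (projT2 (cid (ex B))).
Qed.

Lemma diag_spectral_measure : exists (E : set R -> V -> V)
    (m : V -> {measure set (measurableTypeR R) -> \bar R}),
  [/\ spectral_measure E m D,
      forall B i x, Q i (E B x) = (\1_B (lam i) : R)%:C *: Q i x
    & forall x y (f : R -> R), measurable_fun setT f ->
        (forall i, Q i y = (f (lam i))%:C *: Q i x) ->
        dot x y = (\int[m x]_l f l)%:C].
Proof.
have [E hE] := projB_ex; exists E, mu; split; [|by move=> B; apply: (hE B).2|exact: mu_vec].
have bE B := (hE B).1; have qE B := (hE B).2.
have QI B B' : E (B `&` B') = E B \o E B'.
  apply/funext => x; apply: (odec_inj oQ) => i.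
  by rewrite /= !qE scalerA -rmorphM/= indicI.
split.
- split=> //.
  + move=> B mB; split => //; first by rewrite -QI setIid.
    move=> x y.
    apply: (odec_dot_eq cV oQ) => i.
    by rewrite !qE dotZl dotZr conjC_real.
  + apply/funext => x; apply: (odec_inj oQ) => i.
    by rewrite qE indicT scale1r.
  + move=> x B mB; rewrite mu_set//; apply: (odec_nneseries cV oQ) => i.
      by rewrite mulr_ge0 ?nsq_ge0.
    by rewrite qE dotZr dotxx mulrC rmorphM.
- apply/seteqP; split=> x /=.
  + move/domD => [y hy]; rewrite (mu_integral x (f := fun l => l ^+ 2)).
    * rewrite (@eq_eseriesr _ _ (fun i => (nsq (Q i y))%:E)); last first.
        by move=> i _; rewrite hy nsqZ normcR real_normK ?num_real// mulrC.
      by rewrite (odec_nsq cV oQ) ltry.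
    * exact: measurable_funX.
    * by move=> t; exact: sqr_ge0.
  + rewrite (mu_integral x (f := fun l => l ^+ 2)); last 2 first.
    * exact: measurable_funX.
    * by move=> t; exact: sqr_ge0.
    move=> fin; apply/domD; have nn i : (0 <= (nsq (Q i x) * lam i ^+ 2)%:E)%E.
      by rewrite lee_fin mulr_ge0 ?nsq_ge0 ?sqr_ge0.
    set s := (\sum_(0 <= i <oo) _)%E in fin.
    have sf : s \is a fin_num by rewrite ge0_fin_numE// nneseries_ge0.
    apply: (@odec_vec _ _ cV _ oQ x lam (fine s)) => N.
    rewrite -lee_fin fineK// -sumEFin.
    apply: le_trans (nneseries_lim_ge N _) => //=.
    by apply: lee_sum => i _; rewrite mulrC.
- move=> x dx; rewrite (@mu_vec x (D x) id)//; exact: appD.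
Qed.

Let domZ c x : dom D x -> dom D (c *: x).
Proof.
move=> /domD[y hy]; apply/domD; exists (c *: y) => i.
by rewrite !(linZ (lQ i)) hy !scalerA mulrC.
Qed.

Let domDD x y : dom D x -> dom D y -> dom D (x + y).
Proof.
move=> /domD[x' hx] /domD[y' hy]; apply/domD; exists (x' + y') => i.
by rewrite !(linD (lQ i)) hx hy scalerDr.
Qed.

Let DZ c x : dom D x -> D (c *: x) = c *: D x.
Proof.
move=> dx; apply: (odec_inj oQ) => i; rewrite appD ?(linZ (lQ i)) ?appD//.
  by rewrite !scalerA mulrC.
exact: domZ.
Qed.

Let DD x y : dom D x -> dom D y -> D (x + y) = D x + D y.
Proof.
move=> dx dy; apply: (odec_inj oQ) => i; rewrite appD ?(linD (lQ i)) ?appD//.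
  by rewrite scalerDr.
exact: domDD.
Qed.

Let symD x y : dom D x -> dom D y -> dot (D x) y = dot x (D y).
Proof.
move=> dx dy; apply: (odec_dot_eq cV oQ) => i.
by rewrite !appD// dotZl dotZr conjC_real.
Qed.

Section uniqueness.
Variables (E : set R -> V -> V)
  (m : V -> {measure set (measurableTypeR R) -> \bar R}).
Hypothesis sE : spectral_measure E m D.

Let pE B : measurable B -> projection (E B).
Proof. by case: sE => -[+ _ _ _] _ _; exact. Qed.

Let EI B B' : measurable B -> measurable B' -> E (B `&` B') = E B \o E B'.
Proof. by case: sE => -[_ _ + _] _ _; exact. Qed.

Let mE x B : measurable B -> m x B = (nsq (E B x))%:E.
Proof.
move=> mB; case: sE => -[_ _ _ h] _ _; rewrite h//.
by rewrite proj_dot//; exact: pE.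
Qed.

Let E0 x : E set0 x = 0.
Proof. by apply: nsq_eq0; have := mE x measurable0; rewrite measure0 => -[]. Qed.

(** Additivity of the measures [m v] gives equality of quadratic forms, and polarization makes it an
    equality of operators. *)
Let EC B x : measurable B -> E (~` B) x = x - E B x.
Proof.
move=> mB; have mB' := measurableC mB.
have h : E (~` B) = id - E B.
  apply: bounded_polar; [exact/proj_lin/pE|exact/proj_lin/proj_compl/pE|] => v.
  rewrite subfE dotBr (proj_dot v (pE mB')) (proj_dot v (pE mB)) dotxx.
  rewrite -rmorphB/=; congr _%:C.
  have : m v setT = (m v B + m v (~` B))%E.
    rewrite -measureU ?setUv ?setICr//.
  have -> : m v setT = (nsq v)%:E by rewrite mE//; case: sE => -[_ -> _ _] _ _.
  by rewrite !mE// -EFinD => -[->]; rewrite addrC addKr.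
by rewrite h subfE.
Qed.

Let E_cross B C x : measurable B -> measurable C -> E B (E C (E (~` B) x)) = 0.
Proof.
move=> mB mC; have mB' := measurableC mB.
have := congr1 (@^~ x) (EI (measurableI _ _ mB mC) mB').
rewrite (EI mB mC) /= => <-; rewrite (_ : _ `&` _ = set0) ?E0//.
by apply/seteqP; split=> // l [[? ?] ?].
Qed.

(** The two pieces remain orthogonal under [E C], so the measure does not see the phase [c]. *)
Let m_split B x c C : measurable B -> measurable C -> Normc.normc c = 1 ->
  m (E B x + c *: E (~` B) x) C = (m (E B x) C + m (E (~` B) x) C)%E.
Proof.
move=> mB mC c1; have lC := proj_lin (pE mC); have mB' := measurableC mB.
rewrite !mE// (linD lC) (linZ lC) nsqD nsqZ c1 expr1n mul1r dotZr.
suff -> : dot (E C (E B x)) (E C (E (~` B) x)) = 0 by rewrite mulr0 mulr0 addr0.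
have [_ _ aC] := pE mC; have [_ _ aB] := pE mB.
by rewrite aC proj_idem; [rewrite aB E_cross// dot0r|exact: pE].
Qed.

Let m_fin x : fin_num_fun (m x).
Proof. by move=> B mB; rewrite mE. Qed.

Let id_integrable y : dom D y -> (m y).-integrable setT (EFin \o id).
Proof.
move=> dy; have mid : measurable_fun setT (fun l : measurableTypeR R => l%:E).
  exact/measurable_EFinP.
have msq : measurable_fun setT (fun l : measurableTypeR R => (l ^+ 2)%:E).
  exact/measurable_EFinP/measurable_funX.
apply/integrableP; split=> //.
have fy : (\int[m y]_l (l ^+ 2)%:E < +oo)%E.
  by case: sE => _ + _; move=> dE; move: dy; rewrite dE.
apply: (@le_lt_trans _ _ (\int[m y]_l ((1 : R)%:E + (l ^+ 2)%:E))%E).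
  apply: ge0_le_integral => //=; first exact: measurableT_comp.
    exact: emeasurable_funD.
  move=> l _; rewrite -EFinD lee_fin.
  have [l1|l1] := leP `|l| 1; first by have := sqr_ge0 l; lra.
  by rewrite -(real_normK (num_real l)); nra.
rewrite ge0_integralD//=; last by move=> l _; rewrite lee_fin sqr_ge0.
by rewrite lte_add_pinfty// integral_cst//= mul1e ltey_eq m_fin.
Qed.

Section eigenvector.
Variables (j : nat) (x : V) (B : set R).
Hypotheses (Qx : Q j x = x) (mB : measurable B).
Let mB' := measurableC mB.
Let y := E B x.
Let z := E (~` B) x.

Let xyz : y + z = x. Proof. by rewrite /z EC// addrC subrK. Qed.

Let DjE : dom D x /\ D x = (lam j)%:C *: x.
Proof.
have h i : Q i ((lam j)%:C *: x) = (lam i)%:C *: Q i x.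
  rewrite (linZ (lQ i)) -Qx; have [->//|ij] := eqVneq i j.
  by case: oQ => _ -> // _; rewrite !scaler0.
have dx : dom D x by apply/domD; exists ((lam j)%:C *: x).
by split=> //; apply: (odec_inj oQ) => i; rewrite appD.
Qed.

Let dom_yz : dom D y /\ dom D z.
Proof.
have [dx _] := DjE; move: (dx); case: sE => _ dE _; rewrite dE/=.
have -> : (\int[m x]_l (l ^+ 2)%:E =
           \int[m y]_l (l ^+ 2)%:E + \int[m z]_l (l ^+ 2)%:E)%E.
  rewrite -ge0_integral_measure_add//=.
  - apply: eq_measure_integral => C mC _.
    have := m_split x mB mC (Normc.normc1 R); rewrite scale1r -/y -/z xyz => ->.
    exact/esym/measure_addE.
  - by move=> t _; rewrite lee_fin sqr_ge0.
  - exact/measurable_EFinP/measurable_funX.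
have n0 v : (0 <= \int[m v]_l (l ^+ 2)%:E)%E.
  by apply: integral_ge0 => l _; rewrite lee_fin sqr_ge0.
move=> h; split; apply: le_lt_trans h; rewrite /=; [exact: leeDl|exact: leeDr].
Qed.

Let int_split c : Normc.normc c = 1 ->
  dot (y + c *: z) (D (y + c *: z)) = dot y (D y) + dot z (D z).
Proof.
move=> c1; have [dy dz] := dom_yz; have dw := domDD dy (domZ c dz).
case: sE => _ _ iE; rewrite !iE// -rmorphD/=; congr _%:C.
rewrite /Rintegral -fineD; [|exact: integrable_fin_num (id_integrable _)..].
congr fine; rewrite -integral_measure_add//; [|exact: id_integrable..].
by apply: eq_measure_integral => C mC _; rewrite m_split//; exact/esym/measure_addE.
Qed.

(** It is not known beforehand that [E B] commutes with [D], only the domain and the quadratic form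
    being prescribed. The form at [y + c *: z] is the same for every [c] of modulus 1; the choices
    [c = 1] and [c = 'i] remove the real and the imaginary part of the cross term. *)
Let cross0 : dot y (D z) = 0.
Proof.
have [dy dz] := dom_yz; set w := dot y (D z).
have h c : Normc.normc c = 1 -> c * w + (c * w)^* = 0.
  move=> c1; have := int_split c1; rewrite DD//; last exact: domZ.
  rewrite DZ// dotDl !dotDr !dotZl !dotZr -/w.
  have -> : dot z (D y) = w^* by rewrite -symD// -dot_conj.
  rewrite (mulrA c^* c) -normCKC normcC c1 expr1n mul1r conjCM => e.
  apply: (addrI (dot y (D y))); apply: (addIr (dot z (D z))); rewrite addr0.
  by rewrite -e; ring.
have h1 := h 1 (Normc.normc1 R); rewrite !mul1r in h1.
have := h 'i; rewrite /= expr0n add0r expr1n sqrtr1 => /(_ erefl).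
move: h1; clear h; case: w => a b /eqP; rewrite eq_complex/= => /andP[/eqP h1 _].
move=> /eqP; rewrite eq_complex/= => /andP[/eqP h2 _].
by apply/eqP; rewrite eq_complex/=; apply/andP; split; apply/eqP; lra.
Qed.

Let int_y : \int[m y]_l l = lam j * nsq y.
Proof.
have [dy dz] := dom_yz; have [dx Dx] := DjE.
have : dot y (D x) = dot y (D y) by rewrite -xyz DD// dotDr cross0 addr0.
rewrite Dx dotZr; case: sE => _ _ iE; rewrite iE//.
have [_ _ aB] := pE mB.
have -> : dot y x = (nsq y)%:C by rewrite aB proj_dot//; exact: pE.
by rewrite -rmorphM/= => /complexI.
Qed.

(** For [e = 1] or [e = -1], [B] is an open half-line ending at the eigenvalue. By [int_y],
    [e * (l - lam j)] has integral 0 against the measure of [y]; this measure is carried by [B],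
    where the integrand is positive, so it vanishes. *)
Lemma eigen_half (e : R) : B = [set l | 0 < e * (l - lam j)] -> E B x = 0.
Proof.
move=> BE; apply: nsq_eq0; have [dy dz] := dom_yz.
have mg : measurable_fun setT (fun l : measurableTypeR R => (e * (l - lam j))%:E).
  apply/measurable_EFinP; apply: measurable_funM => //.
  exact: measurable_funB.
have iid := id_integrable dy.
have ig : (\int[m y]_l (e * (l - lam j))%:E = 0)%E.
  have icst : (m y).-integrable setT (EFin \o cst (lam j)).
    apply/integrableP; split; first exact/measurable_EFinP/measurable_cst.
    by rewrite /= integral_cst// lte_mul_pinfty// ltey_eq m_fin.
  have -> : (fun l : measurableTypeR R => (e * (l - lam j))%:E) =
     (fun l => e%:E * ((EFin \o id) l - (EFin \o cst (lam j)) l))%E by [].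
  rewrite integralZl//; last exact: integrableB.
  rewrite integralB// /= integral_cst//.
  have -> : (\int[m y]_l l%:E = (lam j * nsq y)%:E)%E.
    by rewrite -int_y /Rintegral fineK//; exact: (integrable_fin_num _ iid).
  rewrite mE//.
  have -> : E setT y = y by case: sE => -[_ -> _ _] _ _.
  by rewrite [X in (_ * X)%E](_ : _ = 0%E) ?mule0// EFinM subee.
have mz : m y (~` B) = 0%E.
  rewrite mE// /y.
  have := congr1 (@^~ x) (EI mB' mB); rewrite /= => <-.
  by rewrite setICl E0 nsq0.
have iabs : (\int[m y]_l `|(e * (l - lam j))%:E| = 0)%E.
  rewrite -ig; apply: ae_eq_integral => //; first exact: measurableT_comp.
  exists (~` B); split => // l /= h Bl; apply: h => _.
  by rewrite gtr0_norm//; move: Bl; rewrite BE.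
have [/(_ iabs) [N [mN N0 hN]] _] := ae_eq_integral_abs (m y) measurableT mg.
suff : (m y B <= 0)%E.
  rewrite mE// lee_fin proj_idem; last exact: pE.
  by move=> h; apply/eqP; rewrite eq_le h nsq_ge0.
rewrite -N0; apply: le_measure; rewrite ?inE// => l Bl; apply: hN => /= h.
by have := h I => -[] h0; move: Bl; rewrite BE /= h0 ltxx.
Qed.

End eigenvector.

(** The complement of the point [lam i] is the union of two half-lines as in [eigen_half], so [E] of
    that point fixes the range of [Q i]. Multiplicativity then evaluates [E B] on this range, and
    self-adjointness moves [Q i] to the front. *)
Lemma spectral_measure_diag B i x : measurable B ->
  Q i (E B x) = (\1_B (lam i) : R)%:C *: Q i x.
Proof.
move=> mB; have key v : E [set lam i] (Q i v) = Q i v.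
  have Qv : Q i (Q i v) = Q i v by exact: proj_idem.
  pose Bs (e : R) : set R := [set l | 0 < e * (l - lam i)].
  have mBs e : measurable (Bs e).
    rewrite -[Bs e]setTI.
    have : measurable_fun setT (fun l : measurableTypeR R => e * (l - lam i)).
      by apply: measurable_funM => //; exact: measurable_funB.
    move=> /(_ measurableT `]0, +oo[%classic (measurable_itv _)).
    by congr (measurable (_ `&` _)); apply/seteqP; split=> l /=; rewrite in_itv/= andbT.
  have hs e : E (Bs e) (Q i v) = 0 by exact: (eigen_half Qv (mBs e)).
  apply/eqP; rewrite -subr_eq0 -opprB oppr_eq0 -EC//; apply/eqP/nsq_eq0.
  have : m (Q i v) (~` [set lam i]) = 0%E.
    have -> : ~` [set lam i] = Bs 1 `|` Bs (-1).
      apply/seteqP; split=> l /=.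
        move=> /eqP; rewrite neq_lt => /orP[h|h]; [right|left]; rewrite /Bs/=; lra.
      by case; rewrite /Bs/= => h; apply/eqP; rewrite neq_lt; apply/orP; [right|left]; lra.
    apply/eqP; rewrite eq_le measure_ge0 andbT.
    have h e : m (Q i v) (Bs e) = 0%E by rewrite mE// hs nsq0.
    apply: (@le_trans _ _ (m (Q i v) (Bs 1%R) + m (Q i v) (Bs (-1)%R))%E).
      by apply: measureU2; exact: mBs.
    by rewrite !h adde0.
  by rewrite mE; [case|exact: measurableC].
have key2 v : E B (Q i v) = (\1_B (lam i) : R)%:C *: Q i v.
  rewrite -{1}key; have := congr1 (@^~ (Q i v)) (EI mB (measurable_set1 (lam i))).
  rewrite /= => <-; rewrite indicE; case: (asboolP (B (lam i))) => Bi.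
    rewrite mem_set// scale1r (_ : _ `&` _ = [set lam i]) ?key//.
    by apply/seteqP; split => l /= => [[]|->].
  rewrite memNset// scale0r (_ : _ `&` _ = set0) ?E0//.
  by apply/seteqP; split => l /= => [[Bl lE]|//]; move: Bi; rewrite -lE.
apply: dot_ext => w; have [_ _ aB] := pE mB.
by rewrite -aQ -aB key2 dotZl conjC_real aQ dotZr.
Qed.

End uniqueness.

Lemma fcalc_diag (f : R -> R) A : measurable_fun setT f -> bounded_op A ->
  (forall i x, Q i (A x) = (f (lam i))%:C *: Q i x) -> fcalc D f = A.
Proof.
move=> mf bA hA; have [E [m [sE qE hm]]] := diag_spectral_measure.
apply: xget_unique; first by split=> //; exists E, m; split=> // x; exact: hm.
move=> A' [bA' [E' [m' [sE' hA']]]]; apply: bounded_polar.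
- exact: bounded_lin.
- exact: bounded_lin.
move=> x; rewrite hA' (hm x (A x) f)//; congr (fine _)%:C.
apply: eq_measure_integral => B mB _.
have [[_ _ _ h'] _ _] := sE'; have [[_ _ _ h] _ _] := sE.
rewrite h// h'//; congr (complex.Re (dot _ _))%:E.
by apply: (odec_inj oQ) => i; rewrite qE (spectral_measure_diag sE').
Qed.

End spectral.

Lemma proj_0 (R : realType) (V : innerType R) : projection (0 : V -> V).
Proof. by split; [exact: bounded_0|exact/funext|exact: adjoint_0]. Qed.

(** * Decompositions over countable index sets *)

Section odec_count.
Context {R : realType} {V : innerType R} (cV : complete_inner V) {I : countType}.
Variable Q : I -> V -> V.
Hypothesis oQ : odec Q.
Implicit Types (x y : V) (c : I -> R).

(** Numbers that are not codes get the zero projection, so the results for sequences apply to any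
    countable index set. *)
Let Qn m : V -> V := if pickle_inv m is Some i then Q i else 0.

Let QnE i : Qn (pickle i) = Q i.
Proof. by rewrite /Qn pickleK_inv. Qed.

Let oQn : odec Qn.
Proof.
case: oQ => pQ orQ tQ; split=> [m|m m' x mm'|x hx].
- by rewrite /Qn; case: pickle_inv => [i|]; [exact: pQ|exact: proj_0].
- rewrite /Qn; have := @pickle_invK I m; have := @pickle_invK I m'.
  case: (pickle_inv m') => [j|] /= j'; case: (pickle_inv m) => [i|] //= i'.
    by apply: orQ; apply: contraNneq mm' => ij; rewrite -i' -j' ij.
  exact/lin0/proj_lin.
- by apply: tQ => i; rewrite -QnE.
Qed.

Lemma odec_eq x y : (forall i, Q i x = Q i y) -> x = y.
Proof.
move=> h; apply: (odec_inj oQn) => m; rewrite /Qn.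
by case: pickle_inv.
Qed.

Lemma odec_norm_le (C : R) x y : 0 <= C ->
  (forall i, vnorm (Q i y) <= C * vnorm (Q i x)) -> vnorm y <= C * vnorm x.
Proof.
move=> C0 h; apply: (odec_leM cV oQn C0) => m; rewrite /Qn.
by case: pickle_inv => //; rewrite vnorm0 mulr_ge0// vnorm_ge0.
Qed.

Lemma odec_adj x y x' y' :
  (forall i, dot (Q i x) (Q i y) = dot (Q i x') (Q i y')) -> dot x y = dot x' y'.
Proof.
move=> h; apply: (odec_dot_eq cV oQn) => m; rewrite /Qn.
by case: pickle_inv => //; rewrite !dot0r.
Qed.

Definition odiag c : V -> V := xget 0 [set A | bounded_op A /\
  forall i x, Q i (A x) = (c i)%:C *: Q i x].

Lemma odiagP c (C : R) : (forall i, `|c i| <= C) -> bounded_op (odiag c) /\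
  forall i x, Q i (odiag c x) = (c i)%:C *: Q i x.
Proof.
move=> hc; pose cn m : R := if pickle_inv m is Some i then c i else 0.
suff ex : exists A, bounded_op A /\ forall i x, Q i (A x) = (c i)%:C *: Q i x.
  exact: (xgetPex 0 ex).
have [m|A bA hA] := @odec_diag_ex _ _ cV _ oQn cn `|C|.
  rewrite /cn; case: pickle_inv => [i|]; last by rewrite normr0.
  exact: le_trans (hc i) (ler_norm _).
by exists A; split=> // i x; have := hA (pickle i) x; rewrite QnE /cn pickleK_inv.
Qed.

Lemma odec_fcalc (D : partial_op V) (lam : I -> R) (f : R -> R) A :
  (forall x, dom D x <-> exists y, forall i, Q i y = (lam i)%:C *: Q i x) ->
  (forall x, dom D x -> forall i, Q i (D x) = (lam i)%:C *: Q i x) ->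
  measurable_fun setT f -> bounded_op A ->
  (forall i x, Q i (A x) = (f (lam i))%:C *: Q i x) -> fcalc D f = A.
Proof.
move=> domD appD mf bA hA.
pose ln m : R := if pickle_inv m is Some i then lam i else 0.
have tr (g : R -> R) x y : (forall i, Q i y = (g (lam i))%:C *: Q i x) ->
    forall m, Qn m y = (g (ln m))%:C *: Qn m x.
  by move=> h m; rewrite /Qn /ln; case: pickle_inv => //; rewrite scaler0.
apply: (@fcalc_diag _ _ cV Qn ln) => //.
- move=> x; rewrite domD; split=> -[y hy]; exists y; first exact: (tr id).
  by move=> i; have := hy (pickle i); rewrite QnE /ln pickleK_inv.
- by move=> x dx; apply: (tr id); exact: appD.
- by move=> m x; exact: tr.
Qed.

End odec_count.

(** * The Cuntz algebra and its GNS space *)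

Section cstar.
Context {R : realType} {O : cstarType R}.
Implicit Types a b : O.

Lemma star0 : star (0 : O) = 0.
Proof. by apply: (addrI (star 0)); rewrite -starD !addr0. Qed.

Lemma star1 : star (1 : O) = 1.
Proof. by rewrite -[LHS]mulr1 -{2}(starK 1) -starM mulr1 starK. Qed.

Lemma starN a : star (- a) = - star a.
Proof. by apply: (addrI (star a)); rewrite -starD !subrr star0. Qed.

Lemma star_sum (I : Type) (r : seq I) (P : pred I) (F : I -> O) :
  star (\sum_(i <- r | P i) F i) = \sum_(i <- r | P i) star (F i).
Proof. by elim/big_rec2: _ => [|i x y _ <-]; rewrite ?starD ?star0. Qed.

Lemma cnorm0 : cnorm (0 : O) = 0.
Proof. by rewrite -(scale0r 0) cnormZ Normc.normc0 mul0r. Qed.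

Lemma cnormN a : cnorm (- a) = cnorm a.
Proof. by rewrite -scaleN1r cnormZ normcN Normc.normc1 mul1r. Qed.

Lemma cnorm_ge0 a : 0 <= cnorm a.
Proof.
have := cnormD a (- a); rewrite subrr cnorm0 cnormN -mulr2n -mulr_natl.
by rewrite pmulr_rge0.
Qed.

Lemma cnorm_star a : cnorm (star a) = cnorm a.
Proof.
have h b : cnorm b <= cnorm (star b).
  have [->|b0] := eqVneq (cnorm b) 0; first exact: cnorm_ge0.
  have b1 : 0 < cnorm b by rewrite lt_neqAle eq_sym b0 cnorm_ge0.
  by rewrite -(ler_pM2r b1) -expr2 -cnorm_starM; exact: cnormM.
by apply/eqP; rewrite eq_le h -{2}(starK a) h.
Qed.

Lemma cnormB a b : cnorm (a - b) <= cnorm a + cnorm b.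
Proof. by rewrite -(cnormN b); exact: cnormD. Qed.

Lemma cnormBC a b : cnorm (a - b) = cnorm (b - a).
Proof. by rewrite -cnormN opprB. Qed.

Lemma cnorm_sum (I : Type) (r : seq I) (P : pred I) (F : I -> O) :
  cnorm (\sum_(i <- r | P i) F i) <= \sum_(i <- r | P i) cnorm (F i).
Proof.
elim/big_rec2: _ => [|i x y _ h]; first by rewrite cnorm0.
by apply: le_trans (cnormD _ _) _; rewrite lerD2l.
Qed.

Lemma cnorm_eps (K : R) a : (forall e : R, 0 < e -> cnorm a <= K * e) -> a = 0.
Proof.
move=> h; apply/cnorm_eq0/eq0_le_eps => [|e e0]; first exact: cnorm_ge0.
have K0 : 0 < `|K| + 1 by rewrite ltr_wpDl.
have := h _ (divr_gt0 e0 K0); move/le_lt_trans; apply.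
rewrite mulrA ltr_pdivrMr// mulrC ltr_pM2l//.
by apply: le_lt_trans (ler_norm _) _; rewrite ltrDl.
Qed.

End cstar.

Section cuntz_words.
Context {R : realType} {n : nat} (G : cuntz_system R n).
Local Notation O := (cs_O G).
Local Notation S := (cs_S G).
Local Notation gm := (cs_gauge G).
Local Notation Fix := (fixed_algebra (cs_gauge G)).
Local Notation tau := (cs_tau G).
Local Notation w2 := (word2 (cs_S G)).
Local Notation wd := (word (cs_S G)).
Local Notation Onc := (Onc (cs_S G)).
Implicit Types (a b f : O) (mu nu al be : seq 'I_n) (z : R[i]).

Lemma star_SS i : star (S i) * S i = 1.
Proof. by have [h _ _] := cs_cuntz G. Qed.

Lemma sum_SS : \sum_(i < n) S i * star (S i) = 1.
Proof. by have [_ h _] := cs_cuntz G. Qed.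

Lemma gauge_lin z : unit_circle z -> linear (gm z).
Proof. by case: (cs_gaugeP G) => h _ _ _ _ /h[]. Qed.

Lemma gaugeM z a b : unit_circle z -> gm z (a * b) = gm z a * gm z b.
Proof. by case: (cs_gaugeP G) => h _ _ _ _ /h[]. Qed.

Lemma gauge_star z a : unit_circle z -> gm z (star a) = star (gm z a).
Proof. by case: (cs_gaugeP G) => h _ _ _ _ /h[]. Qed.

Lemma gauge_norm z a : unit_circle z -> cnorm (gm z a) = cnorm a.
Proof. by case: (cs_gaugeP G) => h _ _ _ _ /h[]. Qed.

Lemma gauge_S z j : unit_circle z -> gm z (S j) = z *: S j.
Proof. by case: (cs_gaugeP G) => _ _ _ _; apply. Qed.

Lemma unit_circleP z : unit_circle z -> z^* * z = 1.
Proof. by rewrite /unit_circle => h; rewrite -normCKC normcC h expr1n. Qed.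

Lemma gauge1 z : unit_circle z -> gm z 1 = 1.
Proof.
move=> hz; rewrite -sum_SS (lin_sum (gauge_lin hz)); apply: eq_bigr => i _.
rewrite gaugeM// gauge_star// gauge_S// starZ -scalerAl -scalerAr scalerA.
by rewrite mulrC unit_circleP// scale1r.
Qed.

Lemma Fix1 : Fix 1. Proof. by move=> z hz; rewrite gauge1. Qed.

Lemma FixZ c a : Fix a -> Fix (c *: a).
Proof. by move=> h z hz; rewrite (linZ (gauge_lin hz)) h. Qed.

Lemma FixD a b : Fix a -> Fix b -> Fix (a + b).
Proof. by move=> h h' z hz; rewrite (linD (gauge_lin hz)) h// h'. Qed.

Lemma Fix0 : Fix 0. Proof. by move=> z hz; rewrite (lin0 (gauge_lin hz)). Qed.

Lemma FixM a b : Fix a -> Fix b -> Fix (a * b).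
Proof. by move=> h h' z hz; rewrite gaugeM// h// h'. Qed.

Lemma Fix_star a : Fix a -> Fix (star a).
Proof. by move=> h z hz; rewrite gauge_star// h. Qed.

Lemma Fix_sum (I : Type) (r : seq I) (P : pred I) (F : I -> O) :
  (forall i, P i -> Fix (F i)) -> Fix (\sum_(i <- r | P i) F i).
Proof. by move=> h; apply: big_ind => //; [exact: Fix0|exact: FixD]. Qed.

Lemma tauZD c a b : Fix a -> Fix b -> tau (c *: a + b) = c * tau a + tau b.
Proof. by case: (cs_tauP G) => h _ _ _ _; exact: h. Qed.

Lemma tau1 : tau 1 = 1. Proof. by case: (cs_tauP G) => _ [h _] _ _ _. Qed.

Lemma tau_norm a : Fix a -> Normc.normc (tau a) <= cnorm a.
Proof. by case: (cs_tauP G) => _ [_ h] _ _ _; exact: h. Qed.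

Lemma tau_pos a : Fix a -> 0 <= tau (star a * a).
Proof. by case: (cs_tauP G) => _ _ h _ _; exact: h. Qed.

Lemma tau_faithful a : Fix a -> tau (star a * a) = 0 -> a = 0.
Proof. by case: (cs_tauP G) => _ _ _ h _; exact: h. Qed.

Lemma tauC a b : Fix a -> Fix b -> tau (a * b) = tau (b * a).
Proof. by case: (cs_tauP G) => _ _ _ _ h; exact: h. Qed.

Lemma tauD a b : Fix a -> Fix b -> tau (a + b) = tau a + tau b.
Proof. by move=> ha hb; have := tauZD 1 ha hb; rewrite scale1r mul1r. Qed.

Lemma tau0 : tau 0 = 0.
Proof. by apply: (addrI (tau 0)); rewrite -tauD ?addr0//; exact: Fix0. Qed.

Lemma tauZ c a : Fix a -> tau (c *: a) = c * tau a.
Proof. by move=> ha; have := tauZD c ha Fix0; rewrite !addr0 tau0 addr0. Qed.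

Lemma tau_sum (I : Type) (r : seq I) (P : pred I) (F : I -> O) :
  (forall i, P i -> Fix (F i)) ->
  tau (\sum_(i <- r | P i) F i) = \sum_(i <- r | P i) tau (F i).
Proof.
move=> h; suff [] : Fix (\sum_(i <- r | P i) F i) /\
  tau (\sum_(i <- r | P i) F i) = \sum_(i <- r | P i) tau (F i) by [].
apply: (big_ind2 (fun x y => Fix x /\ tau x = y)) => [|x1 x2 y1 y2 [f1 e1] [f2 e2]|i Pi].
- by split; [exact: Fix0|exact: tau0].
- by rewrite tauD// e1 e2; split=> //; exact: FixD.
- by split=> //; exact: h.
Qed.

(** The relations only say that the range projections sum to 1. Compressed by [S j], the term
    [k = j] of this sum is already 1, so the other terms, of the form [star a * a] with [a] fixed by
    the gauge action, have total trace 0. Faithfulness of [tau] then removes each of them. *)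
Lemma star_S_diff i j : i != j -> star (S i) * S j = 0.
Proof.
move=> ij; have Fa k : Fix (star (S k) * S j).
  move=> z hz; rewrite gaugeM// gauge_star// !gauge_S// starZ -scalerAl -scalerAr.
  by rewrite scalerA unit_circleP// scale1r.
have h : \sum_(k < n | k != j) tau (star (star (S k) * S j) * (star (S k) * S j)) = 0.
  rewrite -tau_sum; last by move=> k _; exact/FixM/Fa/Fix_star/Fa.
  apply/eqP; rewrite -(inj_eq (addrI (tau (star 1 * 1)))).
  rewrite addr0 -tauD; last 2 first.
  - by rewrite star1 mulr1; exact: Fix1.
  - by apply: Fix_sum => k _; exact/FixM/Fa/Fix_star/Fa.
  apply/eqP; congr tau; rewrite star1 mulr1.
  transitivity (star (S j) * ((\sum_(k < n) S k * star (S k)) * S j)); last first.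
    by rewrite sum_SS mul1r star_SS.
  rewrite mulr_suml mulr_sumr [RHS](bigD1 j)//=.
  congr (_ + _); first by rewrite -mulrA star_SS mulr1 star_SS.
  by apply: eq_bigr => k _; rewrite starM starK !mulrA.
have := psumr_eq0P (fun k _ => tau_pos (Fa k)) h ij.
exact: tau_faithful.
Qed.

Lemma word_nil : wd [::] = 1. Proof. by rewrite /word big_nil. Qed.

Lemma word_cons i mu : wd (i :: mu) = S i * wd mu.
Proof. by rewrite /word big_cons. Qed.

Lemma word_cat mu nu : wd (mu ++ nu) = wd mu * wd nu.
Proof. by rewrite /word big_cat. Qed.

Lemma star_word_word mu : star (wd mu) * wd mu = 1.
Proof.
elim: mu => [|i mu IH]; first by rewrite word_nil star1 mulr1.
by rewrite word_cons starM mulrA -(mulrA (star _)) star_SS mulr1.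
Qed.

(** Letters cancel as long as the words agree; a suffix of one of them is left, or 0 at the first
    mismatch. The size equation is equality of degrees without subtraction. *)
Lemma word_reduce nu al : star (wd nu) * wd al = 0 \/
  exists nu' al', star (wd nu) * wd al = w2 al' nu' /\
    (size al' + size nu = size al + size nu')%N.
Proof.
elim: nu al => [|i nu IH] [|j al].
- by right; exists [::], [::]; rewrite /word2 !word_nil !star1.
- by right; exists [::], (j :: al); rewrite /word2 !word_nil !star1 mul1r mulr1.
- by right; exists (i :: nu), [::]; rewrite /word2 !word_nil mul1r mulr1 add0n.
- rewrite !word_cons starM mulrA -(mulrA (star _)).
  have [<-|ij] := eqVneq i j; last by left; rewrite star_S_diff// mulr0 mul0r.
  rewrite star_SS mulr1; case: (IH al) => [|[nu' [al' [-> e]]]]; first by left.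
  by right; exists nu', al'; split=> //=; rewrite addnS e addSn.
Qed.

Lemma star_word_diff mu nu : size mu = size nu -> mu != nu ->
  star (wd mu) * wd nu = 0.
Proof.
elim: mu nu => [|i mu IH] [|j nu]//= [e]; rewrite eqseq_cons negb_and => h.
rewrite !word_cons starM mulrA -(mulrA (star _)).
have [eij|ij] := eqVneq i j; last by rewrite star_S_diff// mulr0 mul0r.
by rewrite eij star_SS mulr1 IH//; move: h; rewrite eij eqxx.
Qed.

Lemma word_sum k : \sum_(mu : k.-tuple 'I_n) wd mu * star (wd mu) = 1.
Proof.
elim: k => [|k IH].
  rewrite (big_pred1 [tuple]) ?word_nil ?mul1r ?star1// => t.
  by rewrite [t]tuple0 /= eqxx.
pose h (p : 'I_n * k.-tuple 'I_n) : k.+1.-tuple 'I_n := [tuple of p.1 :: p.2].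
rewrite (reindex h); last first.
  exists (fun t => (thead t, [tuple of behead t])) => [[i t] _|t _].
    by rewrite /h /=; congr (_, _); exact: val_inj.
  by rewrite /h -tuple_eta.
rewrite -sum_SS (eq_bigl (fun p => true && true))// -(pair_big xpredT xpredT
  (fun i (t : k.-tuple 'I_n) => wd (i :: t) * star (wd (i :: t))))/=.
apply: eq_bigr => i _; rewrite -{1}[S i]mulr1 -IH mulr_sumr mulr_suml.
by apply: eq_bigr => t _; rewrite word_cons starM !mulrA.
Qed.

Lemma w2M mu nu al be : w2 mu nu * w2 al be = 0 \/
  exists mu' nu', w2 mu nu * w2 al be = w2 mu' nu' /\
    degree mu' nu' = degree mu nu + degree al be.
Proof.
rewrite /word2 mulrA -(mulrA (wd mu)).
case: (word_reduce nu al) => [->|[nu' [al' [-> e]]]].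
  by left; rewrite mulr0 mul0r.
right; exists (mu ++ al'), (be ++ nu'); rewrite /word2 !word_cat starM !mulrA.
by split=> //; rewrite /degree !size_cat !PoszD; lia.
Qed.

Lemma star_w2 mu nu : star (w2 mu nu) = w2 nu mu.
Proof. by rewrite /word2 starM starK. Qed.

Lemma Onc_ind (P : O -> Prop) : P 0 ->
  (forall c mu nu b, P b -> P (c *: w2 mu nu + b)) -> forall a, Onc a -> P a.
Proof.
move=> P0 PD a [s ->]; elim: s => [|x s IH]; first by rewrite big_nil.
by rewrite big_cons; exact: PD.
Qed.

Lemma Onc0 : Onc 0. Proof. by exists [::]; rewrite big_nil. Qed.

Lemma OncD a b : Onc a -> Onc b -> Onc (a + b).
Proof. by move=> [s ->] [t ->]; exists (s ++ t); rewrite big_cat. Qed.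

Lemma OncZ c a : Onc a -> Onc (c *: a).
Proof.
move=> [s ->]; exists [seq (c * x.1, x.2) | x <- s]; rewrite big_map scaler_sumr.
by apply: eq_bigr => x _; rewrite scalerA.
Qed.

Lemma Onc_w2 mu nu : Onc (w2 mu nu).
Proof. by exists [:: (1, (mu, nu))]; rewrite big_seq1 scale1r. Qed.

Lemma Onc_word mu : Onc (wd mu).
Proof. by have := Onc_w2 mu [::]; rewrite /word2 word_nil star1 mulr1. Qed.

Lemma Onc1 : Onc 1. Proof. by rewrite -word_nil; exact: Onc_word. Qed.

Lemma Onc_star a : Onc a -> Onc (star a).
Proof.
move: a; apply: Onc_ind => [|c mu nu b hb]; first by rewrite star0; exact: Onc0.
by rewrite starD starZ star_w2; apply: OncD => //; exact/OncZ/Onc_w2.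
Qed.

Lemma OncM a b : Onc a -> Onc b -> Onc (a * b).
Proof.
move=> ha; move: b; apply: Onc_ind => [|c al be b hb].
  by rewrite mulr0; exact: Onc0.
rewrite mulrDr -scalerAr; apply: OncD => //; apply: OncZ.
move: a ha {hb}; apply: Onc_ind => [|d mu nu a ha]; first by rewrite mul0r; exact: Onc0.
rewrite mulrDl -scalerAl; apply: OncD => //; apply: OncZ.
case: (w2M mu nu al be) => [->|[mu' [nu' [-> _]]]]; [exact: Onc0|exact: Onc_w2].
Qed.

Lemma Onc_sum (I : Type) (r : seq I) (P : pred I) (F : I -> O) :
  (forall i, P i -> Onc (F i)) -> Onc (\sum_(i <- r | P i) F i).
Proof. by move=> h; apply: big_ind => //; [exact: Onc0|exact: OncD]. Qed.

Lemma OncN a : Onc a -> Onc (- a).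
Proof. by move=> h; rewrite -scaleN1r; exact: OncZ. Qed.

Lemma gauge_word z mu : unit_circle z -> gm z (wd mu) = z ^+ size mu *: wd mu.
Proof.
move=> hz; elim: mu => [|i mu IH]; first by rewrite word_nil gauge1// expr0 scale1r.
by rewrite word_cons gaugeM// gauge_S// IH -scalerAl -scalerAr scalerA -exprS.
Qed.

Lemma conjCX z k : (z ^+ k)^* = z^* ^+ k. Proof. exact: rmorphXn. Qed.

Lemma gauge_w2 z mu nu : unit_circle z ->
  gm z (w2 mu nu) = (z ^+ size mu * z^* ^+ size nu) *: w2 mu nu.
Proof.
move=> hz; rewrite /word2 gaugeM// gauge_star// !gauge_word// starZ conjCX.
by rewrite -scalerAl -scalerAr scalerA.
Qed.

Lemma Fix_w2 mu nu : degree mu nu = 0 -> Fix (w2 mu nu).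
Proof.
move=> /eqP; rewrite subr_eq0 => /eqP[e] z hz; rewrite gauge_w2// e -exprMn.
by rewrite mulrC unit_circleP// expr1n scale1r.
Qed.

(** The closure of [Onc] is a closed star-subalgebra containing the generators, so the minimality
    clause of [is_cuntz_algebra] applies. *)
Lemma Onc_dense a (e : R) : 0 < e -> exists2 b, Onc b & cnorm (a - b) < e.
Proof.
move=> e0; pose B : set O := [set a | forall e : R, 0 < e ->
  exists2 b, Onc b & cnorm (a - b) < e].
have BO b : Onc b -> B b by move=> hb d d0; exists b => //; rewrite subrr cnorm0.
suff BT : B = setT by have : B a; [rewrite BT|apply].
have [_ _ h] := cs_cuntz G; apply: h.
- by move=> i; apply: BO; have := Onc_word [:: i]; rewrite word_cons word_nil mulr1.
- move=> x y hx hy; split=> d d0.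
    have d2 : 0 < d / 2 by rewrite divr_gt0.
    have [b Ob hb] := hx _ d2; have [c Oc hc] := hy _ d2.
    exists (b + c); first exact: OncD.
    rewrite opprD addrACA [ltRHS]splitr; apply: le_lt_trans (cnormD _ _) _.
    exact: ltrD.
  pose K := cnorm x + cnorm y + 1.
  have K0 : 0 < K by rewrite ltr_wpDl ?addr_ge0 ?cnorm_ge0.
  (* The bound 1 keeps [cnorm c] below [cnorm y + 1], so that [K] bounds both fixed factors in the
     estimate of the product. *)
  pose d' := Num.min 1 (d / (2 * K)).
  have d'0 : 0 < d' by rewrite lt_min ltr01 divr_gt0// mulr_gt0.
  have [b Ob hb] := hx _ d'0; have [c Oc hc] := hy _ d'0.
  exists (b * c); first exact: OncM.
  have -> : x * y - b * c = x * (y - c) + (x - b) * c.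
    by rewrite mulrBr mulrBl addrA subrK.
  have hd : d' * (2 * K) <= d.
    by rewrite -ler_pdivlMr ?mulr_gt0// ge_min lexx orbT.
  have d1 : d' <= 1 by rewrite ge_min lexx.
  have c1 : cnorm c <= cnorm y + 1.
    rewrite -(subrK y c); apply: le_trans (cnormD _ _) _; rewrite addrC lerD2l.
    by rewrite cnormBC; apply: le_trans (ltW hc) _.
  apply: le_lt_trans (cnormD _ _) _; apply: (lt_le_trans _ hd).
  apply: (@lt_le_trans _ _ (K * d' + K * d')); last by rewrite mulrCA mulr_natl mulrC mulr2n.
  have hK : cnorm x <= K by rewrite /K; have := cnorm_ge0 y; lra.
  have hK2 : cnorm c <= K by rewrite /K; have := cnorm_ge0 x; lra.
  apply: ltrD.
    apply: le_lt_trans (cnormM _ _) _.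
    apply: (@le_lt_trans _ _ (K * cnorm (y - c))); first by rewrite ler_wpM2r ?cnorm_ge0.
    by rewrite ltr_pM2l.
  apply: le_lt_trans (cnormM _ _) _; rewrite mulrC.
  apply: (@le_lt_trans _ _ (K * cnorm (x - b))); first by rewrite ler_wpM2r ?cnorm_ge0.
  by rewrite ltr_pM2l.
- move=> c x hx; split=> d d0.
    have K0 : 0 < Normc.normc c + 1 by rewrite ltr_wpDl ?normc_ge0.
    have [b Ob hb] := hx _ (divr_gt0 d0 K0); exists (c *: b); first exact: OncZ.
    rewrite -scalerBr cnormZ; move: hb; rewrite ltr_pdivlMr// => hb.
    apply: le_lt_trans hb; rewrite mulrC ler_wpM2l ?cnorm_ge0// lerDl.
    exact: ler01.
  have [b Ob hb] := hx _ d0; exists (star b); first exact: Onc_star.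
  by rewrite -starN -starD cnorm_star.
- move=> x hx d d0; have d2 : 0 < d / 2 by rewrite divr_gt0.
  have [y hy xy] := hx _ d2; have [b Ob hb] := hy _ d2.
  exists b => //; rewrite -(subrK y x) -addrA [ltRHS]splitr.
  by apply: le_lt_trans (cnormD _ _) _; exact: ltrD.
Qed.

End cuntz_words.

Section circle.
Context {R : realType}.

Lemma circle_ptD (s t : R) : circle_pt (s + t) = circle_pt s * circle_pt t.
Proof.
by rewrite /circle_pt cosD sinD /GRing.mul/=; congr (_ +i* _); rewrite addrC.
Qed.

Lemma circle_pt0 : circle_pt (0 : R) = 1.
Proof. by rewrite /circle_pt cos0 sin0. Qed.

Lemma circle_ptX (t : R) k : circle_pt t ^+ k = circle_pt (k%:R * t).
Proof.
elim: k => [|k IH]; first by rewrite expr0 mul0r circle_pt0.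
by rewrite exprS IH -circle_ptD -{1}[t]mul1r -mulrDl -natr1 addrC.
Qed.

Lemma circle_pt_unit (t : R) : unit_circle (circle_pt t).
Proof. by rewrite /unit_circle /circle_pt/= cos2Dsin2 sqrtr1. Qed.

Lemma circle_pt_pi : circle_pt pi = -1 :> R[i].
Proof. by rewrite /circle_pt cospi sinpi; apply/eqP; rewrite eq_complex/= oppr0 !eqxx. Qed.

(** Geometric series: [q] is not 1 because a power of it is -1, and the number of terms is a
    multiple of the period [2 * M] of its powers. *)
Lemma sum_rootX0 (q : R[i]) M k : q ^+ M = -1 -> \sum_(i < (2 * k * M)%N) q ^+ i = 0.
Proof.
move=> qM; have q1 : q - 1 != 0.
  rewrite subr_eq0; apply: contra_eq_neq qM => ->; rewrite expr1n eq_sym.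
  by rewrite -subr_eq0 -opprD oppr_eq0 (_ : 1 + 1 = 2%:R)// pnatr_eq0.
apply: (mulfI q1); rewrite mulr0 -subrX1 mulnC exprM qM exprM sqrrN !expr1n.
exact: subrr.
Qed.

End circle.

(** * The expectation onto the fixed point algebra and the KMS state *)

Section expectation.
Context {R : realType} {n : nat} (G : cuntz_system R n).
Local Notation O := (cs_O G).
Local Notation S := (cs_S G).
Local Notation gm := (cs_gauge G).
Local Notation Fix := (fixed_algebra (cs_gauge G)).
Local Notation tau := (cs_tau G).
Local Notation Phi := (cs_Phi G).
Local Notation w2 := (word2 (cs_S G)).
Local Notation wd := (word (cs_S G)).
Local Notation Onc := (Onc (cs_S G)).
Implicit Types (a b f : O) (mu nu al be : seq 'I_n) (z : R[i]).

Let node (N i : nat) : R := 2 * pi * i%:R / N.+1%:R.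

Let avg N a : O := ((N.+1%:R : R)^-1)%:C *: \sum_(i < N.+1) gm (circle_pt (node N i)) a.

Let nodeS N i : node N i.+1 - node N i = 2 * pi / N.+1%:R.
Proof. by rewrite /node -mulrBl -mulrBr -(natr1 i) addrAC subrr add0r mulr1. Qed.

(** Equidistant nodes with left tags turn the Riemann integral into averages of isometric linear
    maps; linearity, contractivity and the fixed points of the averages pass to [Phi]. *)
Lemma Phi_avg a (e : R) : 0 < e -> exists N0, forall N, (N0 <= N)%N ->
  cnorm (avg N a - Phi a) < e.
Proof.
move=> e0; have [v hv ->] := cs_PhiP a.
have p0 : 0 < 2 * pi :> R by rewrite mulr_gt0// pi_gt0.
have [d d0 hd] := hv _ (mulr_gt0 e0 p0).
have [N0 hN0] : exists N0 : nat, 2 * pi / d < N0%:R.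
  by exists (Num.truncn (2 * pi / d)).+1; exact: truncnS_gt.
exists N0 => N NN0; pose s := mkseq (fun i => node N i.+1) N.+1.
have node0 : node N 0 = 0 by rewrite /node mulr0 mul0r.
have sn i : (i <= N.+1)%N -> nth 0 (0 :: s) i = node N i.
  by case: i => [|i] // iN /=; rewrite nth_mkseq.
have nlt i : node N i < node N i.+1.
  by rewrite -subr_gt0 nodeS divr_gt0.
have ss : size s = N.+1 by rewrite size_mkseq.
have := hd s (node N); rewrite ss.
have -> : \sum_(i < N.+1) (nth 0 (0 :: s) i.+1 - nth 0 (0 :: s) i)%:C *:
    gm (circle_pt (node N i)) a = (2 * pi)%:C *: avg N a.
  rewrite /avg scalerA -rmorphM scaler_sumr; apply: eq_bigr => i _.
  by rewrite !sn ?nodeS//; exact/ltnW/ltn_ord.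
move=> h; have {h} : cnorm ((2 * pi)%:C *: avg N a - v) < e * (2 * pi).
  apply: h.
  - split; last first.
      by rewrite (last_nth 0) ss sn// /node mulfK.
    apply/(pathP 0) => i; rewrite ss => iN.
    have -> : nth 0 s i = node N i.+1 by rewrite nth_mkseq.
    by rewrite sn ?nlt// ltnW.
  - move=> i; rewrite ss => iN; rewrite !sn ?nodeS//; last exact: ltnW.
    rewrite ltr_pdivrMr// [ltRHS]mulrC -ltr_pdivrMr//; apply: lt_trans hN0 _.
    by rewrite ltr_nat ltnS.
  - move=> i iN; rewrite !sn ?lexx ?ltW//; exact: ltnW.
have -> : avg N a - ((2 * pi)^-1)%:C *: v = ((2 * pi)^-1)%:C *: ((2 * pi)%:C *: avg N a - v).
  by rewrite scalerBr scalerA -rmorphM mulVf ?gt_eqF// scale1r.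
rewrite cnormZ normcR ger0_norm ?invr_ge0 ?ltW// => h.
by rewrite mulrC ltr_pdivrMr.
Qed.

Let avg_lin N : linear (avg N).
Proof.
move=> c a b; rewrite /avg scalerA (mulrC c) -scalerA -scalerDr; congr (_ *: _).
rewrite scaler_sumr -big_split; apply: eq_bigr => i _.
by rewrite /= (gauge_lin (circle_pt_unit _)).
Qed.

Lemma Phi_lin : linear Phi.
Proof.
move=> c a b; apply/eqP; rewrite -subr_eq0; apply/eqP.
apply: (@cnorm_eps _ _ (Normc.normc c + 2)) => e e0.
have [N1 h1] := Phi_avg (c *: a + b) e0.
have [N2 h2] := Phi_avg a e0; have [N3 h3] := Phi_avg b e0.
pose N := maxn N1 (maxn N2 N3).
have {h1} := h1 N (leq_maxl _ _).
have {h2} := h2 N (leq_trans (leq_maxl _ _) (leq_maxr _ _)).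
have {h3} := h3 N (leq_trans (leq_maxr _ _) (leq_maxr _ _)).
move=> h3 h2 h1.
have -> : Phi (c *: a + b) - (c *: Phi a + Phi b) =
   (Phi (c *: a + b) - avg N (c *: a + b)) +
   (c *: (avg N a - Phi a) + (avg N b - Phi b)).
  have -> : c *: (avg N a - Phi a) + (avg N b - Phi b) =
      avg N (c *: a + b) - (c *: Phi a + Phi b).
    by rewrite avg_lin scalerBr addrACA opprD.
  by rewrite addrA subrK.
apply: le_trans (cnormD _ _) _; rewrite cnormBC.
apply: le_trans (lerD (ltW h1) (le_trans (cnormD _ _) (lerD _ (ltW h3)))) _.
  by rewrite cnormZ; apply: ler_wpM2l (ltW h2); exact: normc_ge0.
by rewrite mulrDl; lra.
Qed.

Lemma Phi_norm a : cnorm (Phi a) <= cnorm a.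
Proof.
apply/ler_addgt0Pr => e e0.
have [N hN] := Phi_avg a e0; have {hN} := hN N (leqnn N); rewrite cnormBC => h.
rewrite -(subrK (avg N a) (Phi a)) addrC; apply: le_trans (cnormD _ _) _.
apply: lerD (ltW h); rewrite /avg cnormZ normcR ger0_norm ?invr_ge0//.
rewrite mulrC ler_pdivrMr ?ltr0n//; apply: le_trans (cnorm_sum _ _ _) _.
rewrite (eq_bigr (fun=> cnorm a)) => [|i _]; last first.
  by rewrite gauge_norm//; exact: circle_pt_unit.
by rewrite sumr_const card_ord mulr_natr.
Qed.

Lemma Phi_fix a : Fix a -> Phi a = a.
Proof.
move=> Fa; apply/eqP; rewrite -subr_eq0; apply/eqP.
apply: (@cnorm_eps _ _ 1) => e e0; rewrite mul1r.
have [N hN] := Phi_avg a e0; have {hN} := hN N (leqnn N); rewrite cnormBC.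
suff -> : avg N a = a by move/ltW.
rewrite /avg (eq_bigr (fun=> a)) => [|i _]; last exact/Fa/circle_pt_unit.
rewrite sumr_const card_ord -(scaler_nat N.+1 a) scalerA.
rewrite (_ : _ * _ = 1) ?scale1r//.
by rewrite -(rmorph_nat (real_complex R)) -rmorphM mulVf// pnatr_eq0.
Qed.

Lemma Phi_w2 mu nu : Phi (w2 mu nu) = if degree mu nu == 0 then w2 mu nu else 0.
Proof.
case: eqP => [/(@Fix_w2 _ _ G)|/eqP d0]; first exact: Phi_fix.
apply: (@cnorm_eps _ _ 1) => e e0; rewrite mul1r.
have [N0 hN] := Phi_avg (w2 mu nu) e0.
pose p := `|degree mu nu|%N; have p0 : (0 < p)%N by rewrite absz_gt0.
(* With this number of nodes the power [p * N0.+1] of the basic root of unity is -1, so the average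
   is exactly 0 and not merely small; moreover [N] is at least [N0]. *)
pose N := (2 * p * N0.+1).-1.
have NE : N.+1 = (2 * p * N0.+1)%N by rewrite prednK// !muln_gt0 p0.
have {hN} : cnorm (avg N (w2 mu nu) - Phi (w2 mu nu)) < e.
  by apply: hN; rewrite -ltnS NE; nia.
suff -> : avg N (w2 mu nu) = 0 by rewrite sub0r cnormN => /ltW.
rewrite /avg.
pose z := circle_pt (2 * pi / N.+1%:R : R).
have zE i : circle_pt (node N i) = z ^+ i.
  by rewrite /z circle_ptX /node; congr circle_pt; ring.
have zz : z * z^* = 1 by rewrite mulrC; exact/unit_circleP/circle_pt_unit.
have zM : z ^+ p ^+ N0.+1 = -1.
  rewrite -exprM circle_ptX -circle_pt_pi; congr circle_pt; rewrite NE.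
  rewrite !natrM; field.
  by rewrite addrC natr1 !pnatr_eq0/= -lt0n.
rewrite (eq_bigr (fun i : 'I_N.+1 =>
  (z ^+ i ^+ size mu * (z ^+ i)^* ^+ size nu) *: w2 mu nu)); last first.
  by move=> i _; rewrite -zE gauge_w2//; exact: circle_pt_unit.
rewrite -scaler_suml.
suff -> : \sum_(i < N.+1) (z ^+ i ^+ size mu * (z ^+ i)^* ^+ size nu) = 0.
  by rewrite scale0r scaler0.
have [le|/ltnW le] := leqP (size nu) (size mu).
  rewrite -[RHS](sum_rootX0 p zM) -NE; apply: eq_bigr => i _.
  rewrite -(subnK le) exprD -mulrA -exprMn conjCX -exprMn zz !expr1n mulr1.
  rewrite -!exprM mulnC; congr (_ ^+ (_ * _)).
  by rewrite /p /degree; lia.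
have zM' : z^* ^+ p ^+ N0.+1 = -1.
  by rewrite -!conjCX zM; apply/eqP; rewrite eq_complex/= !oppr0 !eqxx.
rewrite -[RHS](sum_rootX0 p zM') -NE; apply: eq_bigr => i _.
rewrite -(subnK le) exprD mulrCA -exprMn conjCX -exprMn zz !expr1n mulr1.
rewrite -!exprM mulnC; congr (_ ^+ (_ * _)).
by rewrite /p /degree; lia.
Qed.

Lemma Phi_Onc a : Onc a -> Onc (Phi a) /\ Fix (Phi a).
Proof.
move: a; apply: Onc_ind => [|c mu nu b [hb fb]].
  by rewrite (lin0 Phi_lin); split; [exact: Onc0|exact: Fix0].
rewrite Phi_lin Phi_w2; case: eqP => [d0|_]; last by rewrite scaler0 add0r.
by split; [apply: OncD => //; exact/OncZ/Onc_w2|apply: FixD => //; exact/FixZ/Fix_w2].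
Qed.

(** Known on [Onc] from the formula on words; contractivity of [Phi] extends it by density. *)
Lemma Phi_Fix a : Fix (Phi a).
Proof.
move=> z hz; apply/eqP; rewrite -subr_eq0; apply/eqP.
apply: (@cnorm_eps _ _ 2) => e e0; have [b Ob hb] := Onc_dense a e0.
have [_ /(_ z hz) Fb] := Phi_Onc Ob.
rewrite -(subrK (Phi b) (Phi a)) (linD (gauge_lin hz)) Fb opprD addrACA subrr addr0.
rewrite -(linB Phi_lin).
apply: le_trans (cnormB _ _) _; rewrite gauge_norm//.
by have := le_lt_trans (Phi_norm _) hb; lra.
Qed.

Definition psi a : R[i] := tau (Phi a).

Lemma psiD a b : psi (a + b) = psi a + psi b.
Proof. by rewrite /psi (linD Phi_lin) tauD//; exact: Phi_Fix. Qed.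

Lemma psiZ c a : psi (c *: a) = c * psi a.
Proof. by rewrite /psi (linZ Phi_lin) tauZ//; exact: Phi_Fix. Qed.

Lemma psi0 : psi 0 = 0.
Proof. by rewrite /psi (lin0 Phi_lin) tau0. Qed.

Lemma psi_sum (I : Type) (r : seq I) (P : pred I) (F : I -> O) :
  psi (\sum_(i <- r | P i) F i) = \sum_(i <- r | P i) psi (F i).
Proof. by elim/big_rec2: _ => [|i x y _ <-]; rewrite ?psiD ?psi0. Qed.

Lemma psi_fix a : Fix a -> psi a = tau a.
Proof. by move=> h; rewrite /psi Phi_fix. Qed.

Lemma psi_norm a : Normc.normc (psi a) <= cnorm a.
Proof. exact: le_trans (tau_norm (Phi_Fix _)) (Phi_norm a). Qed.

Lemma psi_w2_deg mu nu : degree mu nu != 0 -> psi (w2 mu nu) = 0.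
Proof. by move=> h; rewrite /psi Phi_w2 (negPf h) tau0. Qed.

(** The trace property for [w2 al mu * w2 mu al] shows that all [w2 al al] of one length have the
    same trace; their sum over the words of that length is 1. For different words of equal length,
    the product taken in the opposite order is 0. *)
Lemma psi_w2_eq mu nu : size mu = size nu ->
  psi (w2 mu nu) = if mu == nu then ((n%:R ^- size mu : R))%:C else 0.
Proof.
move=> e; have F al be : size al = size be -> Fix (w2 al be).
  by move=> h; apply: Fix_w2; rewrite /degree h subrr.
rewrite psi_fix; last exact: F.
case: eqP => [<-|/eqP ne]; last first.
  have -> : w2 mu nu = w2 mu mu * w2 mu nu.
    by rewrite /word2 mulrA -(mulrA (wd mu)) star_word_word mulr1.
  rewrite tauC; [|exact: F|exact: F].
  rewrite /word2 mulrA -(mulrA (wd mu)) star_word_diff// 1?eq_sym// mulr0 mul0r.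
  exact: tau0.
have same al : size al = size mu -> tau (w2 al al) = tau (w2 mu mu).
  move=> h; have -> : w2 al al = w2 al mu * w2 mu al.
    by rewrite /word2 mulrA -(mulrA (wd al)) star_word_word mulr1.
  rewrite tauC; [|exact: F|exact: F].
  by rewrite /word2 mulrA -(mulrA (wd mu)) star_word_word mulr1.
have h : \sum_(t : (size mu).-tuple 'I_n) tau (w2 t t) = 1.
  rewrite -tau_sum => [|t _]; last exact: F.
  by rewrite word_sum tau1.
have nz : (n ^ size mu)%N%:R != 0 :> R[i].
  apply: contra_eq_neq h => h; rewrite (eq_bigr (fun=> tau (w2 mu mu))); last first.
    by move=> t _; apply: same; rewrite size_tuple.
  rewrite sumr_const card_tuple card_ord -(mulr_natr (tau _)) h mulr0.
  by rewrite eq_sym oner_eq0.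
move: h; rewrite (eq_bigr (fun=> tau (w2 mu mu))); last first.
  by move=> t _; apply: same; rewrite size_tuple.
rewrite sumr_const card_tuple card_ord -(mulr_natr (tau (w2 mu mu))) => h.
by apply: (mulIf nz); rewrite h -natrX fmorphV rmorph_nat mulVf.
Qed.

End expectation.

(** * The GNS space and its grading *)

Section gns.
Context {R : realType} {n : nat} (G : cuntz_system R n).
Local Notation O := (cs_O G).
Local Notation H := (cs_H G).
Local Notation S := (cs_S G).
Local Notation Fix := (fixed_algebra (cs_gauge G)).
Local Notation Phi := (cs_Phi G).
Local Notation w2 := (word2 (cs_S G)).
Local Notation wd := (word (cs_S G)).
Local Notation Onc := (Onc (cs_S G)).
Local Notation io := (cs_iota G).
Local Notation rep := (cs_pi G).
Local Notation Phik := (cs_Phik G).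
Local Notation psi := (@psi _ _ G).
Implicit Types (a b f : O) (mu nu al be : seq 'I_n) (x y : H).

Lemma complete_H : complete_inner H. Proof. by case: (cs_gns G). Qed.

Lemma io_lin : linear io. Proof. by case: (cs_gns G). Qed.

Lemma dot_io a b : dot (io a) (io b) = psi (star a * b).
Proof. by case: (cs_gns G) => _ _ ->. Qed.

Lemma rep_bounded a : bounded_op (rep a).
Proof. by case: (cs_gns G) => _ _ _ _ /(_ a)[]. Qed.

Lemma rep_io a b : rep a (io b) = io (a * b).
Proof. by case: (cs_gns G) => _ _ _ _ /(_ a)[]. Qed.

Lemma vnorm_io a : vnorm (io a) <= cnorm a.
Proof.
rewrite -(@ler_pXn2r _ 2) ?nnegrE ?vnorm_ge0 ?cnorm_ge0// vnorm_sqr.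
rewrite /nsq dot_io -cnorm_starM.
exact: le_trans (Re_le_normc _) (psi_norm _).
Qed.

Lemma io_Onc_dense x (e : R) : 0 < e ->
  exists2 a, Onc a & vnorm (x - io a) < e.
Proof.
move=> e0; have e2 : 0 < e / 2 by rewrite divr_gt0.
have [_ _ _ dense _] := cs_gns G; have [a ha] := dense x _ e2.
have [b Ob hb] := Onc_dense a e2; exists b => //.
apply: le_lt_trans (vnorm_dist (io a) _ _) _; rewrite [ltRHS]splitr; apply: ltrD => //.
by rewrite -(linB io_lin); apply: le_lt_trans (vnorm_io _) hb.
Qed.

Lemma words_total (P : H -> Prop) : P 0 ->
  (forall c x y, P x -> P y -> P (c *: x + y)) ->
  (forall x, (forall e : R, 0 < e -> exists2 y, P y & vnorm (x - y) < e) -> P x) ->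
  (forall mu nu, P (io (w2 mu nu))) -> forall x, P x.
Proof.
move=> P0 PD PC Pw x; apply: PC => e e0; have [a Oa ha] := io_Onc_dense x e0.
exists (io a) => //; move: a Oa {ha}; apply: Onc_ind; first by rewrite (lin0 io_lin).
by move=> c mu nu b Pb; rewrite io_lin; exact: PD.
Qed.

(** Only additivity and a zero set stable under scalars are asked of [f], so that conjugate-linear
    functionals, such as [dot] in its first variable, are covered as well. *)
Lemma words_zero (f : H -> R[i]) (K : R) : (forall x y, f (x + y) = f x + f y) ->
  (forall c x, f x = 0 -> f (c *: x) = 0) ->
  (forall x, Normc.normc (f x) <= K * vnorm x) ->
  (forall mu nu, f (io (w2 mu nu)) = 0) -> forall x, f x = 0.
Proof.
move=> fD fZ fK fw; apply: words_total => //.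
- by apply: (addrI (f 0)); rewrite -fD !addr0.
- by move=> c x y x0 y0; rewrite fD fZ// y0 addr0.
- move=> x hx; apply: Normc.eq0_normc; apply: eq0_le_eps => [|e e0].
    exact: normc_ge0.
  have K0 : 0 < `|K| + 1 by rewrite ltr_wpDl.
  have [y y0 hy] := hx _ (divr_gt0 e0 K0); move: hy; rewrite ltr_pdivlMr// => hy.
  rewrite -(subrK y x) fD y0 addr0; apply: le_lt_trans (fK _) _.
  apply: le_lt_trans hy; rewrite mulrC ler_wpM2l ?vnorm_ge0//.
  by apply: le_trans (ler_norm _) _; rewrite lerDl.
Qed.

Lemma op_ext (A B : H -> H) : bounded_op A -> bounded_op B ->
  (forall mu nu, A (io (w2 mu nu)) = B (io (w2 mu nu))) -> A = B.
Proof.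
move=> bA bB h; apply/funext => x; apply: dot_ext => y.
apply/eqP; rewrite -subr_eq0; apply/eqP; move: x.
have lA := bounded_lin bA; have lB := bounded_lin bB.
have [M _ hM] := bounded_ge0 bA; have [N _ hN] := bounded_ge0 bB.
apply: (@words_zero _ (vnorm y * (M + N))) => [u v|c u|u|mu nu].
- by rewrite (linD lA) (linD lB) !dotDr opprD addrACA.
- by rewrite (linZ lA) (linZ lB) !dotZr -mulrBr => ->; rewrite mulr0.
- rewrite -dotBr -mulrA; apply: le_trans (dot_CS _ _) _.
  rewrite ler_wpM2l ?vnorm_ge0//; apply: le_trans (vnormB _ _) _.
  by rewrite mulrDl lerD.
- by rewrite h subrr.
Qed.

Lemma adj_words (A B : H -> H) : bounded_op A -> bounded_op B ->
  (forall mu nu al be, dot (A (io (w2 mu nu))) (io (w2 al be)) =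
     dot (io (w2 mu nu)) (B (io (w2 al be)))) -> adjoint_of A B.
Proof.
move=> bA bB h x y; apply/eqP; rewrite -subr_eq0; apply/eqP.
have lA := bounded_lin bA; have lB := bounded_lin bB.
have [M _ hM] := bounded_ge0 bA; have [N _ hN] := bounded_ge0 bB.
have bound u v : Normc.normc (dot (A u) v - dot u (B v)) <=
    (M + N) * vnorm u * vnorm v.
  apply: le_trans (ler_normcD _ _) _; rewrite normcN !mulrDl lerD//.
    apply: le_trans (dot_CS _ _) _.
    by rewrite ler_wpM2r ?vnorm_ge0.
  apply: le_trans (dot_CS _ _) _.
  by rewrite -mulrA mulrCA ler_wpM2l ?vnorm_ge0.
move: y; apply: (@words_zero _ ((M + N) * vnorm x)) => [u v|c u|u|al be].
- by rewrite (linD lB) !dotDr opprD addrACA.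
- by rewrite (linZ lB) !dotZr -mulrBr => ->; rewrite mulr0.
- exact: bound.
move: x; apply: (@words_zero _ ((M + N) * vnorm (io (w2 al be)))) => [u v|c u|u|mu nu].
- by rewrite (linD lA) !dotDl opprD addrACA.
- by rewrite (linZ lA) !dotZl -mulrBr => ->; rewrite mulr0.
- by rewrite mulrAC; exact: bound.
- by rewrite h subrr.
Qed.

Lemma repM a b : rep (a * b) = rep a \o rep b.
Proof.
apply: op_ext; [exact: rep_bounded|exact/bounded_comp/rep_bounded/rep_bounded|].
by move=> mu nu; rewrite /= !rep_io mulrA.
Qed.

Lemma repD a b : rep (a + b) = rep a + rep b.
Proof.
apply: op_ext; [exact: rep_bounded|exact/bounded_add/rep_bounded/rep_bounded|].
by move=> mu nu; rewrite addfE !rep_io mulrDl (linD io_lin).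
Qed.

Lemma repZ c a : rep (c *: a) = c *: rep a.
Proof.
apply: op_ext; [exact: rep_bounded|exact/bounded_scale/rep_bounded|].
by move=> mu nu; rewrite scalefE !rep_io -scalerAl (linZ io_lin).
Qed.

Lemma rep0 : rep 0 = 0.
Proof. by rewrite -(scale0r 0) repZ scale0r. Qed.

Lemma rep1 : rep 1 = id.
Proof.
apply: op_ext; [exact: rep_bounded|exact: bounded_id|].
by move=> mu nu; rewrite rep_io mul1r.
Qed.

Lemma rep_sum (I : Type) (r : seq I) (P : pred I) (F : I -> O) :
  rep (\sum_(i <- r | P i) F i) = \sum_(i <- r | P i) rep (F i).
Proof. by elim/big_rec2: _ => [|i x y _ <-]; rewrite ?repD ?rep0. Qed.

Lemma rep_adj a : adjoint_of (rep a) (rep (star a)).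
Proof.
apply: adj_words; [exact: rep_bounded|exact: rep_bounded|].
by move=> mu nu al be; rewrite !rep_io !dot_io starM mulrA.
Qed.

Lemma Phik_bounded j : bounded_op (Phik j).
Proof. by have [] := @cs_PhikP _ _ G j. Qed.

Lemma Phik_w2 j mu nu :
  Phik j (io (w2 mu nu)) = if degree mu nu == j then io (w2 mu nu) else 0.
Proof. by have [_ ->] := @cs_PhikP _ _ G j. Qed.

Lemma Phik_lin j : linear (Phik j). Proof. exact/bounded_lin/Phik_bounded. Qed.

Lemma dot_w2 mu nu al be : degree mu nu != degree al be ->
  dot (io (w2 mu nu)) (io (w2 al be)) = 0.
Proof.
move=> h; rewrite dot_io star_w2.
case: (w2M G nu mu al be) => [->|[mu' [nu' [-> e]]]]; first exact: psi0.
by rewrite psi_w2_deg// e; move: h; rewrite /degree; lia.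
Qed.

Lemma Phik_adj j : adjoint_of (Phik j) (Phik j).
Proof.
apply: adj_words; [exact: Phik_bounded|exact: Phik_bounded|].
move=> mu nu al be; rewrite !Phik_w2.
have [e|ne] := eqVneq (degree mu nu) (degree al be).
  by rewrite e; case: eqP => // _; rewrite dot0l dot0r.
by case: eqP; case: eqP => //; rewrite ?dot0l ?dot0r ?dot_w2.
Qed.

Lemma Phik_orth i j x : i != j -> Phik i (Phik j x) = 0.
Proof.
move=> ij; suff e : Phik i \o Phik j = 0 by exact: (congr1 (@^~ x) e).
apply: op_ext; [exact/bounded_comp/Phik_bounded/Phik_bounded|exact: bounded_0|].
move=> mu nu; rewrite /= Phik_w2; case: eqP => [e|_]; last exact/lin0/Phik_lin.
by rewrite Phik_w2 e eq_sym (negPf ij).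
Qed.

Lemma Phik_proj j : projection (Phik j).
Proof.
split; [exact: Phik_bounded| |exact: Phik_adj].
apply: op_ext; [exact/bounded_comp/Phik_bounded/Phik_bounded|exact: Phik_bounded|].
move=> mu nu; rewrite /= Phik_w2; case: eqP => [e|_]; last exact/lin0/Phik_lin.
by rewrite Phik_w2 e eqxx.
Qed.

Lemma odec_Phik : odec Phik.
Proof.
split; [exact: Phik_proj|exact: Phik_orth|] => x hx.
apply: dot_ext => z; rewrite dot0r; move: z.
apply: (@words_zero _ (vnorm x)) => [u v|c u|u|mu nu].
- by rewrite dotDl.
- by rewrite dotZl => ->; rewrite mulr0.
- by rewrite mulrC; exact: dot_CS.
have -> : io (w2 mu nu) = Phik (degree mu nu) (io (w2 mu nu)) by rewrite Phik_w2 eqxx.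
by rewrite Phik_adj hx dot0r.
Qed.

Lemma Phik_rep_w2 j mu nu x :
  Phik j (rep (w2 mu nu) x) = rep (w2 mu nu) (Phik (j - degree mu nu) x).
Proof.
suff e : Phik j \o rep (w2 mu nu) = rep (w2 mu nu) \o Phik (j - degree mu nu).
  exact: (congr1 (@^~ x) e).
have bP := Phik_bounded; have br := rep_bounded.
apply: op_ext; [exact: bounded_comp|exact: bounded_comp|] => al be /=.
rewrite rep_io Phik_w2; case: (w2M G mu nu al be) => [e0|[mu' [nu' [e d]]]].
  rewrite e0 (lin0 io_lin) (lin0 (Phik_lin j)); case: ifP => _.
    by rewrite rep_io e0 (lin0 io_lin).
  by rewrite (lin0 (bounded_lin (br _))).
rewrite e Phik_w2 d (_ : (_ == j) = (degree al be == j - degree mu nu)); last first.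
  by rewrite /degree; lia.
by case: ifP => _; rewrite ?rep_io ?e// (lin0 (bounded_lin (br _))).
Qed.

(** Replacing [f] by [Phi f] lets the induction run over all words: those of nonzero degree
    contribute 0, and those of degree 0 do not shift the grading. *)
Lemma Phik_rep_fix j f x : Onc f -> Fix f -> Phik j (rep f x) = rep f (Phik j x).
Proof.
move=> Of Ff; rewrite -(Phi_fix Ff); move: f Of {Ff}; apply: Onc_ind.
  rewrite (lin0 (@Phi_lin _ _ G)) rep0; exact: (lin0 (Phik_lin j)).
move=> c mu nu b h; rewrite Phi_lin Phi_w2 repD repZ !addfE !scalefE.
rewrite (linD (Phik_lin j)) (linZ (Phik_lin j)) h; congr (_ *: _ + _).
case: eqP => [d|_]; last by rewrite rep0; exact: (lin0 (Phik_lin j)).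
by rewrite Phik_rep_w2 d subr0.
Qed.

Lemma Phik0_io a : Phik 0 (io a) = io (Phi a).
Proof.
have [M M0 hM] := bounded_ge0 (Phik_bounded 0).
have key b : Onc b -> Phik 0 (io b) = io (Phi b).
  move: b; apply: Onc_ind => [|c mu nu b h].
    rewrite (lin0 (@Phi_lin _ _ G)) (lin0 io_lin); exact: (lin0 (Phik_lin 0)).
  rewrite io_lin (Phik_lin 0) h Phi_lin Phi_w2 Phik_w2 io_lin.
  by case: eqP => //; rewrite (lin0 io_lin).
apply/eqP; rewrite -subr_eq0; apply/eqP/vnorm_eps => e e0.
have K0 : 0 < M + 1 by rewrite ltr_wpDl.
have [b Ob hb] := Onc_dense a (divr_gt0 e0 K0).
move: hb; rewrite ltr_pdivlMr// mulrDr mulr1 => hb.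
apply: le_lt_trans (vnorm_dist (io (Phi b)) _ _) _; apply: le_lt_trans hb.
rewrite -key// -(linB (Phik_lin 0)) key// -!(linB io_lin) lerD//.
  by apply: le_trans (hM _) _; rewrite mulrC ler_wpM2r// vnorm_io.
rewrite -(linB (@Phi_lin _ _ G)); apply: le_trans (vnorm_io _) _.
by apply: le_trans (Phi_norm _) _; rewrite cnormBC.
Qed.

End gns.

(** * Homogeneous components and the KMS property *)

Lemma sum_int_single (V : zmodType) (N : nat) (d : int) (F : int -> V) :
  (absz d <= N)%N -> (forall j, j != d -> F j = 0) ->
  \sum_(i < N.*2.+1) F (i%:Z - N%:Z) = F d.
Proof.
move=> dN F0; have lt : (absz (d + N%:Z)%R < N.*2.+1)%N by lia.
rewrite (bigD1 (Ordinal lt))//= big1 => [|i].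
  by rewrite addr0; congr F; lia.
by move=> /eqP h; apply: F0; apply/eqP => e; apply: h; apply: val_inj => /=; lia.
Qed.

Section homogeneous.
Context {R : realType} {n : nat} (G : cuntz_system R n).
Local Notation O := (cs_O G).
Local Notation H := (cs_H G).
Local Notation S := (cs_S G).
Local Notation Fix := (fixed_algebra (cs_gauge G)).
Local Notation tau := (cs_tau G).
Local Notation Phi := (cs_Phi G).
Local Notation w2 := (word2 (cs_S G)).
Local Notation wd := (word (cs_S G)).
Local Notation Onc := (Onc (cs_S G)).
Local Notation io := (cs_iota G).
Local Notation rep := (cs_pi G).
Local Notation Phik := (cs_Phik G).
Local Notation psi := (@psi _ _ G).
Local Notation sigma := (@sigma _ _ G).
Implicit Types (a b f : O) (mu nu al be : seq 'I_n) (x y : H) (c : int -> R[i]).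

Lemma psi_w2 mu nu :
  psi (w2 mu nu) = if mu == nu then ((n%:R ^- size mu : R))%:C else 0.
Proof.
have [e|ne] := eqVneq (size mu) (size nu); first exact: psi_w2_eq.
rewrite psi_w2_deg; first by case: eqP => // e; rewrite e eqxx in ne.
by rewrite /degree; lia.
Qed.

Hypothesis n2 : (2 <= n)%N.

Let nR0 : n%:R != 0 :> R. Proof. by rewrite pnatr_eq0; lia. Qed.

Let wordS mu nu i : w2 mu nu * S i =
  match nu with [::] => w2 (rcons mu i) [::]
  | j :: nu' => if j == i then w2 mu nu' else 0 end.
Proof.
case: nu => [|j nu]; rewrite /word2.
  by rewrite -cats1 word_cat word_cons !word_nil star1 !mulr1.
rewrite word_cons starM -!mulrA; have [->|ji] := eqVneq j i.
  by rewrite star_SS mulr1.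
by rewrite star_S_diff// !mulr0.
Qed.

Let Sword mu nu i : S i * w2 mu nu = w2 (i :: mu) nu.
Proof. by rewrite /word2 word_cons mulrA. Qed.

Let wordSs mu nu i : w2 mu nu * star (S i) = w2 mu (i :: nu).
Proof. by rewrite /word2 word_cons starM mulrA. Qed.

Let Ssword mu nu i : star (S i) * w2 mu nu =
  match mu with [::] => w2 [::] (rcons nu i)
  | j :: mu' => if j == i then w2 mu' nu else 0 end.
Proof. by rewrite -[LHS]starK starM starK star_w2 wordS; case: mu => [|j mu]; [|case: ifP => _];
  rewrite ?star_w2 ?star0. Qed.

(** On words, [w2 mu nu * S i] loses a letter of [nu] while [S i * w2 mu nu] gains one in [mu], and
    each additional letter costs a factor 1/n in [psi]. This is the KMS property for one
    generator. *)
Lemma psi_S_cycle a i : Onc a -> psi (a * S i) = n%:R * psi (S i * a).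
Proof.
move: a; apply: Onc_ind => [|c mu nu b h]; first by rewrite mul0r mulr0 psi0 mulr0.
rewrite mulrDl mulrDr -scalerAl -scalerAr !psiD !psiZ h mulrDr mulrCA; congr (_ * _ + _).
rewrite wordS Sword; case: nu => [|j nu].
  rewrite !psi_w2 mulr0; case: eqP => // /(congr1 size).
  by rewrite size_rcons.
rewrite psi_w2 eqseq_cons eq_sym; case: eqP => //= _; last by rewrite psi0 mulr0.
rewrite psi_w2; case: eqP => _; last by rewrite mulr0.
rewrite -(rmorph_nat (real_complex R)) -rmorphM; congr _%:C.
by rewrite /= exprS invfM mulrA mulfV// mul1r.
Qed.

Lemma psi_Ss_cycle a i : Onc a ->
  psi (a * star (S i)) = n%:R^-1 * psi (star (S i) * a).
Proof.
move: a; apply: Onc_ind => [|c mu nu b h]; first by rewrite mul0r mulr0 psi0 mulr0.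
rewrite mulrDl mulrDr -scalerAl -scalerAr !psiD !psiZ h mulrDr mulrCA; congr (_ * _ + _).
rewrite wordSs Ssword; case: mu => [|j mu].
  rewrite !psi_w2; case: eqP => // _; case: eqP => [|_]; last by rewrite mulr0.
  by move=> /(congr1 size); rewrite size_rcons.
rewrite psi_w2 eqseq_cons; case: eqP => //= _; last by rewrite psi0 mulr0.
rewrite psi_w2; case: eqP => _; last by rewrite mulr0.
rewrite -(rmorph_nat (real_complex R)) -fmorphV -rmorphM; congr _%:C.
by rewrite /= exprS invfM.
Qed.

Lemma psi_word_cycle a mu : Onc a ->
  psi (a * wd mu) = n%:R ^+ size mu * psi (wd mu * a).
Proof.
elim: mu a => [|i mu IH] a Oa; first by rewrite word_nil mulr1 !mul1r.
have Oi : Onc (S i) by have := Onc_word G [:: i]; rewrite word_cons word_nil mulr1.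
rewrite word_cons mulrA IH; last exact: OncM.
rewrite mulrA psi_S_cycle; last by apply: OncM => //; exact: Onc_word.
by rewrite mulrA -exprSr mulrA.
Qed.

Lemma psi_star_word_cycle a mu : Onc a ->
  psi (a * star (wd mu)) = n%:R ^- size mu * psi (star (wd mu) * a).
Proof.
elim: mu a => [|i mu IH] a Oa.
  by rewrite word_nil star1 mulr1 !mul1r invr1 mul1r.
have Oi : Onc (star (S i)).
  by apply: Onc_star; have := Onc_word G [:: i]; rewrite word_cons word_nil mulr1.
rewrite word_cons starM mulrA psi_Ss_cycle; last exact/OncM/Onc_star/Onc_word.
rewrite mulrA IH; last exact: OncM.
by rewrite mulrA -invfM -exprS mulrA.
Qed.

Let i0 : 'I_n := Ordinal (ltnW n2).

(** The component of degree [j], formed inside the algebra. Nonnegative degrees need the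
    decomposition of 1 by all words of length [k]; for negative degrees one word suffices, because
    [star (wd nu) * wd nu = 1]. *)
Definition comp (j : int) (a : O) : O :=
  match j with
  | Posz k => \sum_(mu : k.-tuple 'I_n) wd mu * Phi (star (wd mu) * a)
  | Negz k => star (wd (nseq k.+1 i0)) * Phi (wd (nseq k.+1 i0) * a)
  end.

Let Phi_w2M mu nu al be : Phi (w2 mu nu * w2 al be) =
  if degree mu nu + degree al be == 0 then w2 mu nu * w2 al be else 0.
Proof.
case: (w2M G mu nu al be) => [->|[mu' [nu' [-> <-]]]]; last exact: Phi_w2.
by rewrite (lin0 (@Phi_lin _ _ G)); case: ifP.
Qed.

Lemma comp_lin j : linear (comp j).
Proof.
move=> c a b; case: j => k /=.
  rewrite scaler_sumr -big_split; apply: eq_bigr => mu _.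
  by rewrite /= mulrDr -scalerAr Phi_lin mulrDr -scalerAr.
by rewrite mulrDr -scalerAr Phi_lin mulrDr -scalerAr.
Qed.

Lemma comp_w2 j mu nu : comp j (w2 mu nu) = if degree mu nu == j then w2 mu nu else 0.
Proof.
have s1 al : star (wd al) = w2 [::] al by rewrite /word2 word_nil mul1r.
have s2 al : wd al = w2 al [::] by rewrite /word2 word_nil star1 mulr1.
case: j => k; rewrite /comp.
  rewrite (eq_bigr (fun al : k.-tuple 'I_n => wd al * star (wd al) *
    (if degree mu nu == k then w2 mu nu else 0))) => [|al _].
    by rewrite -mulr_suml word_sum mul1r.
  rewrite s1 Phi_w2M -s1 (_ : (_ == 0) = (degree mu nu == k)); last first.
    by rewrite /degree size_tuple /=; lia.
  by case: ifP; rewrite ?mulr0 ?mulrA.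
set al := nseq _ _; rewrite {2}s2 Phi_w2M -s2 (_ : (_ == 0) = (degree mu nu == Negz k)).
  by case: ifP => _; rewrite ?mulr0// mulrA star_word_word mul1r.
by rewrite /degree /al size_nseq /=; lia.
Qed.

Lemma io_comp j a : Onc a -> io (comp j a) = Phik j (io a).
Proof.
move: a; apply: Onc_ind => [|c mu nu b h].
  rewrite (lin0 (comp_lin j)) (lin0 (@io_lin _ _ G)); exact/esym/lin0/Phik_lin.
rewrite comp_lin comp_w2 !io_lin (Phik_lin j) h Phik_w2; congr (_ *: _ + _).
by case: ifP => // _; exact/lin0/io_lin.
Qed.

Lemma comp_sum a : Onc a -> exists M, forall N, (M <= N)%N ->
  a = \sum_(i < N.*2.+1) comp (i%:Z - N%:Z) a.
Proof.
move: a; apply: Onc_ind => [|c mu nu b [M h]].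
  by exists 0%N => N _; rewrite big1// => i _; exact/lin0/comp_lin.
exists (maxn M (absz (degree mu nu))) => N; rewrite geq_max => /andP[MN dN].
under eq_bigr do rewrite comp_lin.
rewrite big_split -scaler_sumr /= -h//; congr (_ *: _ + _).
rewrite (sum_int_single (d := degree mu nu) (F := fun j => comp j (w2 mu nu)))//.
  by rewrite comp_w2 eqxx.
by move=> j jd; rewrite comp_w2 eq_sym (negPf jd).
Qed.

Lemma Fix_io0 f : Fix f -> io f = 0 -> f = 0.
Proof.
move=> Ff h; apply: tau_faithful => //; rewrite -psi_fix; last exact/FixM/Ff/Fix_star.
by rewrite -dot_io h dot0r.
Qed.

(** Faithfulness of [psi] on [Onc] is reduced to that of [tau]: a component of an element of the
    kernel is built from values of [Phi], and multiplying it by a word or its adjoint leads back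
    into [Fix]. *)
Lemma io_inj a b : Onc a -> Onc b -> io a = io b -> a = b.
Proof.
move=> Oa Ob ab; apply/eqP; rewrite -subr_eq0; apply/eqP.
have Oc : Onc (a - b) by apply: OncD => //; exact: OncN.
have c0 : io (a - b) = 0 by rewrite (linB (@io_lin _ _ G)) ab subrr.
move: (a - b) Oc c0 => {a b Oa Ob ab} a Oa a0.
have [M hM] := comp_sum Oa; rewrite (hM M (leqnn M)) big1// => i _.
move: (_ - _) => j; have cj : io (comp j a) = 0.
  by rewrite io_comp// a0; exact/lin0/Phik_lin.
have rz b : rep b (io (comp j a)) = 0 by rewrite cj; exact/lin0/bounded_lin/rep_bounded.
case: j cj rz => k cj rz; rewrite /comp in cj rz *.
  rewrite big1// => mu _; set f := Phi _.
  suff -> : f = 0 by rewrite mulr0.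
  apply: Fix_io0; first exact: Phi_Fix.
  have := rz (star (wd mu)); rewrite rep_io mulr_sumr (bigD1 mu)//= mulrA.
  rewrite star_word_word mul1r big1 ?addr0// => nu nm.
  by rewrite mulrA star_word_diff ?mul0r// ?size_tuple// eq_sym.
set al := nseq _ _ in cj rz *; set f := Phi _ in cj rz *.
have ff : wd al * (star (wd al) * f) = 0.
  apply: Fix_io0; last by rewrite -rep_io rz.
  rewrite mulrA; apply: FixM; last exact: Phi_Fix.
  by apply: Fix_w2; rewrite /degree subrr.
by rewrite -[LHS]mul1r -(star_word_word G al) -mulrA ff mulr0.
Qed.

(** The operator c(D) acting on [Onc]. The choice has the same form as that of [sigma], which is
    therefore [dmul] for c(j) = n^j by conversion; uniqueness comes from [io_inj]. *)
Definition dmul c a : O := xget 0 [set b | Onc b /\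
  forall j, Phik j (io b) = c j *: Phik j (io a)].

Lemma dmulP c a : Onc a ->
  Onc (dmul c a) /\ forall j, Phik j (io (dmul c a)) = c j *: Phik j (io a).
Proof.
move=> Oa; apply: (@xgetPex _ 0 [set b | Onc b /\
  forall j, Phik j (io b) = c j *: Phik j (io a)]).
move: a Oa; apply: Onc_ind => [|d mu nu a [b [Ob hb]]].
  exists 0; split=> [|j]; first exact: Onc0.
  by rewrite (lin0 (@io_lin _ _ G)) (lin0 (Phik_lin j)) scaler0.
exists ((d * c (degree mu nu)) *: w2 mu nu + b); split=> [|j].
  by apply: OncD => //; exact/OncZ/Onc_w2.
rewrite !io_lin !(Phik_lin j) hb scalerDr; congr (_ + _); rewrite Phik_w2.
by case: eqP => [->|_]; rewrite ?scaler0// scalerA mulrC.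
Qed.

Lemma Onc_dmul c a : Onc a -> Onc (dmul c a). Proof. by case/(dmulP c). Qed.

Lemma dmul_eq c a b : Onc a -> Onc b ->
  (forall j, Phik j (io b) = c j *: Phik j (io a)) -> dmul c a = b.
Proof.
move=> Oa Ob h; have [Od hd] := dmulP c Oa; apply: io_inj => //.
by apply: (odec_eq (odec_Phik G)) => j; rewrite hd h.
Qed.

Lemma dmul_ext c d a : Onc a ->
  (forall j, Phik j (io a) != 0 -> c j = d j) -> dmul c a = dmul d a.
Proof.
move=> Oa h; apply: dmul_eq => //; first exact: Onc_dmul.
move=> j; have [_ ->] := dmulP d Oa.
by have [->|/h->//] := eqVneq (Phik j (io a)) 0; rewrite !scaler0.
Qed.

Lemma dmul_lin c z a b : Onc a -> Onc b ->
  dmul c (z *: a + b) = z *: dmul c a + dmul c b.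
Proof.
move=> Oa Ob; have [Oda hda] := dmulP c Oa; have [Odb hdb] := dmulP c Ob.
apply: dmul_eq => [||j]; [exact/OncD/Ob/OncZ|exact/OncD/Odb/OncZ|].
by rewrite !io_lin !(Phik_lin j) hda hdb scalerDr !scalerA mulrC.
Qed.

Lemma dmul0 c : dmul c 0 = 0.
Proof.
apply: dmul_eq => [||j]; [exact: Onc0|exact: Onc0|].
by rewrite (lin0 (@io_lin _ _ G)) (lin0 (Phik_lin j)) scaler0.
Qed.

Lemma dmulD c a b : Onc a -> Onc b -> dmul c (a + b) = dmul c a + dmul c b.
Proof. by move=> Oa Ob; have := dmul_lin c 1 Oa Ob; rewrite !scale1r. Qed.

Lemma dmul_sum c (I : Type) (r : seq I) (P : pred I) (F : I -> O) :
  (forall i, Onc (F i)) ->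
  dmul c (\sum_(i <- r | P i) F i) = \sum_(i <- r | P i) dmul c (F i).
Proof.
move=> h; elim: r => [|i r IH]; first by rewrite !big_nil dmul0.
rewrite !big_cons; case: ifP => // _; rewrite dmulD ?IH//.
by apply: Onc_sum => j _; exact: h.
Qed.

Lemma dmul_w2 c mu nu : dmul c (w2 mu nu) = c (degree mu nu) *: w2 mu nu.
Proof.
apply: dmul_eq => [||j]; [exact: Onc_w2|exact/OncZ/Onc_w2|].
rewrite (linZ (@io_lin _ _ G)) (linZ (Phik_lin j)) Phik_w2.
by case: eqP => [->//|_]; rewrite !scaler0.
Qed.

Lemma dmul_w2M c mu nu al be : dmul c (w2 mu nu * w2 al be) =
  c (degree mu nu + degree al be) *: (w2 mu nu * w2 al be).
Proof.
case: (w2M G mu nu al be) => [->|[mu' [nu' [-> <-]]]]; last exact: dmul_w2.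
by rewrite dmul0 scaler0.
Qed.

Lemma dmul_dmul c d a : Onc a -> dmul c (dmul d a) = dmul (fun j => c j * d j) a.
Proof.
move=> Oa; have [Od hd] := dmulP d Oa; have [Oe he] := dmulP (fun j => c j * d j) Oa.
by apply: dmul_eq => // j; rewrite he hd scalerA.
Qed.

Lemma dmul_addc c d a : Onc a -> dmul (fun j => c j + d j) a = dmul c a + dmul d a.
Proof.
move=> Oa; have [Oc hc] := dmulP c Oa; have [Od hd] := dmulP d Oa.
apply: dmul_eq => // [|j]; first exact: OncD.
by rewrite (linD (@io_lin _ _ G)) (linD (Phik_lin j)) hc hd scalerDl.
Qed.

Lemma dmul_scalec c z a : Onc a -> dmul (fun j => z * c j) a = z *: dmul c a.
Proof.
move=> Oa; have [Oc hc] := dmulP c Oa.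
apply: dmul_eq => // [|j]; first exact: OncZ.
by rewrite (linZ (@io_lin _ _ G)) (linZ (Phik_lin j)) hc scalerA.
Qed.

Lemma dmul1 a : Onc a -> dmul (fun=> 1) a = a.
Proof. by move=> Oa; apply: dmul_eq => // j; rewrite scale1r. Qed.

(** Membership in [Onc] is carried along because the maps built from [dmul] are known to be linear
    only there. *)
Lemma bilinear_words (B1 B2 : O -> O -> O) :
  (forall z a a' b, Onc a -> Onc a' -> Onc b -> B1 (z *: a + a') b = z *: B1 a b + B1 a' b) ->
  (forall z a a' b, Onc a -> Onc a' -> Onc b -> B2 (z *: a + a') b = z *: B2 a b + B2 a' b) ->
  (forall z a b b', Onc a -> Onc b -> Onc b' -> B1 a (z *: b + b') = z *: B1 a b + B1 a b') ->
  (forall z a b b', Onc a -> Onc b -> Onc b' -> B2 a (z *: b + b') = z *: B2 a b + B2 a b') ->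
  (forall mu nu al be, B1 (w2 mu nu) (w2 al be) = B2 (w2 mu nu) (w2 al be)) ->
  forall a b, Onc a -> Onc b -> B1 a b = B2 a b.
Proof.
move=> l1 l2 r1 r2 h.
have z1 (B : O -> O -> O) : (forall z a a' b, Onc a -> Onc a' -> Onc b ->
    B (z *: a + a') b = z *: B a b + B a' b) -> forall b, Onc b -> B 0 b = 0.
  move=> hB b Ob; have := hB (-1) 0 0 b (Onc0 G) (Onc0 G) Ob.
  by rewrite !scaleN1r oppr0 addr0 addNr.
have z2 (B : O -> O -> O) : (forall z a b b', Onc a -> Onc b -> Onc b' ->
    B a (z *: b + b') = z *: B a b + B a b') -> forall a, Onc a -> B a 0 = 0.
  move=> hB a Oa; have := hB (-1) a 0 0 Oa (Onc0 G) (Onc0 G).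
  by rewrite !scaleN1r oppr0 addr0 addNr.
have Ow := Onc_w2 G.
have s1 mu nu b : Onc b -> B1 (w2 mu nu) b = B2 (w2 mu nu) b.
  move=> Ob; suff [] : Onc b /\ B1 (w2 mu nu) b = B2 (w2 mu nu) b by [].
  move: b Ob; apply: Onc_ind => [|c al be b [Ob e]].
    by split; [exact: Onc0|rewrite z2// z2].
  split; first exact/OncD/Ob/OncZ.
  by rewrite r1// r2// h e.
move=> a b Oa Ob; suff [] : Onc a /\ B1 a b = B2 a b by [].
move: a Oa; apply: Onc_ind => [|c mu nu a [Oa e]].
  by split; [exact: Onc0|rewrite z1// z1].
split; first exact/OncD/Oa/OncZ.
by rewrite l1// l2// s1 // e.
Qed.

Lemma dmul_derivation c a b : Onc a -> Onc b -> (forall i j, c (i + j) = c i + c j) ->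
  dmul c (a * b) = dmul c a * b + a * dmul c b.
Proof.
move=> Oa Ob hc; move: a b Oa Ob; apply: bilinear_words.
- move=> z a a' b Oa Oa' Ob; rewrite mulrDl -scalerAl dmul_lin//; exact: OncM.
- move=> z a a' b Oa Oa' Ob; rewrite dmul_lin// !mulrDl -!scalerAl scalerDr.
  by rewrite addrACA.
- move=> z a b b' Oa Ob Ob'; rewrite mulrDr -scalerAr dmul_lin//; exact: OncM.
- move=> z a b b' Oa Ob Ob'; rewrite dmul_lin// !mulrDr -!scalerAr scalerDr.
  by rewrite addrACA.
- move=> mu nu al be; rewrite dmul_w2M !dmul_w2 hc scalerDl.
  by rewrite -scalerAl -scalerAr.
Qed.

(** As in [Phik_rep_fix], [Phi f] takes the place of [f]: only words of degree 0 survive on the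
    right, and they leave the degree of the left factor unchanged. *)
Lemma dmul_fixr c a f : Onc a -> Onc f -> Fix f -> dmul c (a * f) = dmul c a * f.
Proof.
move=> Oa Of Ff; rewrite -(Phi_fix Ff).
have OP b : Onc b -> Onc (Phi b) by case/Phi_Onc.
move: a f Oa Of {Ff}; apply: (bilinear_words
  (B1 := fun a f => dmul c (a * Phi f)) (B2 := fun a f => dmul c a * Phi f)).
- move=> z a a' b Oa Oa' Ob; rewrite mulrDl -scalerAl dmul_lin//; exact/OncM/OP.
- by move=> z a a' b Oa Oa' Ob; rewrite dmul_lin// mulrDl scalerAl.
- move=> z a b b' Oa Ob Ob'; rewrite Phi_lin mulrDr -scalerAr dmul_lin//; exact/OncM/OP.
- by move=> z a b b' Oa Ob Ob'; rewrite Phi_lin mulrDr scalerAr.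
- move=> mu nu al be; rewrite Phi_w2; case: eqP => [d0|_]; last by rewrite !mulr0 dmul0.
  by rewrite dmul_w2M dmul_w2 d0 addr0 scalerAl.
Qed.

Lemma dmul_star c a : Onc a -> dmul c (star a) = star (dmul (fun j => (c (- j))^*) a).
Proof.
move=> Oa; suff [] : Onc a /\ dmul c (star a) = star (dmul (fun j => (c (- j))^*) a) by [].
move: a Oa; apply: Onc_ind => [|z mu nu b [Ob e]].
  by split; [exact: Onc0|rewrite star0 !dmul0 star0].
split; first by apply: OncD => //; exact/OncZ/Onc_w2.
have Osw : Onc (star (w2 mu nu)) by exact/Onc_star/Onc_w2.
have Osb : Onc (star b) by exact: Onc_star.
rewrite starD starZ (dmul_lin c _ Osw Osb) e dmul_lin//; last exact: Onc_w2.
rewrite starD starZ star_w2 !dmul_w2 starZ star_w2 conjCK.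
by congr (_ *: (c _ *: _) + _); rewrite /degree opprB.
Qed.

Lemma sigmaE a : sigma a = dmul (fun j => ((n%:R ^ j : R))%:C) a.
Proof. by []. Qed.

(** For a word, [star (wd nu)] is moved to the front first and [wd mu] second; the two powers of n
    combine to n to the degree of the word. *)
Lemma KMS a b : Onc a -> Onc b -> psi (a * b) = psi (sigma b * a).
Proof.
move=> Oa Ob; rewrite sigmaE.
suff [] : Onc b /\ psi (a * b) = psi (dmul (fun j => ((n%:R ^ j : R))%:C) b * a) by [].
move: b Ob; apply: Onc_ind => [|z mu nu b [Ob e]].
  by split; [exact: Onc0|rewrite mulr0 dmul0 mul0r].
split; first by apply: OncD => //; exact/OncZ/Onc_w2.
rewrite dmul_lin ?dmul_w2//; last exact: Onc_w2.
rewrite mulrDr mulrDl !psiD -scalerAr -!scalerAl !psiZ e; congr (_ * _ + _).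
rewrite {1}/word2 mulrA psi_star_word_cycle; last exact/OncM/Onc_word.
rewrite mulrA psi_word_cycle; last exact/OncM/Oa/Onc_star/Onc_word.
rewrite !mulrA /word2; congr (_ * _).
rewrite /degree expfzDr// rmorphM/= mulrC; congr (_ * _).
  by rewrite -exprnP rmorphXn rmorph_nat.
by rewrite -exprnN -(rmorph_nat (real_complex R)) -rmorphXn -fmorphV.
Qed.

Lemma psi_dmul_id a : Onc a -> psi (dmul (fun j => j%:~R) a) = 0.
Proof.
move: a => a Oa; suff [] : Onc a /\ psi (dmul (fun j => j%:~R) a) = 0 by [].
move: a Oa; apply: Onc_ind => [|z mu nu b [Ob e]].
  by split; [exact: Onc0|rewrite dmul0 psi0].
split; first by apply: OncD => //; exact/OncZ/Onc_w2.
rewrite dmul_lin ?dmul_w2//; last exact: Onc_w2.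
rewrite psiD !psiZ e addr0; have [->|d0] := eqVneq (degree mu nu) 0.
  by rewrite mulr0z mul0r mulr0.
by rewrite psi_w2_deg// !mulr0.
Qed.

End homogeneous.

(** * The von Neumann algebra and its trace *)

Section commutants.
Context {R : realType} {V : innerType R}.
Implicit Types (X : set (V -> V)) (A B : V -> V).

Lemma commutant_id X : commutant X id.
Proof. by split=> //; exact: bounded_id. Qed.

Lemma commutant_bounded X A : commutant X A -> bounded_op A. Proof. by case. Qed.

Lemma commutant_comp X A B : commutant X A -> commutant X B -> commutant X (A \o B).
Proof.
move=> [bA hA] [bB hB]; split=> [|C XC]; first exact: bounded_comp.
apply/funext => x /=; have eA := congr1 (@^~ (B x)) (hA C XC).
have eB := congr1 (@^~ x) (hB C XC); rewrite /= in eA eB.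
by rewrite eB eA.
Qed.

Lemma commutant_add X A B : (forall C, X C -> linear C) ->
  commutant X A -> commutant X B -> commutant X (A + B).
Proof.
move=> lX [bA hA] [bB hB]; split=> [|C XC]; first exact: bounded_add.
apply/funext => x /=; rewrite !addfE (linD (lX C XC)).
have eA := congr1 (@^~ x) (hA C XC); have eB := congr1 (@^~ x) (hB C XC).
by rewrite /= in eA eB; rewrite eA eB.
Qed.

Lemma commutant_scale X c A : (forall C, X C -> linear C) ->
  commutant X A -> commutant X (c *: A).
Proof.
move=> lX [bA hA]; split=> [|C XC]; first exact: bounded_scale.
apply/funext => x /=; rewrite !scalefE (linZ (lX C XC)).
by have eA := congr1 (@^~ x) (hA C XC); rewrite /= in eA; rewrite eA.
Qed.

(** This takes the place of strong limits: an operator lies in a commutant once its compositions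
    with a total family of projections of that commutant do. *)
Lemma commutant_odec X A (I : countType) (Q : I -> V -> V) :
  (forall C, X C -> linear C) -> bounded_op A -> odec Q ->
  (forall i, commutant X (Q i)) -> (forall i, commutant X (Q i \o A)) ->
  commutant X A.
Proof.
move=> lX bA oQ hQ hQA; split=> // C XC; apply/funext => x.
apply: (odec_eq oQ) => i /=.
have e1 := congr1 (@^~ x) ((hQA i).2 C XC).
have e2 := congr1 (@^~ (A x)) ((hQ i).2 C XC); rewrite /= in e1 e2.
by rewrite e1 e2.
Qed.

Lemma commutant_linear X : forall C, commutant X C -> linear C.
Proof. by move=> C [[]]. Qed.

Lemma vN_gen X A : X A -> bounded_op A -> vN_generated X A.
Proof. by move=> XA bA; split=> // C [_ hC]; rewrite hC//; left. Qed.

End commutants.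

(** * Linear extension of functionals from positive operators *)

Section linear_extension.
Context {R : realType} {V : innerType R}.
Implicit Types (K N : set (V -> V)) (T A B : V -> V) (phi : (V -> V) -> \bar R).

Let qf A x : R := complex.Re (dot x (A x)).

(** Real and imaginary part of the quadratic form separate the two differences. Sums are compared
    instead of differences, because the functionals are additive on the cone of positive
    operators. *)
Lemma pos_parts_eq A1 A2 A3 A4 B1 B2 B3 B4 :
  (forall A, A \in [:: A1; A2; A3; A4; B1; B2; B3; B4] -> linear A /\ pos_op A) ->
  A1 - A2 + 'i *: (A3 - A4) = B1 - B2 + 'i *: (B3 - B4) ->
  A1 + B2 = B1 + A2 /\ A3 + B4 = B3 + A4.
Proof.
move=> h e.
have hA A : A \in [:: A1; A2; A3; A4; B1; B2; B3; B4] ->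
    forall x, dot x (A x) = (qf A x)%:C by move=> /h[_ pA] x; exact: pos_real.
have key x : qf A1 x + qf B2 x = qf B1 x + qf A2 x /\
             qf A3 x + qf B4 x = qf B3 x + qf A4 x.
  have := congr1 (fun T => dot x (T x)) e.
  rewrite !addfE !oppfE !scalefE !addfE !oppfE !(dotDr, dotNr, dotZr).
  rewrite !hA ?inE ?eqxx ?orbT//.
  move=> /eqP; rewrite eq_complex/= => /andP[/eqP e1 /eqP e2].
  by split; lra.
have lin A B : A \in [:: A1; A2; A3; A4; B1; B2; B3; B4] ->
  B \in [:: A1; A2; A3; A4; B1; B2; B3; B4] -> linear (A + B).
  move=> /h[lA _] /h[lB _] c x y.
  by rewrite !addfE lA lB scalerDr addrACA.
split; apply: bounded_polar => [||x]; try by apply: lin; rewrite !inE eqxx /= ?orbT.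
  rewrite !addfE !dotDr !hA ?inE ?eqxx ?orbT// -!rmorphD/=; congr _%:C.
  by have [] := key x.
rewrite !addfE !dotDr !hA ?inE ?eqxx ?orbT// -!rmorphD/=; congr _%:C.
by have [] := key x.
Qed.

Lemma lin_extE K (f : (V -> V) -> R) T z :
  (forall A, K A -> linear A /\ pos_op A) ->
  (forall A B, K A -> K B -> f (A + B) = f A + f B) ->
  lin_ext_at K f T z -> lin_ext K f T = z.
Proof.
move=> hK fD [A1 [A2 [A3 [A4 [[K1 K2 K3 K4] TA zA]]]]].
apply: xget_unique; first by exists A1, A2, A3, A4.
move=> w [B1 [B2 [B3 [B4 [[L1 L2 L3 L4] TB ->]]]]]; rewrite zA.
have [||e1 e2] := @pos_parts_eq A1 A2 A3 A4 B1 B2 B3 B4.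
- by move=> A; rewrite !inE => /or4P[/eqP->|/eqP->|/eqP->|/or4P[/eqP->|/eqP->|/eqP->|/orP[]/eqP->]];
    exact: hK.
- by rewrite -TA -TB.
- have := congr1 f e1; have := congr1 f e2; rewrite !fD// => h2 h1.
  by congr (_ +i* _); lra.
Qed.

(** The trace of a Theta operator is prescribed as a value of the complex linear extension; for a
    positive operator this determines the extended real value itself, finiteness included. *)
Lemma trace_at_pos N phi T z : (forall A, N A -> linear A) -> N 0 ->
  phi 0 = 0%E ->
  (forall A B, pos_part N A -> pos_part N B -> phi (A + B) = (phi A + phi B)%E) ->
  (forall A, pos_part N A -> (0 <= phi A)%E) ->
  pos_part N T -> trace_at N phi T z -> phi T = (complex.Re z)%:E.
Proof.
move=> lN N0 p0 pD pge pT [A1 [A2 [A3 [A4 [[[q1 f1] [q2 f2] [q3 f3] [q4 f4]] TA ->]]]]].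
have pp A : pos_part N A -> linear A /\ pos_op A by move=> [/lN].
have P0 : pos_part N 0 by split=> //; exact: pos_0.
have [||e1 e2] := @pos_parts_eq A1 A2 A3 A4 T 0 0 0.
- by move=> A; rewrite !inE => /or4P[/eqP->|/eqP->|/eqP->|/or4P[/eqP->|/eqP->|/eqP->|/orP[]/eqP->]];
    exact: pp.
- by rewrite -TA !subr0 scaler0 addr0.
have : (phi A1 = phi T + phi A2)%E by rewrite -pD// -e1 addr0.
have : phi A2 \is a fin_num by rewrite ge0_fin_numE//; exact: pge.
have : phi A1 \is a fin_num by rewrite ge0_fin_numE//; exact: pge.
move=> F1 F2 E1 /=; rewrite EFinB !fineK// E1 -addeA subee// adde0.
by [].
Qed.

End linear_extension.

(** * The trace of f Phi_j *)

Section theta_vN.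
Context {R : realType} {n : nat} (G : cuntz_system R n).
Local Notation O := (cs_O G).
Local Notation H := (cs_H G).
Local Notation S := (cs_S G).
Local Notation Fix := (fixed_algebra (cs_gauge G)).
Local Notation Phi := (cs_Phi G).
Local Notation w2 := (word2 (cs_S G)).
Local Notation wd := (word (cs_S G)).
Local Notation Onc := (Onc (cs_S G)).
Local Notation io := (cs_iota G).
Local Notation rep := (cs_pi G).
Local Notation Phik := (cs_Phik G).
Local Notation ttau := (cs_ttau G).
Local Notation psi := (@psi _ _ G).
Local Notation NN := (Theta_vN (cs_S G) (cs_Phi G) (cs_iota G)).
Implicit Types (a b f : O) (mu nu : seq 'I_n).

(** The operator Theta of [a] and [b]: on the Hilbert space [Phik 0] implements [Phi]. *)
Definition th a b : H -> H := rep a \o Phik 0 \o rep (star b).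

Lemma th_bounded a b : bounded_op (th a b).
Proof. exact/bounded_comp/rep_bounded/bounded_comp/Phik_bounded/rep_bounded. Qed.

Lemma th_Theta a b : is_Theta Phi io a b (th a b).
Proof.
by split=> [|z]; [exact: th_bounded|rewrite /th /= rep_io Phik0_io rep_io].
Qed.

Lemma NN_th a b : Onc a -> Onc b -> NN (th a b).
Proof.
move=> Oa Ob; apply: vN_gen; last exact: th_bounded.
by exists a, b; split=> //; exact: th_Theta.
Qed.

Lemma NN_bounded A : NN A -> bounded_op A. Proof. exact: commutant_bounded. Qed.

Lemma NN_id : NN id. Proof. exact: commutant_id. Qed.

Lemma NN_comp A B : NN A -> NN B -> NN (A \o B).
Proof. exact: commutant_comp. Qed.

Lemma NN_add A B : NN A -> NN B -> NN (A + B).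
Proof. by apply: commutant_add; exact: commutant_linear. Qed.

Lemma NN_scale c A : NN A -> NN (c *: A).
Proof. by apply: commutant_scale; exact: commutant_linear. Qed.

Lemma NN_0 : NN 0.
Proof. by rewrite -(scale0r id); exact/NN_scale/NN_id. Qed.

Lemma NN_sum (I : Type) (r : seq I) (P : pred I) (F : I -> H -> H) :
  (forall i, P i -> NN (F i)) -> NN (\sum_(i <- r | P i) F i).
Proof. by move=> h; apply: big_ind => //; [exact: NN_0|exact: NN_add]. Qed.

Lemma th_pos a : pos_op (th a a).
Proof.
move=> x; rewrite /th /= -[a in rep a]starK -rep_adj.
exact/proj_pos/Phik_proj.
Qed.

Lemma ttau_ge0 A : pos_part NN A -> (0 <= ttau A)%E.
Proof. by case: (cs_ttauP G) => -[h _ _ _] _ _ _; exact: h. Qed.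

Lemma ttau_add A B : pos_part NN A -> pos_part NN B ->
  ttau (A + B) = (ttau A + ttau B)%E.
Proof. by case: (cs_ttauP G) => -[_ h _ _] _ _ _; exact: h. Qed.

Lemma ttau_scale (c : R) A : 0 <= c -> pos_part NN A ->
  ttau (c%:C *: A) = (c%:E * ttau A)%E.
Proof. by case: (cs_ttauP G) => -[_ _ h _] _ _ _; exact: h. Qed.

Lemma NN_pos_0 : pos_part NN 0.
Proof. by split; [exact: NN_0|exact: pos_0]. Qed.

Lemma NN_pos_add A B : pos_part NN A -> pos_part NN B -> pos_part NN (A + B).
Proof. by move=> [? ?] [? ?]; split; [exact: NN_add|exact: pos_add]. Qed.

Lemma ttau_0 : ttau 0 = 0%E.
Proof.
by rewrite -(scale0r 0) (ttau_scale (lexx 0)) ?mul0e//; exact: NN_pos_0.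
Qed.

Lemma NN_pos_sum (I : Type) (r : seq I) (P : pred I) (F : I -> H -> H) :
  (forall i, P i -> pos_part NN (F i)) ->
  pos_part NN (\sum_(i <- r | P i) F i).
Proof. by move=> h; apply: big_ind => //; [exact: NN_pos_0|exact: NN_pos_add]. Qed.

Lemma ttau_sum (I : Type) (r : seq I) (P : pred I) (F : I -> H -> H) :
  (forall i, P i -> pos_part NN (F i)) ->
  (ttau (\sum_(i <- r | P i) F i)%R = \sum_(i <- r | P i) ttau (F i))%E.
Proof.
move=> h; elim: r => [|i r IH]; first by rewrite !big_nil ttau_0.
rewrite !big_cons; case: ifP => // Pi; rewrite ttau_add ?IH//; first exact: h.
exact: NN_pos_sum.
Qed.

Lemma th_pos_part a : Onc a -> pos_part NN (th a a).
Proof. by move=> Oa; split; [exact: NN_th|exact: th_pos]. Qed.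

Lemma ttau_th a : Onc a -> ttau (th a a) = (complex.Re (psi (star a * a)))%:E.
Proof.
move=> Oa; have h := cs_ttau_Theta Oa Oa (th_Theta a a).
apply: (trace_at_pos _ _ _ _ _ _ h).
- exact: commutant_linear.
- exact: NN_0.
- exact: ttau_0.
- exact: ttau_add.
- exact: ttau_ge0.
- exact: th_pos_part.
Qed.

Hypothesis n2 : (2 <= n)%N.
Let i0 : 'I_n := Ordinal (ltnW n2).

Let s1 mu : star (wd mu) = w2 [::] mu. Proof. by rewrite /word2 word_nil mul1r. Qed.
Let s2 mu : wd mu = w2 mu [::]. Proof. by rewrite /word2 word_nil star1 mulr1. Qed.

(** The sum of [wd mu * star (wd mu)] over the words of length [k] is inserted; [star (wd mu)]
    lowers the degree by [k] and so turns [Phik k] into [Phik 0]. *)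
Lemma Phik_th_pos a b (k : nat) : Onc b -> Fix b ->
  rep (a * star b) \o Phik k = \sum_(mu : k.-tuple 'I_n) th (a * wd mu) (b * wd mu).
Proof.
move=> Ob Fb; have Osb := Onc_star Ob; have Fsb := Fix_star Fb.
rewrite -[X in a * X]mul1r -(word_sum G k) mulr_suml mulr_sumr rep_sum.
apply/funext => x; rewrite /= !sumfE; apply: eq_bigr => mu _.
rewrite /th starM !repM /= -(Phik_rep_fix _ _ Osb Fsb) s1 Phik_rep_w2.
by congr (rep _ (rep _ (rep _ (Phik _ _)))); rewrite /degree size_tuple /=; lia.
Qed.

Lemma Phik_th_neg a b (k : nat) : Onc b -> Fix b ->
  let nu := nseq k i0 in
  rep (a * star b) \o Phik (- k%:Z) = th (a * star (wd nu)) (b * star (wd nu)).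
Proof.
move=> Ob Fb nu; have Osb := Onc_star Ob; have Fsb := Fix_star Fb.
rewrite -[X in a * X]mul1r -(star_word_word G nu).
apply/funext => x; rewrite /th starM starK !repM /= -(Phik_rep_fix _ _ Osb Fsb).
rewrite [X in Phik 0 (rep X _)]s2 Phik_rep_w2.
rewrite -s2; congr (rep _ (rep _ (rep _ (Phik _ _)))).
by rewrite /degree /nu size_nseq /=; lia.
Qed.

Lemma NN_rep_Phik_pos b j : Onc b -> Fix b ->
  pos_part NN (rep (b * star b) \o Phik j).
Proof.
move=> Ob Fb; case: (intP j) => [|k|k].
- by rewrite Phik_th_pos//; apply: NN_pos_sum => mu _; exact/th_pos_part/OncM/Onc_word.
- by rewrite Phik_th_pos//; apply: NN_pos_sum => mu _; exact/th_pos_part/OncM/Onc_word.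
- by rewrite Phik_th_neg//; exact/th_pos_part/OncM/Onc_star/Onc_word.
Qed.

(** Each [th] contributes a value of [psi]; moving its word around by the KMS property produces n^j,
    after which the words again combine to 1. *)
Lemma ttau_rep_Phik b j : Onc b -> Fix b ->
  ttau (rep (b * star b) \o Phik j) = (n%:R ^ j * complex.Re (psi (b * star b)))%:E.
Proof.
move=> Ob Fb; have Osb := Onc_star Ob; have Fsb := Fix_star Fb.
have psiC : psi (b * star b) = psi (star b * b).
  by rewrite psi_fix ?psi_fix; [exact: tauC|exact: FixM|exact: FixM].
have Obb : Onc (star b * b) by exact: OncM.
have pos (k : nat) : ttau (rep (b * star b) \o Phik k) =
    (n%:R ^ k%:Z * complex.Re (psi (b * star b)))%:E.
  rewrite Phik_th_pos// ttau_sum; last by move=> mu _; exact/th_pos_part/OncM/Onc_word.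
  rewrite (eq_bigr (fun mu : k.-tuple 'I_n =>
      (n%:R ^+ k * complex.Re (psi (wd mu * star (wd mu) * (star b * b))))%:E)).
    rewrite sumEFin; congr _%:E; rewrite -mulr_sumr -Re_sum -psi_sum -mulr_suml.
    by rewrite word_sum mul1r psiC.
  move=> mu _; rewrite ttau_th; last exact/OncM/Onc_word.
  rewrite starM mulrA psi_word_cycle//; last first.
    by apply/OncM/Ob/OncM/Osb/Onc_star/Onc_word.
  rewrite size_tuple -(rmorph_nat (real_complex R)) -rmorphXn/= ReZ.
  by rewrite !mulrA.
case: (intP j) => [|k|k]; [exact: pos|exact: pos|].
rewrite Phik_th_neg// ttau_th; last exact/OncM/Onc_star/Onc_word.
rewrite starM starK mulrA psi_star_word_cycle//; last first.
  by apply/OncM/Ob/OncM/Osb/Onc_word.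
rewrite size_nseq -mulrA !(mulrA _ (wd _)) star_word_word mul1r psiC -exprnN.
by rewrite -(rmorph_nat (real_complex R)) -rmorphXn -fmorphV/= ReZ.
Qed.

Lemma NN_Phik j : NN (Phik j).
Proof.
have [+ _] := NN_rep_Phik_pos j (Onc1 G) (Fix1 G).
by rewrite star1 mulr1 rep1.
Qed.

Lemma NN_odec A : bounded_op A -> (forall j, NN (Phik j \o A)) -> NN A.
Proof.
move=> bA h; apply: (commutant_odec _ bA (odec_Phik G)) => //.
- exact: commutant_linear.
- exact: NN_Phik.
Qed.

Lemma NN_odiag (c : int -> R) (C : R) : (forall j, `|c j| <= C) -> NN (odiag Phik c).
Proof.
move=> hC; have [bc hc] := odiagP (@complete_H _ _ G) (odec_Phik G) hC.
apply: NN_odec => // j; have -> : Phik j \o odiag Phik c = (c j)%:C *: Phik j.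
  by apply/funext => x; rewrite scalefE /= hc.
exact/NN_scale/NN_Phik.
Qed.

(** Each [Phik j \o rep f] is a finite sum of [th] operators, which is all that [NN_odec] asks
    for. *)
Lemma NN_rep f : Onc f -> Fix f -> NN (rep f).
Proof.
move=> Of Ff; apply: NN_odec => [|j]; first exact: rep_bounded.
have -> : Phik j \o rep f = rep (f * star 1) \o Phik j.
  by apply/funext => x; rewrite /= star1 mulr1 Phik_rep_fix.
have O1 := Onc1 G; have F1 := Fix1 G.
case: (intP j) => [|k|k].
- by rewrite Phik_th_pos//; apply: NN_sum => mu _; apply: NN_th; apply: OncM => //; exact: Onc_word.
- by rewrite Phik_th_pos//; apply: NN_sum => mu _; apply: NN_th; apply: OncM => //; exact: Onc_word.
- by rewrite Phik_th_neg//; apply: NN_th; apply: OncM => //; exact/Onc_star/Onc_word.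
Qed.

End theta_vN.

(** * Symmetric sums over the integers *)

Lemma sum_int_sym (V : zmodType) (N : nat) (F : int -> V) :
  \sum_(i < N.*2.+1) F (i%:Z - N%:Z) =
  F 0 + \sum_(0 <= m < N) (F m.+1%:Z + F (- m.+1%:Z)).
Proof.
elim: N => [|N IH]; first by rewrite big_ord1 big_geq// !addr0.
rewrite doubleS big_ord_recl big_ord_recr /= big_nat_recr//= [RHS]addrA -IH addrCA.
congr (_ + _).
  by apply: eq_bigr => i _; congr F; rewrite /bump; lia.
by rewrite addrC; congr (F _ + F _); rewrite /bump; lia.
Qed.

Section odec_int.
Context {R : realType} {V : innerType R} (cV : complete_inner V).
Variable Q : int -> V -> V.
Hypothesis oQ : odec Q.
Implicit Types (x y : V) (A B : V -> V).

(** Degrees m and -m are joined, so that the symmetric partial sums of [strong_sum] become ordinary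
    partial sums of a decomposition indexed by [nat]. *)
Let Qs m : V -> V := if m is m'.+1 then Q m'.+1%:Z + Q (- m'.+1%:Z) else Q 0.

Let oQs : odec Qs.
Proof.
have [pQ orQ tQ] := oQ; have lQ j := proj_lin (pQ j).
split=> [[|m]|[|i] [|j] x ij|x hx].
- exact: pQ.
- have [b1 _ a1] := pQ m.+1%:Z; have [b2 _ a2] := pQ (- m.+1%:Z).
  split; [exact: bounded_add| |exact: adjoint_add].
  apply/funext => x; rewrite /= !addfE (linD (lQ _)) (linD (lQ _)).
  by rewrite !proj_idem// (orQ _ (- m.+1%:Z))// (orQ _ m.+1%:Z)// addr0 add0r.
- by rewrite eqxx in ij.
- by rewrite /= addfE (linD (lQ _)) !orQ// addr0.
- by rewrite /= addfE !orQ// addr0.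
- rewrite /= !addfE !(linD (lQ _)) !orQ ?addr0//; lia.
- apply: tQ => j; case: (intP j) => [|m|m].
  + exact: (hx 0%N).
  + have := congr1 (Q m.+1%:Z) (hx m.+1); rewrite /= addfE (linD (lQ _)).
    by rewrite proj_idem// orQ// addr0 (lin0 (lQ _)).
  + have := congr1 (Q (- m.+1%:Z)) (hx m.+1); rewrite /= addfE (linD (lQ _)).
    by rewrite proj_idem// orQ// add0r (lin0 (lQ _)).
Qed.

Lemma odec_int_sum x : vlim (fun m => \sum_(i < m.*2.+1) Q (i%:Z - m%:Z) x) x.
Proof.
move=> e e0; have [N hN] := odec_sum cV oQs x e0; exists N => m Nm.
rewrite (sum_int_sym m (fun j => Q j x)).
by have := hN m.+1 (leq_trans Nm (leqnSn m)); rewrite big_nat_recl.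
Qed.

Lemma odec_op_ext A B : bounded_op A -> bounded_op B ->
  (forall j x, A (Q j x) = B (Q j x)) -> A = B.
Proof.
move=> bA bB h; apply/funext => x; have lx := odec_int_sum x.
apply: (vlim_unique (bounded_lim bA lx)).
have -> : A \o (fun m => \sum_(i < m.*2.+1) Q (i%:Z - m%:Z) x) =
          B \o (fun m => \sum_(i < m.*2.+1) Q (i%:Z - m%:Z) x).
  apply/funext => m; rewrite /= (lin_sum (bounded_lin bA)) (lin_sum (bounded_lin bB)).
  by apply: eq_bigr => i _; rewrite h.
exact: bounded_lim.
Qed.

Lemma strong_sum_odec (A : int -> V -> V) x y :
  (forall j, A j x = Q j y) -> strong_sum_at A x y.
Proof.
move=> h; apply/vlimP.
have -> : (fun m => \sum_(i < m.*2.+1) A (i%:Z - m%:Z) x) =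
          (fun m => \sum_(i < m.*2.+1) Q (i%:Z - m%:Z) y).
  by apply/funext => m; apply: eq_bigr => i _; rewrite h.
exact: odec_int_sum.
Qed.

Lemma strong_sum_uniq (A : int -> V -> V) x y z :
  strong_sum_at A x y -> strong_sum_at A x z -> y = z.
Proof. by move=> /vlimP h /vlimP h'; exact: vlim_unique h h'. Qed.

Lemma strong_sum_app (A : int -> V -> V) x y :
  strong_sum_at A x y -> strong_sum A x = y.
Proof. by move=> h; apply: xget_unique => // z hz; exact: strong_sum_uniq hz h. Qed.

(** Once the window contains [j], the images of the partial sums under [Q j] are constant. *)
Lemma strong_sum_comp (A : int -> V -> V) x y : (forall j i, i != j -> Q i (A j x) = 0) ->
  strong_sum_at A x y -> forall j, Q j y = Q j (A j x).
Proof.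
move=> h /vlimP hy j; have [bQ _ _] : projection (Q j) by case: oQ.
apply: (vlim_unique (bounded_lim bQ hy)) => e e0; exists `|j|%N => m jm.
rewrite /= (lin_sum (bounded_lin bQ)) (@sum_int_single _ m j (fun i => Q j (A i x)))//.
  by rewrite subrr vnorm0.
by move=> i ij; rewrite h// eq_sym.
Qed.

End odec_int.

(** * Matrices over the Cuntz algebra *)

Section direct_sums.
Context {R : realType} {n : nat} {G : cuntz_system R n} {k : nat}.
Local Notation H := (cs_H G).
Local Notation Hk := {ffun 'I_k -> H}.
Local Notation ampl := (@ampl _ _ G k).
Implicit Types (T B : Hk -> Hk) (A : H -> H) (x y : Hk) (v : H).

Lemma dot_ffun x y : dot x y = \sum_i dot (x i) (y i).
Proof. by []. Qed.

Lemma nsq_ffun x : nsq x = \sum_i nsq (x i).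
Proof. by rewrite /nsq dot_ffun Re_sum. Qed.

Lemma vnorm_ffun_le x i : vnorm (x i) <= vnorm x.
Proof.
rewrite !vnormE ler_sqrt ?nsq_ge0// nsq_ffun (bigD1 i)//= lerDl sumr_ge0// => j _.
exact: nsq_ge0.
Qed.

Lemma vnorm_ffun x : vnorm x <= \sum_i vnorm (x i).
Proof.
have s0 : 0 <= \sum_i vnorm (x i) by apply: sumr_ge0 => i _; exact: vnorm_ge0.
rewrite -(@ler_pXn2r _ 2) ?nnegrE ?vnorm_ge0// vnorm_sqr nsq_ffun expr2 mulr_suml.
apply: ler_sum => i _; rewrite -vnorm_sqr expr2 ler_wpM2l ?vnorm_ge0//.
rewrite (bigD1 i)//= lerDl sumr_ge0// => j _; exact: vnorm_ge0.
Qed.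

Lemma subfE_ffun x y i : (x - y) i = x i - y i.
Proof. by rewrite !ffunE. Qed.

Lemma complete_ffun : complete_inner H -> complete_inner Hk.
Proof.
move=> cH x hx.
have cx i : exists l, vlim (fun p => x p i) l.
  have [|l /vlimP hl] := cH (fun p => x p i); last by exists l.
  move=> e e0; have [N hN] := hx e e0; exists N => p q Np Nq.
  apply: le_lt_trans (hN p q Np Nq).
  by have := vnorm_ffun_le (x p - x q) i; rewrite !ffunE.
pose l := [ffun i => projT1 (cid (cx i))]; exists l; apply/vlimP => e e0.
have e1 : 0 < e / k.+1%:R by rewrite divr_gt0.
have ch i : exists N, forall p, (N <= p)%N -> vnorm (x p i - l i) < e / k.+1%:R.
  have [N hN] := projT2 (cid (cx i)) _ e1; exists N => p Np.
  by rewrite ffunE; exact: hN.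
pose N i := projT1 (cid (ch i)); exists (\max_i N i) => p Np.
apply: le_lt_trans (vnorm_ffun _) _.
apply: (@le_lt_trans _ _ (\sum_(i < k) e / k.+1%:R)).
  apply: ler_sum => i _; rewrite subfE_ffun; apply/ltW.
  apply: (projT2 (cid (ch i)) p); exact: leq_trans (leq_bigmax i) Np.
rewrite sumr_const card_ord -(mulr_natr (e / _)) -mulrA gtr_pMr// mulrC ltr_pdivrMr//.
by rewrite mul1r ltr_nat.
Qed.

Definition inj_at (j : 'I_k) v : Hk := [ffun l => if l == j then v else 0].

Lemma entryE T i j v : entry T i j v = T (inj_at j v) i. Proof. by []. Qed.

Lemma ffun_sum_inj x : x = \sum_j inj_at j (x j).
Proof.
apply/ffunP => i; rewrite sum_ffunE (bigD1 i)//= ffunE eqxx big1 ?addr0// => j ji.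
by rewrite ffunE eq_sym (negPf ji).
Qed.

Lemma dot_inj_at j v x : dot (inj_at j v) x = dot v (x j).
Proof.
rewrite dot_ffun (bigD1 j)//= ffunE eqxx big1 ?addr0// => i ij.
by rewrite ffunE (negPf ij) dot0l.
Qed.

Lemma entry_sum T x i : linear T -> T x i = \sum_j entry T i j (x j).
Proof. by move=> lT; rewrite {1}(ffun_sum_inj x) (lin_sum lT) sum_ffunE. Qed.

Lemma entry_ext T B : linear T -> linear B ->
  (forall i j, entry T i j = entry B i j) -> T = B.
Proof.
move=> lT lB h; apply/funext => x; apply/ffunP => i.
by rewrite (entry_sum _ _ lT) (entry_sum _ _ lB); apply: eq_bigr => j _; rewrite h.
Qed.

Lemma entry_comp T B i j : linear T ->
  entry (T \o B) i j = \sum_l (entry T i l \o entry B l j).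
Proof. by move=> lT; apply/funext => v; rewrite sumfE entryE /= (entry_sum _ _ lT). Qed.

Lemma entry_add T B i j : entry (T + B) i j = entry T i j + entry B i j.
Proof. by apply/funext => v; rewrite addfE !entryE addfE ffunE. Qed.

Lemma entry_scale c T i j : entry (c *: T) i j = c *: entry T i j.
Proof. by apply/funext => v; rewrite scalefE !entryE scalefE ffunE. Qed.

Lemma entry_pos T i : pos_op T -> pos_op (entry T i i).
Proof. by move=> pT v; rewrite entryE -dot_inj_at. Qed.

Lemma entry_ampl A i j : linear A -> entry (ampl A) i j = if i == j then A else 0.
Proof.
move=> lA; apply/funext => v; rewrite entryE /ampl !ffunE.
by case: ifP => // _; rewrite (lin0 lA).
Qed.

Lemma ampl_bounded A : bounded_op A -> bounded_op (ampl A).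
Proof.
move=> bA; have [M M0 hM] := bounded_ge0 bA; split=> [c x y|].
  by apply/ffunP => i; rewrite !ffunE (bounded_lin bA).
exists M => x; rewrite vnorm_leM// !nsq_ffun mulr_sumr; apply: ler_sum => i _.
by rewrite ffunE -vnorm_leM.
Qed.

Lemma ampl_adj A A' : adjoint_of A A' -> adjoint_of (ampl A) (ampl A').
Proof. by move=> h x y; rewrite !dot_ffun; apply: eq_bigr => i _; rewrite !ffunE h. Qed.

Lemma ampl_comp A A' : ampl (A \o A') = ampl A \o ampl A'.
Proof. by apply/funext => x; apply/ffunP => i; rewrite !ffunE. Qed.

Lemma ampl_proj A : projection A -> projection (ampl A).
Proof.
move=> [bA iA aA]; split; [exact: ampl_bounded| |exact: ampl_adj].
by rewrite -ampl_comp iA.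
Qed.

Lemma ampl_odec (I : eqType) (Q : I -> H -> H) : odec Q -> odec (fun i => ampl (Q i)).
Proof.
move=> [pQ orQ tQ]; split=> [i|i j x ij|x h]; first exact: ampl_proj.
  by apply/ffunP => l; rewrite !ffunE orQ.
apply/ffunP => l; rewrite [RHS]ffunE; apply: tQ => i.
by have := congr1 (fun y : Hk => y l) (h i); rewrite !ffunE.
Qed.

End direct_sums.

Section esum_int.
Context {R : realType}.
Implicit Types c : int -> R.

Lemma esum_int (c : int -> \bar R) : (forall j, 0 <= c j)%E ->
  (\esum_(j in [set: int]) c j = \sum_(0 <= m <oo) (c m%:Z + c (Negz m)))%E.
Proof.
move=> c0; rewrite (esumID (range Posz))//.
have -> : [set: int] `&` range Posz = [set Posz x | x in [set: nat]] by rewrite setTI.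
have -> : [set: int] `&` ~` range Posz = [set Negz x | x in [set: nat]].
  rewrite setTI; apply/seteqP; split=> [[m|m]|_ [m _ <-]] //=.
  - by move=> h; exfalso; apply: h; exists m.
  - by move=> _; exists m.
  - by case.
rewrite !esum_image; [|by move=> x y _ _ []|by move=> x y _ _ []].
rewrite nneseriesD//; congr (_ + _)%E.
  by rewrite nneseries_esumT.
by rewrite nneseries_esumT.
Qed.

Lemma esum_intZ (r : R) (c : int -> \bar R) : (0 <= r)%R -> (forall j, 0 <= c j)%E ->
  (\esum_(j in [set: int]) (r%:E * c j) = r%:E * \esum_(j in [set: int]) c j)%E.
Proof.
move=> r0 c0; rewrite !esum_int//; last by move=> j; rewrite mule_ge0.
rewrite -nneseriesZl; last by move=> m _; rewrite adde_ge0.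
by apply: eq_eseriesr => m _; rewrite ge0_muleDr.
Qed.

(** [Negz m] is -(m+1): the first [N] pairs cover the integers from -N to N-1, and the symmetric
    window needs the extra term at N. *)
Lemma partial_sum_intE (c : int -> R) N :
  \sum_(0 <= m < N) (c m%:Z + c (Negz m)) + c N%:Z = \sum_(i < N.*2.+1) c (i%:Z - N%:Z).
Proof.
rewrite sum_int_sym big_split/= [in RHS]big_split/= addrAC addrA; congr (_ + _).
by rewrite -(big_nat_recr N 0 (fun m => c m%:Z))// big_nat_recl.
Qed.

Lemma esum_int_fin c (N : nat) : (forall j, 0 <= c j) ->
  (forall j, (N < absz j)%N -> c j = 0) ->
  (\esum_(j in [set: int]) (c j)%:E = (\sum_(i < N.*2.+1) c (i%:Z - N%:Z))%:E)%E.
Proof.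
move=> c0 cN; rewrite esum_int; last by move=> j; rewrite lee_fin.
rewrite -partial_sum_intE EFinD -sumEFin (nneseries_split 0 N.+1); last first.
  by move=> m _; rewrite -EFinD lee_fin addr_ge0.
rewrite add0n eseries0 ?adde0; last first.
  by move=> m Nm _; rewrite !cN ?adde0//; lia.
by rewrite big_nat_recr//= [in X in (_ + (_ + X))%E]cN ?adde0//; lia.
Qed.

Lemma esum_int_le c (B : R) : (forall j, 0 <= c j) ->
  (forall N, \sum_(i < N.*2.+1) c (i%:Z - N%:Z) <= B) ->
  (\esum_(j in [set: int]) (c j)%:E <= B%:E)%E.
Proof.
move=> c0 hB; rewrite esum_int; last by move=> j; rewrite lee_fin.
apply: lime_le; first by apply: is_cvg_nneseries => m _ _; rewrite -EFinD lee_fin addr_ge0.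
apply: nearW => N; rewrite sumEFin lee_fin; apply: le_trans (hB N).
by rewrite -partial_sum_intE lerDl.
Qed.

Lemma esum_int_ge c N : (forall j, 0 <= c j) ->
  ((\sum_(i < N.*2.+1) c (i%:Z - N%:Z))%:E <= \esum_(j in [set: int]) (c j)%:E)%E.
Proof.
move=> c0; rewrite esum_int; last by move=> j; rewrite lee_fin.
apply: le_trans (nneseries_lim_ge N.+1 _) => [|m _ _]; last first.
  by rewrite -EFinD lee_fin addr_ge0.
rewrite sumEFin lee_fin -partial_sum_intE big_nat_recr//= lerD2l lerDl.
exact: c0.
Qed.

End esum_int.

Section matrices.
Context {R : realType} {n : nat} {G : cuntz_system R n} {k : nat}.
Hypothesis n2 : (2 <= n)%N.
Local Notation O := (cs_O G).
Local Notation H := (cs_H G).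
Local Notation Hk := {ffun 'I_k -> H}.
Local Notation Fix := (fixed_algebra (cs_gauge G)).
Local Notation Phi := (cs_Phi G).
Local Notation w2 := (word2 (cs_S G)).
Local Notation Onc := (Onc (cs_S G)).
Local Notation io := (cs_iota G).
Local Notation rep := (cs_pi G).
Local Notation Phik := (cs_Phik G).
Local Notation ttau := (cs_ttau G).
Local Notation psi := (@psi _ _ G).
Local Notation NN := (Theta_vN (cs_S G) (cs_Phi G) (cs_iota G)).
Local Notation mD := (mD G k).
Local Notation mPhik := (@mPhik _ _ G k).
Local Notation mN := (@mN _ _ G k).
Local Notation mM := (mM G k).
Local Notation ampl := (@ampl _ _ G k).
Local Notation dmul := (@dmul _ _ G).
Implicit Types (a b f g : 'M[O]_k) (T A B : Hk -> Hk) (x y : Hk) (c d : int -> R).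

Lemma complete_Hk : complete_inner Hk.
Proof. exact/complete_ffun/complete_H. Qed.

Lemma odec_mPhik : odec mPhik.
Proof. exact/ampl_odec/odec_Phik. Qed.

Lemma mPhik_proj j : projection (mPhik j).
Proof. by case: odec_mPhik. Qed.

Lemma mPhik_lin j : linear (mPhik j). Proof. exact: proj_lin (mPhik_proj j). Qed.

Lemma mPhik_orth i j x : mPhik i (mPhik j x) = if i == j then mPhik j x else 0.
Proof.
case: eqP => [->|/eqP ij]; first exact: proj_idem (mPhik_proj j).
by case: odec_mPhik => _ ->.
Qed.

Lemma mrep_bounded a : bounded_op (mrep a).
Proof.
have bM i j : exists M : R, 0 <= M /\ forall v, vnorm (rep (a i j) v) <= M * vnorm v.
  by have [M M0 hM] := bounded_ge0 (rep_bounded (a i j)); exists M.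
pose M i j := projT1 (cid (bM i j)).
have M0 i j : 0 <= M i j by case: (projT2 (cid (bM i j))).
have hM i j v : vnorm (rep (a i j) v) <= M i j * vnorm v.
  by case: (projT2 (cid (bM i j))).
split=> [c x y|].
  apply/ffunP => i; rewrite !ffunE scaler_sumr -big_split; apply: eq_bigr => j _.
  by rewrite !ffunE (bounded_lin (rep_bounded _)).
exists (\sum_i \sum_j M i j) => x; apply: le_trans (vnorm_ffun _) _.
rewrite mulr_suml; apply: ler_sum => i _; rewrite ffunE.
apply: le_trans (vnorm_sum _ _ _) _; rewrite mulr_suml; apply: ler_sum => j _.
by apply: le_trans (hM _ _ _) _; rewrite ler_wpM2l// vnorm_ffun_le.
Qed.

Lemma mrep_lin a : linear (mrep a). Proof. exact/bounded_lin/mrep_bounded. Qed.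

Lemma entry_mrep a i j : entry (mrep a) i j = rep (a i j).
Proof.
apply/funext => v; rewrite entryE ffunE (bigD1 j)//= ffunE eqxx big1 ?addr0// => l lj.
by rewrite ffunE (negPf lj) (lin0 (bounded_lin (rep_bounded _))).
Qed.

Lemma comp_lin_op A B : linear A -> linear B -> linear (A \o B).
Proof. by move=> lA lB c x y; rewrite /= lB lA. Qed.

Lemma mrepM a b : mrep (a *m b) = mrep a \o mrep b.
Proof.
apply: entry_ext; [exact: mrep_lin|exact/comp_lin_op/mrep_lin/mrep_lin|] => i j.
rewrite entry_comp; last exact: mrep_lin.
rewrite entry_mrep mxE rep_sum; apply: eq_bigr => l _.
by rewrite !entry_mrep repM.
Qed.

Lemma add_lin_op A B : linear A -> linear B -> linear (A + B).
Proof. by move=> lA lB c x y; rewrite !addfE lB lA scalerDr addrACA. Qed.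

Lemma mrepD a b : mrep (a + b) = mrep a + mrep b.
Proof.
apply: entry_ext; [exact: mrep_lin|exact/add_lin_op/mrep_lin/mrep_lin|] => i j.
by rewrite entry_add !entry_mrep mxE repD.
Qed.

Lemma mrepZ (z : R[i]) a : mrep (z%:A *: a) = z *: mrep a.
Proof.
apply: entry_ext; [exact: mrep_lin|exact/bounded_lin/bounded_scale/mrep_bounded|] => i j.
by rewrite entry_scale !entry_mrep mxE -scalerAl mul1r repZ.
Qed.

Lemma mrep1 : @mrep _ _ G k 1%:M = id.
Proof.
apply: entry_ext => // [|i j]; first exact: mrep_lin.
rewrite entry_mrep mxE; apply/funext => v; rewrite entryE ffunE.
by case: eqP => _; rewrite ?rep1// rep0.
Qed.

Lemma mrep0 : @mrep _ _ G k 0 = 0.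
Proof.
apply: entry_ext => [||i j]; [exact: mrep_lin|exact/bounded_lin/bounded_0|].
by rewrite entry_mrep mxE rep0; apply/funext => v; rewrite entryE ffunE.
Qed.

Lemma mrep_sum (I : Type) (r : seq I) (P : pred I) (F : I -> 'M[O]_k) :
  mrep (\sum_(i <- r | P i) F i) = \sum_(i <- r | P i) mrep (F i).
Proof. by elim/big_rec2: _ => [|i x y _ <-]; rewrite ?mrepD ?mrep0. Qed.

Lemma mrep_adj a : adjoint_of (mrep a) (mrep (mstar a)).
Proof.
move=> x y; rewrite !dot_ffun; under eq_bigr do rewrite ffunE dot_suml.
rewrite exchange_big; apply: eq_bigr => j _; rewrite ffunE dot_sumr.
by apply: eq_bigr => i _; rewrite rep_adj mxE.
Qed.

Lemma mPhik_mrep_fix j f x : in_MOnc f -> in_MF f ->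
  mPhik j (mrep f x) = mrep f (mPhik j x).
Proof.
move=> Of Ff; apply/ffunP => i; rewrite !ffunE (lin_sum (Phik_lin j)).
by apply: eq_bigr => l _; rewrite !ffunE Phik_rep_fix.
Qed.

Definition MF f : Prop := in_MOnc f /\ in_MF f.

Lemma MF_mul f g : MF f -> MF g -> MF (f *m g).
Proof.
move=> [Of Ff] [Og Fg]; split=> i j; rewrite mxE.
  by apply: Onc_sum => l _; exact: OncM.
by apply: Fix_sum => l _; exact: FixM.
Qed.

Lemma MF_add f g : MF f -> MF g -> MF (f + g).
Proof.
by move=> [Of Ff] [Og Fg]; split=> i j; rewrite mxE; [exact: OncD|exact: FixD].
Qed.

Lemma MF_scale (z : R[i]) f : MF f -> MF (z%:A *: f).
Proof.
move=> [Of Ff]; split=> i j; rewrite mxE -scalerAl mul1r; [exact: OncZ|exact: FixZ].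
Qed.

Lemma MF_star f : MF f -> MF (mstar f).
Proof.
by move=> [Of Ff]; split=> i j; rewrite mxE; [exact: Onc_star|exact: Fix_star].
Qed.

Lemma MF1 : MF 1%:M.
Proof.
split=> i j; rewrite mxE; case: eqP => _.
- exact: Onc1.
- exact: Onc0.
- exact: Fix1.
- exact: Fix0.
Qed.

Lemma MF0 : MF 0.
Proof. by split=> i j; rewrite mxE; [exact: Onc0|exact: Fix0]. Qed.

Lemma MF_sum (I : Type) (r : seq I) (P : pred I) (F : I -> 'M[O]_k) :
  (forall i, P i -> MF (F i)) -> MF (\sum_(i <- r | P i) F i).
Proof. by move=> h; apply: big_ind => //; [exact: MF0|exact: MF_add]. Qed.

(** ** The operator D and commutators with it *)

Lemma mD_domP x : dom mD x <-> exists y, forall j, mPhik j y = (j%:~R : R[i]) *: mPhik j x.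
Proof.
split=> [[y hy]|[y hy]].
- exists y => j; rewrite (strong_sum_comp odec_mPhik _ hy)//.
    by rewrite /= scalefE (linZ (mPhik_lin j)) mPhik_orth eqxx.
  move=> i l li; rewrite /= scalefE (linZ (mPhik_lin l)) mPhik_orth (negPf li).
  by rewrite scaler0.
- exists y; apply: (strong_sum_odec complete_Hk odec_mPhik) => j.
  by rewrite scalefE hy.
Qed.

Lemma mD_app x y : (forall j, mPhik j y = (j%:~R : R[i]) *: mPhik j x) -> mD x = y.
Proof.
move=> hy; apply/strong_sum_app/(strong_sum_odec complete_Hk odec_mPhik) => j.
by rewrite scalefE hy.
Qed.

Lemma mD_comp x j : dom mD x -> mPhik j (mD x) = (j%:~R : R[i]) *: mPhik j x.
Proof. by move=> /mD_domP[y hy]; rewrite (mD_app hy). Qed.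

Lemma mD_fcalc (h : R -> R) A : measurable_fun setT h -> bounded_op A ->
  (forall j x, mPhik j (A x) = (h j%:~R)%:C *: mPhik j x) -> fcalc mD h = A.
Proof.
move=> mh bA hA.
have rc j : (j%:~R : R[i]) = (j%:~R : R)%:C by rewrite rmorph_int.
apply: (odec_fcalc complete_Hk odec_mPhik (lam := fun j : int => j%:~R)) => //.
- move=> x; rewrite mD_domP; split=> -[y hy]; exists y => j; rewrite hy rc//.
- by move=> x dx j; rewrite mD_comp// rc.
Qed.

Definition mdg c : Hk -> Hk := ampl (odiag Phik c).

Definition bounded_seq c : Prop := exists C : R, forall j, `|c j| <= C.

Lemma mdg_bounded c : bounded_seq c -> bounded_op (mdg c).
Proof.
move=> [C hC]; apply: ampl_bounded.
by have [] := odiagP (@complete_H _ _ G) (odec_Phik G) hC.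
Qed.

Lemma mPhik_mdg c j x : bounded_seq c -> mPhik j (mdg c x) = (c j)%:C *: mPhik j x.
Proof.
move=> [C hC]; apply/ffunP => i; rewrite !ffunE.
by have [_ ->] := odiagP (@complete_H _ _ G) (odec_Phik G) hC.
Qed.

Lemma mdg_mPhik c j x : bounded_seq c -> mdg c (mPhik j x) = (c j)%:C *: mPhik j x.
Proof.
move=> bc; apply: (odec_eq odec_mPhik) => i.
rewrite mPhik_mdg// (linZ (mPhik_lin i)) mPhik_orth.
by case: eqP => [->//|_]; rewrite !scaler0.
Qed.

Lemma mdg_mrep c f x : bounded_seq c -> MF f -> mdg c (mrep f x) = mrep f (mdg c x).
Proof.
move=> bc [Of Ff]; apply: (odec_eq odec_mPhik) => j.
by rewrite mPhik_mdg// !mPhik_mrep_fix// mPhik_mdg// (linZ (mrep_lin f)).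
Qed.

Lemma mdg_adj c : bounded_seq c -> adjoint_of (mdg c) (mdg c).
Proof.
move=> bc x y; apply: (odec_adj complete_Hk odec_mPhik) => j.
by rewrite !mPhik_mdg// dotZl dotZr conjC_real.
Qed.

Lemma fcalc_mdg (h : R -> R) : measurable_fun setT h ->
  bounded_seq (fun j : int => h j%:~R) -> fcalc mD h = mdg (fun j : int => h j%:~R).
Proof.
move=> mh bh; apply: mD_fcalc => // [|j x]; first exact: mdg_bounded.
by rewrite mPhik_mdg.
Qed.

Definition mdmul (c : int -> R[i]) a : 'M[O]_k := map_mx (dmul c) a.

Lemma mdmul_Onc (c : int -> R[i]) a : in_MOnc a -> in_MOnc (mdmul c a).
Proof. by move=> Oa i j; rewrite mxE; exact: Onc_dmul. Qed.

Local Notation der := (mdmul (fun j => j%:~R)).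

(** Here [y] plays the part of D x. On a word of degree d the eigenvalue splits as j = d + (j - d),
    where j - d is the degree of the component of [x] on which the word acts. *)
Let Phik_der (a : O) (x y : H) : Onc a ->
  (forall j, Phik j y = (j%:~R : R[i]) *: Phik j x) -> forall j,
  Phik j (rep (dmul (fun j => j%:~R) a) x + rep a y) = (j%:~R : R[i]) *: Phik j (rep a x).
Proof.
move=> Oa h j; suff [] : Onc a /\ Phik j (rep (dmul (fun j => j%:~R) a) x + rep a y) =
  (j%:~R : R[i]) *: Phik j (rep a x) by [].
move: a Oa; apply: Onc_ind => [|c mu nu b [Ob e]].
  split; first exact: Onc0.
  by rewrite dmul0// rep0 addr0 (lin0 (Phik_lin j)) scaler0.
split; first by apply: OncD => //; exact/OncZ/Onc_w2.
rewrite dmul_lin//; last exact: Onc_w2.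
set dw := dmul _ (w2 mu nu); set db := dmul _ b in e *.
have -> : rep (c *: dw + db) x + rep (c *: w2 mu nu + b) y =
    (c *: rep dw x + c *: rep (w2 mu nu) y) + (rep db x + rep b y).
  by rewrite !repD !repZ !addfE !scalefE addrACA.
rewrite (linD (Phik_lin j)) e repD repZ addfE scalefE {}/dw.
rewrite [in RHS](linD (Phik_lin j)) [in RHS]scalerDr; congr (_ + _).
rewrite -scalerDr !(linZ (Phik_lin j)) (linD (Phik_lin j)) dmul_w2// repZ scalefE.
rewrite (linZ (Phik_lin j)) !Phik_rep_w2 h (linZ (bounded_lin (rep_bounded _))).
by rewrite -scalerDl -intrD addrC subrK !scalerA mulrC.
Qed.

Lemma mD_mrep a x : in_MOnc a -> dom mD x -> dom mD (mrep a x) /\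
  mD (mrep a x) = mrep (der a) x + mrep a (mD x).
Proof.
move=> Oa dx; suff h j : mPhik j (mrep (der a) x + mrep a (mD x)) =
    (j%:~R : R[i]) *: mPhik j (mrep a x).
  split; last exact: mD_app.
  by apply/mD_domP; exists (mrep (der a) x + mrep a (mD x)).
apply/ffunP => i; rewrite !ffunE -big_split (lin_sum (Phik_lin j)).
rewrite (lin_sum (Phik_lin j)) scaler_sumr; apply: eq_bigr => l _ /=.
rewrite mxE Phik_der// => m.
by have := congr1 (fun v : Hk => v l) (mD_comp m dx); rewrite !ffunE.
Qed.

Lemma mPhik_dom j x : dom mD (mPhik j x).
Proof.
apply/mD_domP; exists ((j%:~R : R[i]) *: mPhik j x) => i.
by rewrite (linZ (mPhik_lin i)) mPhik_orth; case: eqP => [->//|_]; rewrite !scaler0.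
Qed.

(** The choice is unique because the ranges of the [mPhik j] lie in the domain, and bounded
    operators that agree on them are equal. *)
Lemma commutator_mrep a : in_MOnc a -> commutator mD (mrep a) = mrep (der a).
Proof.
move=> Oa; apply: xget_unique.
  split=> [|x dx]; first exact: mrep_bounded.
  by have [d e] := mD_mrep Oa dx; split=> //; rewrite e addrK.
move=> C [bC hC]; apply: (odec_op_ext complete_Hk odec_mPhik) => // [|j x].
  exact: mrep_bounded.
have [_ ->] := hC _ (mPhik_dom j x).
by have [_ ->] := mD_mrep Oa (mPhik_dom j x); rewrite addrK.
Qed.

Lemma Phik_rep_Phik j (a : O) (x : H) : Onc a ->
  Phik j (rep a (Phik j x)) = rep (Phi a) (Phik j x).
Proof.
move: a; apply: Onc_ind => [|c mu nu b e].
  by rewrite (lin0 (@Phi_lin _ _ G)) rep0 (lin0 (Phik_lin j)).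
rewrite Phi_lin !repD !repZ !addfE !scalefE (Phik_lin j) e Phi_w2; congr (_ *: _ + _).
rewrite Phik_rep_w2; case: eqP => [->|/eqP d0].
  by rewrite subr0 (proj_idem _ (Phik_proj G j)).
rewrite Phik_orth ?rep0; last by move: d0; rewrite /degree; lia.
by rewrite (lin0 (bounded_lin (rep_bounded _))).
Qed.

Lemma mPsi_mrep a : in_MOnc a -> mPsi (mrep a) = mrep (map_mx Phi a).
Proof.
move=> Oa; apply/funext => x; apply: strong_sum_app.
apply: (strong_sum_odec complete_Hk odec_mPhik) => j; apply/ffunP => i.
rewrite !ffunE !(lin_sum (Phik_lin j)); apply: eq_bigr => l _.
by rewrite mxE !ffunE Phik_rep_Phik// Phik_rep_fix//; have [] := Phi_Onc (Oa i l).
Qed.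

Lemma MF_Phi a : in_MOnc a -> MF (map_mx Phi a).
Proof. by move=> Oa; split=> i j; rewrite mxE; have [] := Phi_Onc (Oa i j). Qed.

End matrices.

(** * The semifinite trace on the fixed point algebra *)

Section fixed_point_trace.
Context {R : realType} {n : nat} {G : cuntz_system R n} {k : nat}.
Hypothesis n2 : (2 <= n)%N.
Local Notation O := (cs_O G).
Local Notation H := (cs_H G).
Local Notation Hk := {ffun 'I_k -> H}.
Local Notation rep := (cs_pi G).
Local Notation Phik := (cs_Phik G).
Local Notation ttau := (cs_ttau G).
Local Notation psi := (@psi _ _ G).
Local Notation NN := (Theta_vN (cs_S G) (cs_Phi G) (cs_iota G)).
Local Notation mPhik := (@mPhik _ _ G k).
Local Notation mN := (@mN _ _ G k).
Local Notation mM := (mM G k).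
Local Notation ampl := (@ampl _ _ G k).
Local Notation mdg := (@mdg _ _ G k).
Local Notation mttau := (@mttau _ _ G k).
Local Notation hattau := (@hattau _ _ G k).
Implicit Types (a b f g : 'M[O]_k) (T A B : Hk -> Hk) (x y : Hk) (c d : int -> R).

Let mdg_bounded := @mdg_bounded R n G k.
Let mPhik_mdg := @mPhik_mdg R n G k.

Lemma mN_bounded T : mN T -> bounded_op T. Proof. by case. Qed.

Lemma mN_add A B : mN A -> mN B -> mN (A + B).
Proof.
move=> [bA hA] [bB hB]; split; first exact: bounded_add.
by move=> i j; rewrite entry_add; exact: NN_add.
Qed.

Lemma mN_scale z A : mN A -> mN (z *: A).
Proof.
move=> [bA hA]; split; first exact: bounded_scale.
by move=> i j; rewrite entry_scale; exact: NN_scale.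
Qed.

Lemma mN_comp A B : mN A -> mN B -> mN (A \o B).
Proof.
move=> [bA hA] [bB hB]; split; first exact: bounded_comp.
move=> i j; rewrite entry_comp; last exact: bounded_lin.
by apply: NN_sum => l _; exact: NN_comp.
Qed.

Lemma mN_ampl (A : H -> H) : NN A -> mN (ampl A).
Proof.
move=> NA; have bA := NN_bounded NA; split; first exact: ampl_bounded.
move=> i j; rewrite entry_ampl; last exact: bounded_lin.
by case: ifP => _ //; exact: NN_0.
Qed.

Lemma mN_mrep f : MF f -> mN (mrep f).
Proof.
move=> [Of Ff]; split; first exact: mrep_bounded.
by move=> i j; rewrite entry_mrep; exact: NN_rep.
Qed.

Lemma mM_mN T : mM T -> mN T. Proof. by case. Qed.

Lemma mM_bounded T : mM T -> bounded_op T. Proof. by move=> /mM_mN/mN_bounded. Qed.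

Lemma mM_lin T : mM T -> linear T. Proof. by move=> /mM_bounded/bounded_lin. Qed.

Lemma mM_comm T j x : mM T -> T (mPhik j x) = mPhik j (T x).
Proof. by move=> [_ h]; exact: (congr1 (@^~ x) (h j)). Qed.

Lemma mM_add A B : mM A -> mM B -> mM (A + B).
Proof.
move=> [NA hA] [NB hB]; split=> [|j]; first exact: mN_add.
apply/funext => x /=; rewrite !addfE (linD (@mPhik_lin _ _ G k j)).
have eA := congr1 (@^~ x) (hA j); have eB := congr1 (@^~ x) (hB j).
by rewrite /= in eA eB; rewrite eA eB.
Qed.

Lemma mM_scale z A : mM A -> mM (z *: A).
Proof.
move=> [NA hA]; split=> [|j]; first exact: mN_scale.
apply/funext => x /=; rewrite !scalefE (linZ (@mPhik_lin _ _ G k j)).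
by have eA := congr1 (@^~ x) (hA j); rewrite /= in eA; rewrite eA.
Qed.

Lemma mM_comp A B : mM A -> mM B -> mM (A \o B).
Proof.
move=> MA MB; split=> [|j]; first by apply: mN_comp; exact: mM_mN.
by apply/funext => x /=; rewrite !mM_comm.
Qed.

Lemma mM_id : mM id.
Proof. by split=> //; rewrite -mrep1; apply: mN_mrep; exact: MF1. Qed.

Lemma mM_0 : mM 0.
Proof. by rewrite -(scale0r id); exact/mM_scale/mM_id. Qed.

Lemma mM_sub A B : mM A -> mM B -> mM (A - B).
Proof. by move=> MA MB; rewrite -scaleN1r; apply: mM_add => //; exact: mM_scale. Qed.

Lemma mM_sum (I : Type) (r : seq I) (P : pred I) (F : I -> Hk -> Hk) :
  (forall i, P i -> mM (F i)) -> mM (\sum_(i <- r | P i) F i).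
Proof. by move=> h; apply: big_ind => //; [exact: mM_0|exact: mM_add]. Qed.

Lemma mM_mrep f : MF f -> mM (mrep f).
Proof.
move=> Mf; split=> [|j]; first exact: mN_mrep.
by case: Mf => Of Ff; apply/funext => x /=; rewrite mPhik_mrep_fix.
Qed.

Lemma mM_mdg c : bounded_seq c -> mM (mdg c).
Proof.
move=> bc; split=> [|j].
  by case: (bc) => C hC; exact: (mN_ampl (NN_odiag G n2 hC)).
by apply/funext => x /=; rewrite mPhik_mdg// mdg_mPhik.
Qed.

Lemma mM_Phik j : mM (mPhik j).
Proof.
split=> [|i]; first exact/mN_ampl/NN_Phik.
by apply/funext => x /=; rewrite !mPhik_orth eq_sym; case: eqP => // ->.
Qed.

Lemma mM_pos_add A B : pos_part mM A -> pos_part mM B -> pos_part mM (A + B).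
Proof. by move=> [? ?] [? ?]; split; [exact: mM_add|exact: pos_add]. Qed.

Lemma mM_pos_0 : pos_part mM 0.
Proof. by split; [exact: mM_0|exact: pos_0]. Qed.

Lemma mM_pos_sum (I : Type) (r : seq I) (P : pred I) (F : I -> Hk -> Hk) :
  (forall i, P i -> pos_part mM (F i)) -> pos_part mM (\sum_(i <- r | P i) F i).
Proof. by move=> h; apply: big_ind => //; [exact: mM_pos_0|exact: mM_pos_add]. Qed.

Let cut j T := mPhik j \o T \o mPhik j.

Let cut_pos j T i : pos_part mM T -> pos_part NN (entry (cut j T) i i).
Proof.
move=> [MT pT]; split.
  by apply: (mM_mN _).2; do !apply: mM_comp => //; exact: mM_Phik.
apply: entry_pos => x; rewrite /cut /=.
by have [_ _ <-] := @mPhik_proj _ _ G k j.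
Qed.

Let cut_add j A B : cut j (A + B) = cut j A + cut j B.
Proof. by apply/funext => x; rewrite /cut addfE /= addfE (linD (@mPhik_lin _ _ G k j)). Qed.

Let nz (j : int) : (0 <= n%:R ^ (- j) :> R)%R.
Proof. by apply: exprz_ge0. Qed.

Let cut_ge0 j T : pos_part mM T -> (0 <= mttau (cut j T))%E.
Proof. by move=> pT; apply: sume_ge0 => i _; apply: ttau_ge0; exact: cut_pos. Qed.

Lemma hattau_ge0 T : pos_part mM T -> (0 <= hattau T)%E.
Proof.
by move=> pT; apply: esum_ge0 => j _; rewrite mule_ge0 ?lee_fin//; exact: cut_ge0.
Qed.

Lemma hattau_add A B : pos_part mM A -> pos_part mM B ->
  hattau (A + B) = (hattau A + hattau B)%E.
Proof.
move=> pA pB; rewrite /hattau -esumD; last 2 first.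
- by move=> j _; rewrite mule_ge0 ?lee_fin//; exact: cut_ge0.
- by move=> j _; rewrite mule_ge0 ?lee_fin//; exact: cut_ge0.
apply: eq_esum => j _; rewrite -ge0_muleDr; [|exact: cut_ge0|exact: cut_ge0].
congr (_ * _)%E; rewrite -!/(cut _ _) cut_add /mttau -big_split; apply: eq_bigr => i _.
by rewrite entry_add ttau_add//; exact: cut_pos.
Qed.

Lemma hattau_0 : hattau 0 = 0%E.
Proof.
apply: esum1 => j _; rewrite -!/(cut _ _) /mttau big1 ?mule0// => i _.
rewrite (_ : entry _ i i = 0) ?ttau_0//; apply/funext => v; rewrite entryE /cut /=.
by rewrite (lin0 (@mPhik_lin _ _ G k j)) ffunE.
Qed.

Lemma hattau_sum (I : Type) (r : seq I) (P : pred I) (F : I -> Hk -> Hk) :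
  (forall i, P i -> pos_part mM (F i)) ->
  (hattau (\sum_(i <- r | P i) F i)%R = \sum_(i <- r | P i) hattau (F i))%E.
Proof.
move=> h; elim: r => [|i r IH]; first by rewrite !big_nil hattau_0.
rewrite !big_cons; case: ifP => // Pi; rewrite hattau_add ?IH//; first exact: h.
exact: mM_pos_sum.
Qed.

Lemma hattau_le A B : pos_part mM A -> mM B -> pos_op (B - A) ->
  (hattau A <= hattau B)%E.
Proof.
move=> pA MB pBA; rewrite -(subrK A B) addrC.
have pC : pos_part mM (B - A) by split=> //; case: pA => MA _; exact: mM_sub.
by rewrite hattau_add// leeDl// hattau_ge0.
Qed.

(* The operator f c(D). *)
Definition fdg f c : Hk -> Hk := mrep f \o mdg c.

Lemma mM_fdg f c : MF f -> bounded_seq c -> mM (fdg f c).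
Proof. by move=> Mf bc; apply: mM_comp; [exact: mM_mrep|exact: mM_mdg]. Qed.

Lemma mPhik_fdg f c j x : MF f -> bounded_seq c ->
  mPhik j (fdg f c x) = (c j)%:C *: mrep f (mPhik j x).
Proof.
move=> [Of Ff] bc; rewrite /fdg /= mPhik_mrep_fix// mPhik_mdg//.
by rewrite (linZ (mrep_lin f)).
Qed.

Lemma fdg_eq f c A : MF f -> bounded_seq c ->
  (forall j x, mPhik j (A x) = (c j)%:C *: mrep f (mPhik j x)) -> A = fdg f c.
Proof.
move=> Mf bc h; apply/funext => x; apply: (odec_eq (@odec_mPhik _ _ G k)) => j.
by rewrite h mPhik_fdg.
Qed.

Lemma fdg_comp f g c d : MF f -> MF g -> bounded_seq c -> bounded_seq d ->
  fdg f c \o fdg g d = fdg (f *m g) (fun j => c j * d j).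
Proof.
move=> Mf Mg bc bd; apply: fdg_eq; first exact: MF_mul.
  case: bc bd => C hC [E hE]; exists (`|C| * `|E|) => j; rewrite normrM ler_pM//.
    exact: le_trans (hC j) (ler_norm _).
  exact: le_trans (hE j) (ler_norm _).
move=> j x; rewrite [LHS]mPhik_fdg// -/(fdg g d x) mPhik_fdg// (linZ (mrep_lin f)).
by rewrite scalerA -rmorphM mrepM.
Qed.

Lemma fdg_adj f c : MF f -> bounded_seq c -> adjoint_of (fdg f c) (fdg (mstar f) c).
Proof.
move=> Mf bc; have Ms := MF_star Mf.
have := adjoint_comp (mrep_adj f) (mdg_adj bc); rewrite -/(fdg f c).
suff -> : mdg c \o mrep (mstar f) = fdg (mstar f) c by [].
by apply/funext => x; rewrite /= mdg_mrep.
Qed.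

Lemma fdg_addl f g c : fdg (f + g) c = fdg f c + fdg g c.
Proof. by apply/funext => x; rewrite /fdg /= mrepD. Qed.

Lemma fdg_scalel (z : R[i]) f c : fdg (z%:A *: f) c = z *: fdg f c.
Proof. by apply/funext => x; rewrite /fdg /= mrepZ. Qed.

Lemma fdg0 c : fdg 0 c = 0.
Proof. by apply/funext => x; rewrite /fdg /= mrep0. Qed.

Lemma fdg_suml (I : Type) (r : seq I) (P : pred I) (F : I -> 'M[O]_k) c :
  fdg (\sum_(i <- r | P i) F i) c = \sum_(i <- r | P i) fdg (F i) c.
Proof.
elim: r => [|i r IH]; first by rewrite !big_nil fdg0.
by rewrite !big_cons; case: ifP => // _; rewrite fdg_addl IH.
Qed.

Lemma mstar_mul a b : mstar (a *m b) = mstar b *m mstar a.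
Proof.
apply/matrixP => i j; rewrite !mxE star_sum; apply: eq_bigr => l _.
by rewrite !mxE starM.
Qed.

Lemma mstarK a : mstar (mstar a) = a.
Proof. by apply/matrixP => i j; rewrite !mxE starK. Qed.

Lemma mstarD a b : mstar (a + b) = mstar a + mstar b.
Proof. by apply/matrixP => i j; rewrite !mxE starD. Qed.

Lemma mstarZ (z : R[i]) a : mstar (z%:A *: a) = (z^*)%:A *: mstar a.
Proof. by apply/matrixP => i j; rewrite !mxE -!scalerAl !mul1r starZ. Qed.

Lemma mstar1 : mstar 1%:M = 1%:M :> 'M[O]_k.
Proof. by apply/matrixP => i j; rewrite !mxE eq_sym; case: eqP; rewrite ?star1 ?star0. Qed.

Lemma mpsiD a b : mpsi (a + b) = mpsi a + mpsi b.
Proof. by rewrite /mpsi -big_split; apply: eq_bigr => i _; rewrite mxE; exact: psiD. Qed.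

Lemma mpsiZ (z : R[i]) a : mpsi (z%:A *: a) = z * mpsi a.
Proof.
rewrite /mpsi mulr_sumr; apply: eq_bigr => i _; rewrite mxE -scalerAl mul1r.
exact: psiZ.
Qed.

Lemma mpsi0 : mpsi (0 : 'M[O]_k) = 0.
Proof. by rewrite /mpsi big1// => i _; rewrite mxE; exact: psi0. Qed.

Lemma mpsi_sum (I : Type) (r : seq I) (P : pred I) (F : I -> 'M[O]_k) :
  mpsi (\sum_(i <- r | P i) F i) = \sum_(i <- r | P i) mpsi (F i).
Proof.
elim: r => [|i r IH]; first by rewrite !big_nil mpsi0.
by rewrite !big_cons; case: ifP => // _; rewrite mpsiD IH.
Qed.

Lemma mpsi_bb_ge0 b : MF b -> 0 <= mpsi (b *m mstar b).
Proof.
move=> [Ob Fb]; apply: sumr_ge0 => i _; rewrite mxE.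
rewrite -/(psi _) psi_sum; apply: sumr_ge0 => l _; rewrite mxE.
rewrite psi_fix; last exact/FixM/Fix_star.
by rewrite -{1}(starK (b i l)); apply: tau_pos; exact: Fix_star.
Qed.

Lemma bounded_seq_sqrt c : (forall j, 0 <= c j) -> bounded_seq c ->
  bounded_seq (fun j => Num.sqrt (c j)).
Proof.
move=> c0 [C hC]; exists (1 + `|C|) => j; rewrite ger0_norm ?sqrtr_ge0//.
have h := le_trans (hC j) (ler_norm _); rewrite ger0_norm// in h.
rewrite -(@ler_pXn2r _ 2) ?nnegrE ?sqrtr_ge0 ?addr_ge0// sqr_sqrtr//.
by have := normr_ge0 C; nra.
Qed.

(** With [s] the square root of [c], the operator is [fdg b s] composed with its adjoint, since
    matrices over the fixed point algebra commute with functions of D. *)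
Lemma fdg_pos b c : MF b -> (forall j, 0 <= c j) -> bounded_seq c ->
  pos_part mM (fdg (b *m mstar b) c).
Proof.
move=> Mb c0 bc; have Ms := MF_star Mb; have Mbb := MF_mul Mb Ms.
split; first exact: mM_fdg.
have bs := bounded_seq_sqrt c0 bc; set s := fun j => _ in bs.
have -> : fdg (b *m mstar b) c = fdg b s \o fdg (mstar b) s.
  rewrite fdg_comp//; apply: fdg_eq => // [|j x].
    by have := bc; congr bounded_seq; apply/funext => j; rewrite -expr2 sqr_sqrtr.
  by rewrite mPhik_fdg// -expr2 sqr_sqrtr.
by apply: pos_adj; apply: adjoint_sym; exact: fdg_adj.
Qed.

(** In degree [j] the weight n^(-j) of [hattau] cancels the factor n^j of [ttau_rep_Phik]. The form
    [b *m mstar b] makes the diagonal entries sums of positive operators, on which the trace is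
    additive. *)
Lemma hattau_fdg b c : MF b -> (forall j, 0 <= c j) -> bounded_seq c ->
  hattau (fdg (b *m mstar b) c) =
  ((complex.Re (mpsi (b *m mstar b)))%:E * \esum_(j in [set: int]) (c j)%:E)%E.
Proof.
move=> Mb c0 bc; have Ms := MF_star Mb; have Mbb := MF_mul Mb Ms.
have [Ob Fb] := Mb; set r := complex.Re _.
have r0 : 0 <= r by exact/ge0_Re_ge0/mpsi_bb_ge0.
rewrite -esum_intZ//.
rewrite /hattau; apply: eq_esum => j _.
have cutE : mPhik j \o fdg (b *m mstar b) c \o mPhik j =
    (c j)%:C *: (mrep (b *m mstar b) \o mPhik j).
  apply/funext => x; rewrite scalefE /= -/(fdg _ _ _) mPhik_fdg//.
  by rewrite (proj_idem _ (mPhik_proj j)).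
have ent i : entry ((c j)%:C *: (mrep (b *m mstar b) \o mPhik j)) i i =
    (c j)%:C *: \sum_l (rep (b i l * star (b i l)) \o Phik j).
  rewrite entry_scale entry_comp; last exact: mrep_lin.
  rewrite (bigD1 i)//= entry_ampl; last exact: Phik_lin.
  rewrite eqxx big1 ?addr0 => [|l li]; last first.
    rewrite entry_ampl; last exact: Phik_lin.
    rewrite (negPf li); apply/funext => v /=; rewrite entry_mrep.
    exact/lin0/bounded_lin/rep_bounded.
  congr (_ *: _); rewrite entry_mrep mxE rep_sum; apply/funext => v.
  by rewrite sumfE /= sumfE; apply: eq_bigr => l _; rewrite mxE.
have pp i l : pos_part NN (rep (b i l * star (b i l)) \o Phik j).
  exact: NN_rep_Phik_pos.
have val i : ttau (entry ((c j)%:C *: (mrep (b *m mstar b) \o mPhik j)) i i) =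
    (c j * (n%:R ^ j * complex.Re (psi ((b *m mstar b) i i))))%:E.
  rewrite ent ttau_scale//; last exact: NN_pos_sum.
  rewrite ttau_sum// EFinM; congr (_ * _)%E.
  rewrite (eq_bigr (fun l => (n%:R ^ j * complex.Re (psi (b i l * star (b i l))))%:E)).
    rewrite sumEFin -mulr_sumr -Re_sum -psi_sum; congr (_ * complex.Re (psi _))%:E.
    by rewrite mxE; apply: eq_bigr => l _; rewrite mxE.
  by move=> l _; rewrite ttau_rep_Phik.
rewrite cutE /mttau (eq_bigr _ (fun i _ => val i)) sumEFin -EFinM.
rewrite -mulr_sumr -mulr_sumr -Re_sum -/(mpsi _) -/r -EFinM; congr _%:E.
have nR : n%:R != 0 :> R by rewrite pnatr_eq0; lia.
by rewrite mulrCA (mulrA (_ ^ _)) -expfzDr// addNr expr0z mul1r mulrC.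
Qed.

End fixed_point_trace.

(** * Complex values of the trace by polarization *)

Section trace_values.
Context {R : realType} {n : nat} {G : cuntz_system R n} {k : nat}.
Hypothesis n2 : (2 <= n)%N.
Local Notation O := (cs_O G).
Local Notation H := (cs_H G).
Local Notation Hk := {ffun 'I_k -> H}.
Local Notation mM := (mM G k).
Local Notation hattau := (@hattau _ _ G k).
Local Notation fdg := (@fdg _ _ G k).
Implicit Types (a b f g : 'M[O]_k) (T A B : Hk -> Hk) (x y : Hk) (c d : int -> R) (z : R[i]).

Lemma mulmx_scaler z a b : a *m (z%:A *: b) = z%:A *: (a *m b).
Proof.
apply/matrixP => i j; rewrite !mxE mulr_sumr; apply: eq_bigr => l _.
by rewrite mxE -!scalerAl !mul1r -scalerAr.
Qed.

Lemma scalermxA z w a : z%:A *: (w%:A *: a) = (z * w)%:A *: a.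
Proof. by rewrite scalerA -scalerAl mul1r scalerA. Qed.

(** For z = 1, -1, i, -i, the elements [half f z *m mstar (half f z)] are positive, and their sum
    with coefficients z is [f]: the polarization identity for [f] and 1. It extends [hattau_fdg]
    from positive elements to all of [MF]. *)
Let half f z : 'M[O]_k := (2^-1)%:A *: (f + z%:A *: 1%:M).

Let half_sq f z : z * z^* = 1 -> half f z *m mstar (half f z) =
  (4^-1)%:A *: (f *m mstar f + (z^*)%:A *: f + z%:A *: mstar f + 1%:M).
Proof.
move=> zz; rewrite /half mstarZ mstarD mstarZ mstar1.
have -> : (2^-1 : R[i])^* = 2^-1 by rewrite fmorphV /= conjC_nat.
rewrite -scalemxAl mulmx_scaler scalermxA.
have -> : 2^-1 * 2^-1 = 4^-1 :> R[i] by rewrite -invfM -natrM.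
congr (_ *: _); rewrite mulmxDl !mulmxDr !mulmx_scaler -!scalemxAl !mul1mx mulmx1.
by rewrite scalermxA mulrC zz scale1r scale1r !addrA.
Qed.

Let four (i p q r s : R[i]) : i * i = -1 ->
  4^-1 * (p + 1 * q + 1 * r + s) - 4^-1 * (p + -1 * q + -1 * r + s) +
  i * (4^-1 * (p + - i * q + i * r + s) - 4^-1 * (p + i * q + - i * r + s)) = q.
Proof.
move=> ii.
transitivity ((q + r) / 2 - (i * i) * ((q - r) / 2)); first by field.
by rewrite ii; field.
Qed.

Let ii : 'i * 'i = -1 :> R[i].
Proof. by apply/eqP; rewrite eq_complex/=; apply/andP; split; apply/eqP; ring. Qed.

Let ci : ('i : R[i])^* = - 'i.
Proof. by apply/eqP; rewrite eq_complex /= oppr0 !eqxx. Qed.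

Let combine (h1 h2 h3 h4 p1 p2 p3 p4 Z : R) :
  h1 = p1 * Z -> h2 = p2 * Z -> h3 = p3 * Z -> h4 = p4 * Z ->
  (p1%:C - p2%:C + 'i * (p3%:C - p4%:C)) * Z%:C = (h1 - h2) +i* (h3 - h4).
Proof.
move=> -> -> -> ->.
by apply/eqP; rewrite eq_complex/=; apply/andP; split; apply/eqP; ring.
Qed.

Let fdg_half f z c x : z * z^* = 1 -> fdg (half f z *m mstar (half f z)) c x =
  4^-1 *: (fdg (f *m mstar f) c x + z^* *: fdg f c x + z *: fdg (mstar f) c x +
           fdg 1%:M c x).
Proof. by move=> zz; rewrite half_sq// fdg_scalel !fdg_addl !fdg_scalel. Qed.

Let mpsi_half f z : z * z^* = 1 -> mpsi (half f z *m mstar (half f z)) =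
  4^-1 * (mpsi (f *m mstar f) + z^* * mpsi f + z * mpsi (mstar f) + mpsi (1%:M : 'M[O]_k)).
Proof. by move=> zz; rewrite half_sq// mpsiZ !mpsiD !mpsiZ. Qed.

Lemma hattau_cone_additive A B : trace_cone mM hattau A -> trace_cone mM hattau B ->
  (fine \o hattau) (A + B) = (fine \o hattau) A + (fine \o hattau) B.
Proof.
move=> [pA fA] [pB fB] /=; rewrite hattau_add// fineD//.
  by rewrite ge0_fin_numE//; exact: hattau_ge0.
by rewrite ge0_fin_numE//; exact: hattau_ge0.
Qed.

Lemma hattau_ext_fdg f c (Z : R) : MF f -> (forall j, 0 <= c j) -> bounded_seq c ->
  (\esum_(j in [set: int]) (c j)%:E = Z%:E)%E ->
  hattau_ext (fdg f c) = mpsi f * Z%:C.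
Proof.
move=> Mf c0 bc hZ; have Mh z : MF (half f z).
  exact/MF_scale/MF_add/MF_scale/MF1.
pose T z := fdg (half f z *m mstar (half f z)) c.
have KT z : trace_cone mM hattau (T z).
  split; first exact: fdg_pos.
  by rewrite /T hattau_fdg// hZ -EFinM ltry.
have vT z : fine (hattau (T z)) = complex.Re (mpsi (half f z *m mstar (half f z))) * Z.
  by rewrite /T hattau_fdg// hZ -EFinM.
have [u1 um1] : (1 : R[i]) * 1^* = 1 /\ (-1 : R[i]) * (-1)^* = 1.
  by rewrite conjCN conjC1 mulrNN !mulr1.
have [ui umi] : ('i : R[i]) * ('i)^* = 1 /\ (- 'i : R[i]) * (- 'i)^* = 1.
  by rewrite conjCN ci opprK mulrN mulNr ii opprK.
apply: lin_extE.
- by move=> A [[MA pA] _]; split=> //; exact: mM_lin.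
- exact: hattau_cone_additive.
exists (T 1), (T (-1)), (T 'i), (T (- 'i)); split=> //.
- apply/funext => x; apply: dot_ext => y.
  rewrite !(addfE, oppfE, scalefE) /T !fdg_half// conjCN conjC1 conjCN ci opprK.
  rewrite !(dotDr, dotZr) !dotNr !(dotDr, dotZr).
  by rewrite (four _ _ _ _ ii).
- have re z : mpsi (half f z *m mstar (half f z)) =
      (complex.Re (mpsi (half f z *m mstar (half f z))))%:C.
    exact/ge0_Re/mpsi_bb_ge0.
  have e1 := mpsi_half f u1; rewrite conjC1 re in e1.
  have e2 := mpsi_half f um1; rewrite conjCN conjC1 re in e2.
  have e3 := mpsi_half f ui; rewrite ci re in e3.
  have e4 := mpsi_half f umi; rewrite conjCN ci opprK re in e4.
  have := @four 'i (mpsi (f *m mstar f)) (mpsi f) (mpsi (mstar f))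
    (mpsi (1%:M : 'M[O]_k)) ii.
  rewrite -e1 -e2 -e3 -e4 => <-.
  exact: (combine (vT 1) (vT (-1)) (vT 'i) (vT (- 'i))).
Qed.

End trace_values.

(** * The residue of the zeta function of D *)

Section zeta.
Context {R : realType}.
Implicit Types (s t x : R) (j : int).

Definition brk s x : R := (1 + x ^+ 2) `^ (- s / 2).

Lemma brkE s x : brk s x = expR (- s / 2 * ln (1 + x ^+ 2)).
Proof. by rewrite /brk /powR ifN// gt_eqF//; have := sqr_ge0 x; lra. Qed.

Lemma brk_gt0 s x : 0 < brk s x.
Proof. by rewrite brkE expR_gt0. Qed.

Lemma brkN s x : brk s (- x) = brk s x.
Proof. by rewrite /brk sqrrN. Qed.

Lemma measurable_brk s : measurable_fun setT (brk s).
Proof.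
apply: (measurableT_comp (measurable_powR _)).
by apply: measurable_funD => //; exact: measurable_funX.
Qed.

Lemma brk_le1 s x : 0 <= s -> brk s x <= 1.
Proof.
move=> s0; have l0 : 0 <= ln (1 + x ^+ 2) by apply: ln_ge0; have := sqr_ge0 x; lra.
by rewrite brkE -[leRHS]expR0 ler_expR; nra.
Qed.

(** The function x^(-t). Its differences over unit steps bound t x^(-t-1) from both sides and so
    replace the integral test by telescoping. *)
Let pw t x := expR (- t * ln x).

Let pwS t x : 0 < x -> pw (t + 1) x = pw t x / x.
Proof.
move=> x0; rewrite /pw -{3}(lnK x0) -expRN -expRD; congr expR; ring.
Qed.

Let brk_le s x : 0 <= s -> 0 < x -> brk s x <= pw s x.
Proof.
move=> s0 x0; rewrite brkE ler_expR.
have : ln x + ln x <= ln (1 + x ^+ 2).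
  rewrite -lnM ?posrE// ler_ln ?posrE ?mulr_gt0//; have := sqr_ge0 x; rewrite ?expr2; lra.
by nra.
Qed.

Let brk_ge s x : 0 <= s -> 0 <= x -> pw s (x + 1) <= brk s x.
Proof.
move=> s0 x0; rewrite brkE ler_expR.
have : ln (1 + x ^+ 2) <= ln (x + 1) + ln (x + 1).
  rewrite -lnM ?posrE; try lra.
  by rewrite ler_ln ?posrE ?expr2; nra.
by nra.
Qed.

Let ln_up x : 0 < x -> ln (x + 1) - ln x <= x^-1.
Proof.
move=> x0; have x'0 : 0 < x^-1 by rewrite invr_gt0.
have -> : x + 1 = x * (1 + x^-1) by rewrite mulrDr mulr1 divff ?gt_eqF.
rewrite lnM ?posrE//; last lra.
by have := @le_ln1Dx R x^-1; lra.
Qed.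

Let ln_dn x : 0 < x -> (x + 1)^-1 <= ln (x + 1) - ln x.
Proof.
move=> x0; have y0 : 0 < x + 1 by lra.
have y'0 : 0 < (x + 1)^-1 by rewrite invr_gt0.
have y1 : (x + 1)^-1 < 1 by rewrite invf_lt1//; lra.
have e : x = (x + 1) * (1 - (x + 1)^-1) by rewrite mulrBr mulr1 divff ?gt_eqF//; ring.
have -> : ln x = ln (x + 1) + ln (1 - (x + 1)^-1).
  by rewrite {1}e lnM ?posrE//; lra.
by have := @le_ln1Dx R (- (x + 1)^-1); lra.
Qed.

Let pw_up t x : 0 < t -> 0 < x -> pw t x - pw t (x + 1) <= t * pw (t + 1) x.
Proof.
move=> t0 x0; rewrite pwS//.
have -> : pw t (x + 1) = pw t x * expR (- t * (ln (x + 1) - ln x)).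
  by rewrite -expRD; congr expR; ring.
have := expR_ge1Dx (- t * (ln (x + 1) - ln x)); have := ln_up x0.
have := expR_gt0 (- t * ln x); rewrite -/(pw t x); move: (pw t x) => p.
set q := expR _; set l := ln _ - ln _; set x' := x^-1 => p0 lx q1.
have : 1 - t * x' <= q by nra.
by nra.
Qed.

Let pw_dn t x : 0 < t -> 0 < x -> t * pw (t + 1) (x + 1) <= pw t x - pw t (x + 1).
Proof.
move=> t0 x0; rewrite pwS; last lra.
have -> : pw t x = pw t (x + 1) * expR (t * (ln (x + 1) - ln x)).
  by rewrite -expRD; congr expR; ring.
have := expR_ge1Dx (t * (ln (x + 1) - ln x)); have := ln_dn x0.
have := expR_gt0 (- t * ln (x + 1)); rewrite -/(pw t (x + 1)); move: (pw t _) => p.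
set q := expR _; set l := ln _ - ln _; set x' := (x + 1)^-1 => p0 lx q1.
have : 1 + t * x' <= q by nra.
by nra.
Qed.

Let pw1 t : pw t 1 = 1.
Proof. by rewrite /pw ln1 mulr0 expR0. Qed.

(** The first term is at most 1, which accounts for the summand [t]; the others telescope by
    [pw_dn]. *)
Let up t N : 0 < t -> t * (\sum_(0 <= m < N.+1) brk (t + 1) m.+1%:R) <= t + 1 - pw t N.+1%:R.
Proof.
move=> t0; have t1 : 0 <= t + 1 by lra.
elim: N => [|N IH].
  rewrite big_nat1 pw1; have := @brk_le (t + 1) 1 t1 ltr01; rewrite pw1.
  by move: (brk _ _) => b; nra.
rewrite big_nat_recr//= mulrDr.
have := brk_le t1 (ltr0Sn R N.+1); have := @pw_dn t N.+1%:R t0 (ltr0Sn _ _).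
rewrite (_ : N.+2%:R = N.+1%:R + 1 :> R) ?natr1//; move: IH; set S := \sum_(_ <= _ < _) _.
move: (brk _ _) (pw (t + 1) _) (pw t _) (pw t _) => b p q r; nra.
Qed.

Let dn t N : 0 < t -> 1 - pw t N.+1%:R <= t * (\sum_(0 <= m < N) brk (t + 1) m%:R).
Proof.
move=> t0; have t1 : 0 <= t + 1 by lra.
elim: N => [|N IH]; first by rewrite big_geq// pw1; lra.
rewrite big_nat_recr//= mulrDr.
have := brk_ge t1 (ler0n R N); have := @pw_up t N.+1%:R t0 (ltr0Sn _ _).
rewrite (_ : N%:R + 1 = N.+1%:R) ?natr1//.
move: IH; set S := \sum_(_ <= _ < _) _.
move: (brk _ _) (pw (t + 1) _) (pw t _) (pw t _) => b p q r; nra.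
Qed.

Let sumE t N : \sum_(i < N.*2.+1) brk t (i%:Z - N%:Z)%:~R =
  1 + 2 * \sum_(0 <= m < N) brk t m.+1%:R.
Proof.
rewrite (sum_int_sym N (fun j => brk t j%:~R)); congr (_ + _).
  by rewrite /brk expr0n addr0 powR1.
rewrite mulr_sumr; apply: eq_bigr => m _.
by rewrite rmorphN /= brkN -pmulrn; ring.
Qed.

Let pw_small t e : 0 < t -> 0 < e -> exists N, pw t N.+1%:R <= e.
Proof.
move=> t0 e0; exists (Num.truncn (expR (e^-1 / t))).
set N := _.+1%:R.
have hN : e^-1 / t <= ln N.
  by rewrite -ler_expR lnK ?posrE ?ltr0Sn// ltW// truncnS_gt.
have : 1 + t * ln N <= expR (t * ln N) by exact: expR_ge1Dx.
have hh : e^-1 <= t * ln N by rewrite mulrC -ler_pdivrMr.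
rewrite /pw mulNr expRN => h1; rewrite -[leRHS]invrK lef_pV2 ?posrE ?invr_gt0 ?expR_gt0//.
by lra.
Qed.

(** With t = s - 1, the sum over the integers is 1 plus twice the sum over m >= 1, and [up] and [dn]
    give 2 - t <= t Z <= 2 + 3 t. *)
Lemma zeta_residue s : 1 < s -> exists Z : R,
  (\esum_(j in [set: int]) (brk s j%:~R)%:E = Z%:E)%E /\
  `|(s - 1) * Z - 2| <= 3 * (s - 1).
Proof.
move=> s1; pose t := s - 1; have t0 : 0 < t by rewrite /t; lra.
have sE : s = t + 1 by rewrite /t; ring.
pose c j := brk s j%:~R; have c0 j : 0 <= c j by rewrite ltW// brk_gt0.
have ub N : \sum_(i < N.*2.+1) c (i%:Z - N%:Z) <= 3 + 2 / t.
  rewrite sumE; have := up N t0; rewrite big_nat_recr//= -sE.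
  have := expR_gt0 (- t * ln N.+1%:R); rewrite -/(pw _ _).
  have := brk_gt0 s N.+1%:R; move: (brk _ _) (pw _ _) (\sum_(_ <= _ < _) _) => b p S b0 p0.
  move=> h; rewrite -(ler_pM2l t0).
  have -> : t * (3 + 2 / t) = 3 * t + 2 by field; lra.
  by nra.
have := esum_int_le c0 ub; have : (0 <= \esum_(j in [set: int]) (c j)%:E)%E.
  by apply: esum_ge0 => j _; rewrite lee_fin.
have lb := esum_int_ge _ c0.
move: (\esum_(_ in _) _)%E lb => [Z| |] // lb Z0; rewrite lee_fin => Zu.
exists Z; split=> //; rewrite -/t.
have l2 : 2 - t <= t * Z.
  apply/ler_addgt0Pr => e e0; have [N hN] := pw_small t0 (divr_gt0 e0 (ltr0Sn R 1)).
  have := lb N; rewrite lee_fin sumE; have := dn N.+1 t0.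
  rewrite -sE big_nat_recl//=.
  have -> : brk s 0 = 1 by rewrite /brk expr0n addr0 powR1.
  have : pw t N.+2%:R <= pw t N.+1%:R.
    rewrite /pw ler_expR !mulNr lerN2 ler_wpM2l ?(ltW t0)// ler_ln ?posrE ?ltr0Sn//.
    by rewrite ler_nat.
  move: (\sum_(_ <= _ < _) _) (pw _ _) (pw _ _) hN => S p q hq hpq h1 h2.
  by nra.
have u2 : t * Z <= 2 + 3 * t.
  have : t * Z <= t * (3 + 2 / t) by rewrite ler_pM2l.
  have -> : t * (3 + 2 / t) = 3 * t + 2 by field; lra.
  by lra.
by rewrite ler_norml; lra.
Qed.

Lemma residue_cvg (F : R -> R[i]) (w : R[i]) :
  (forall s, 1 < s -> exists Z : R, F s = (s - 1)%:C * (w * Z%:C) /\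
     `|(s - 1) * Z - 2| <= 3 * (s - 1)) ->
  F s @[s --> 1^'+] --> 2 * w.
Proof.
move=> hF; apply/cvgrPdist_le => e e0.
have eE : e = (complex.Re e)%:C by exact: ge0_Re (ltW e0).
set r := complex.Re e in eE; have r0 : 0 < r by rewrite -ltcR -eE.
have w0 := normc_ge0 w; set W := Normc.normc w in w0.
near=> s.
have s1 : 1 < s by near: s; exact: nbhs_right_gt.
(* The error is at most 3 W (s - 1); the added 1 covers the case W = 0. *)
have sr : s < 1 + r / (3 * W + 1).
  by near: s; apply: nbhs_right_lt; rewrite ltrDl divr_gt0//; lra.
have [Z [-> hZ]] := hF s s1.
have -> : 2 * w - (s - 1)%:C * (w * Z%:C) = w * (2 - (s - 1) * Z)%:C.
  have -> : (2 - (s - 1) * Z)%:C = 2 - (s - 1)%:C * Z%:C.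
    by rewrite rmorphB rmorphM/= rmorph_nat.
  by ring.
rewrite eE normcC Normc.normcM normcR lecR -/W distrC.
have : 3 * (s - 1) * (3 * W + 1) <= 3 * r.
  rewrite -mulrA ler_pM2l// -ler_pdivlMr; last lra.
  by rewrite lerBlDl ltW.
move=> h; apply: (@le_trans _ _ (W * (3 * (s - 1)))); first by rewrite ler_wpM2l.
by nra.
Unshelve. all: by end_near.
Qed.

Lemma residue_lim (F : R -> R[i]) (w : R[i]) : F s @[s --> 1^'+] --> 2 * w ->
  2^-1 * lim (F s @[s --> 1^'+]) = w.
Proof.
by move=> /cvg_lim -> //; rewrite mulrA mulVf ?mul1r// pnatr_eq0.
Qed.

End zeta.

(** * The residue of the trace and the twisted cocycle *)

Section theta.
Context {R : realType} {n : nat} {G : cuntz_system R n} {k : nat}.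
Hypothesis n2 : (2 <= n)%N.
Local Notation O := (cs_O G).
Local Notation H := (cs_H G).
Local Notation Hk := {ffun 'I_k -> H}.
Local Notation mM := (mM G k).
Local Notation fdg := (@fdg _ _ G k).
Local Notation psi := (@psi _ _ G).
Local Notation der := (mdmul (fun j : int => j%:~R)).
Implicit Types (a b f g : 'M[O]_k) (s : R).

Lemma brk_bounded s : 0 <= s -> bounded_seq (fun j : int => brk s (j%:~R : R)).
Proof. by move=> s0; exists 1 => j; rewrite ger0_norm ?brk_le1// ltW// brk_gt0. Qed.

Lemma mrep_resolvent f s : 0 <= s ->
  mrep f \o resolvent_pow G k s = fdg f (fun j => brk s j%:~R).
Proof.
move=> s0; rewrite /resolvent_pow -[fun x : R => _]/(brk s) fcalc_mdg//.
  exact: measurable_brk.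
exact: brk_bounded.
Qed.

Lemma hattau_residue f : MF f ->
  ((s - 1)%:C * hattau_ext (mrep f \o resolvent_pow G k s)) @[s --> 1^'+] -->
  2 * mpsi f.
Proof.
move=> Mf; apply: residue_cvg => s s1; have s0 : 0 <= s by lra.
have [Z [hZ Zb]] := zeta_residue s1; exists Z; split=> //.
rewrite mrep_resolvent// (hattau_ext_fdg n2 Mf _ _ hZ)//.
  by move=> j; rewrite ltW// brk_gt0.
exact: brk_bounded.
Qed.

Lemma mpsi_Phi a : in_MOnc a -> mpsi (map_mx (cs_Phi G) a) = mpsi a.
Proof.
move=> Oa; apply: eq_bigr => i _; rewrite mxE.
by rewrite Phi_fix//; have [] := Phi_Onc (Oa i i).
Qed.

Lemma MOnc_mul a b : in_MOnc a -> in_MOnc b -> in_MOnc (a *m b).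
Proof. by move=> Oa Ob i j; rewrite mxE; apply: Onc_sum => l _; exact: OncM. Qed.

Lemma MOnc_add a b : in_MOnc a -> in_MOnc b -> in_MOnc (a + b).
Proof. by move=> Oa Ob i j; rewrite mxE; exact: OncD. Qed.

Lemma MOnc_scale (z : R[i]) a : in_MOnc a -> in_MOnc (z%:A *: a).
Proof. by move=> Oa i j; rewrite mxE -scalerAl mul1r; exact: OncZ. Qed.

(** [mPsi] replaces the matrix by its fixed point part, which has the same [mpsi], so the residue
    formula for [MF] applies. *)
Lemma theta_cvg a0 a1 : in_MOnc a0 -> in_MOnc a1 ->
  theta_at a0 a1 s @[s --> 1^'+] --> 2 * mpsi (a0 *m der a1).
Proof.
move=> O0 O1; have Od := mdmul_Onc (fun j => j%:~R) O1; have Om := MOnc_mul O0 Od.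
rewrite -(mpsi_Phi Om).
have -> : theta_at a0 a1 = (fun s => (s - 1)%:C *
    hattau_ext (mrep (map_mx (cs_Phi G) (a0 *m der a1)) \o resolvent_pow G k s)).
  by apply/funext => s; rewrite /theta_at /tau_Delta commutator_mrep// -mrepM mPsi_mrep.
exact/hattau_residue/MF_Phi.
Qed.

Lemma thetaE a0 a1 : in_MOnc a0 -> in_MOnc a1 -> theta a0 a1 = mpsi (a0 *m der a1).
Proof. by move=> O0 O1; exact/residue_lim/theta_cvg. Qed.

Lemma mKMS a b : in_MOnc a -> in_MOnc b -> mpsi (a *m b) = mpsi (msigma b *m a).
Proof.
move=> Oa Ob; rewrite /mpsi.
under eq_bigr do rewrite mxE -/(psi _) psi_sum.
rewrite exchange_big; apply: eq_bigr => l _; rewrite mxE -/(psi _) psi_sum.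
by apply: eq_bigr => i _; rewrite mxE KMS.
Qed.

Lemma msigmaE a : msigma a = mdmul (fun j => (n%:R ^ j : R)%:C) a.
Proof. by apply/matrixP => i j; rewrite !mxE. Qed.

Lemma mdmulM (c : int -> R[i]) a b : (forall i j, c (i + j) = c i + c j) ->
  in_MOnc a -> in_MOnc b -> mdmul c (a *m b) = mdmul c a *m b + a *m mdmul c b.
Proof.
move=> hc Oa Ob; apply/matrixP => i j; rewrite !mxE dmul_sum//; last by move=> l; exact: OncM.
rewrite -big_split; apply: eq_bigr => l _ /=.
by rewrite !mxE dmul_derivation.
Qed.

Lemma mpsi_der a : in_MOnc a -> mpsi (der a) = 0.
Proof.
move=> Oa; rewrite /mpsi big1// => i _; rewrite mxE.
exact: psi_dmul_id.
Qed.

Lemma der_lin (z : R[i]) a b : in_MOnc a -> in_MOnc b ->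
  der (z%:A *: a + b) = z%:A *: der a + der b.
Proof.
move=> Oa Ob; apply/matrixP => i j; rewrite !mxE -!scalerAl !mul1r.
by rewrite dmul_lin.
Qed.

Lemma theta_lin (z : R[i]) a b a1 : in_MOnc a -> in_MOnc b -> in_MOnc a1 ->
  theta (z%:A *: a + b) a1 = z * theta a a1 + theta b a1 /\
  theta a1 (z%:A *: a + b) = z * theta a1 a + theta a1 b.
Proof.
move=> Oa Ob O1; have Oab : in_MOnc (z%:A *: a + b).
  by apply: MOnc_add => //; exact: MOnc_scale.
rewrite !thetaE//; split; first by rewrite mulmxDl -scalemxAl mpsiD mpsiZ.
by rewrite der_lin// mulmxDr mulmx_scaler mpsiD mpsiZ.
Qed.

Lemma theta_b_sigma a0 a1 a2 : in_MOnc a0 -> in_MOnc a1 -> in_MOnc a2 ->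
  b_sigma theta a0 a1 a2 = 0.
Proof.
move=> O0 O1 O2; have O12 := MOnc_mul O1 O2; have O01 := MOnc_mul O0 O1.
have Os : in_MOnc (msigma a2) by rewrite msigmaE; exact: mdmul_Onc.
have Os0 := MOnc_mul Os O0; rewrite /b_sigma !thetaE//.
rewrite mdmulM//; last by move=> i j; rewrite intrD.
(* After the Leibniz rule the terms with [der a2] cancel, and [mKMS] turns the twisted term into
   [mpsi (a0 *m der a1 *m a2)], which cancels the rest. *)
rewrite mulmxDr mpsiD -!mulmxA -mKMS//; first by rewrite !mulmxA; ring.
by apply: MOnc_mul => //; exact: mdmul_Onc.
Qed.

Lemma theta_B_sigma a0 : in_MOnc a0 -> B_sigma theta a0 = 0.
Proof.
move=> O0; rewrite /B_sigma thetaE//; last exact: (@MF1 _ _ G k).1.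
by rewrite mul1mx mpsi_der.
Qed.

End theta.

(** * Spectral decomposition of modular unitaries *)

Section modular.
Context {R : realType} {n : nat} {G : cuntz_system R n} {k : nat}.
Hypothesis n2 : (2 <= n)%N.
Local Notation O := (cs_O G).
Local Notation H := (cs_H G).
Local Notation io := (cs_iota G).
Local Notation Phik := (cs_Phik G).
Local Notation Onc := (Onc (cs_S G)).
Local Notation der := (mdmul (fun j : int => j%:~R)).
Implicit Types (a b f g u : 'M[O]_k) (c d : int -> R[i]) (l m : int).

Lemma Onc_support (a : O) : Onc a -> exists N, forall j, (N < absz j)%N -> Phik j (io a) = 0.
Proof.
move: a; apply: Onc_ind => [|z mu nu b [N hN]].
  by exists 0%N => j _; rewrite (lin0 (@io_lin _ _ G)) (lin0 (Phik_lin j)).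
exists (maxn (absz (degree mu nu)) N) => j; rewrite gtn_max => /andP[h1 h2].
rewrite io_lin (Phik_lin j) hN// addr0 Phik_w2.
by case: eqP => [e|_]; rewrite ?scaler0//; move: h1; rewrite e ltnn.
Qed.

Lemma MOnc_support a : in_MOnc a ->
  exists N, forall i j l, (N < absz l)%N -> Phik l (io (a i j)) = 0.
Proof.
move=> Oa; have h (p : 'I_k * 'I_k) := Onc_support (Oa p.1 p.2).
pose F p := projT1 (cid (h p)); have hF p := projT2 (cid (h p)).
exists (\max_p F p) => i j l hl; apply: (hF (i, j)).
by apply: leq_ltn_trans hl; exact: (leq_bigmax (i, j)).
Qed.

Lemma mdmul_ext c d a N : in_MOnc a ->
  (forall i j l, (N < absz l)%N -> Phik l (io (a i j)) = 0) ->
  (forall l, (absz l <= N)%N -> c l = d l) -> mdmul c a = mdmul d a.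
Proof.
move=> Oa hN h; apply/matrixP => i j; rewrite !mxE; apply: dmul_ext => // l hl.
by apply: h; rewrite leqNgt; apply: contraNN hl => hl; rewrite hN.
Qed.

Lemma mdmul_mul c a f : in_MOnc a -> MF f -> mdmul c (a *m f) = mdmul c a *m f.
Proof.
move=> Oa [Of Ff]; apply/matrixP => i j; rewrite !mxE dmul_sum//; last first.
  by move=> l; exact: OncM.
by apply: eq_bigr => l _; rewrite !mxE dmul_fixr.
Qed.

Lemma mdmul_star c a : in_MOnc a ->
  mdmul c (mstar a) = mstar (mdmul (fun j => (c (- j))^*) a).
Proof. by move=> Oa; apply/matrixP => i j; rewrite !mxE dmul_star. Qed.

Lemma mdmul_mdmul c d a : in_MOnc a -> mdmul c (mdmul d a) = mdmul (fun j => c j * d j) a.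
Proof. by move=> Oa; apply/matrixP => i j; rewrite !mxE dmul_dmul. Qed.

Lemma mdmul_addc c d a : in_MOnc a ->
  mdmul (fun j => c j + d j) a = mdmul c a + mdmul d a.
Proof. by move=> Oa; apply/matrixP => i j; rewrite !mxE dmul_addc. Qed.

Lemma mdmul_scalec (z : R[i]) c a : in_MOnc a ->
  mdmul (fun j => z * c j) a = z%:A *: mdmul c a.
Proof.
by move=> Oa; apply/matrixP => i j; rewrite !mxE dmul_scalec// -scalerAl mul1r.
Qed.

Lemma mdmul1 a : in_MOnc a -> mdmul (fun=> 1) a = a.
Proof. by move=> Oa; apply/matrixP => i j; rewrite !mxE dmul1. Qed.

Lemma mdmul_0 a : in_MOnc a -> mdmul (fun=> 0) a = 0.
Proof.
move=> Oa; have := mdmul_scalec 0 (fun=> 1) Oa.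
by rewrite scale0r scale0r => <-; congr mdmul; apply/funext => j; rewrite mul0r.
Qed.

Lemma mdmul_sumc (I : Type) (r : seq I) (z : I -> R[i]) (c : I -> int -> R[i]) a :
  in_MOnc a ->
  mdmul (fun j => \sum_(i <- r) z i * c i j) a = \sum_(i <- r) (z i)%:A *: mdmul (c i) a.
Proof.
move=> Oa; elim: r => [|i r IH].
  rewrite big_nil -(mdmul_0 Oa); congr mdmul; apply/funext => j; exact: big_nil.
rewrite big_cons -IH -mdmul_scalec// -mdmul_addc//; congr mdmul.
by apply/funext => j; rewrite big_cons.
Qed.

Lemma MOnc_star a : in_MOnc a -> in_MOnc (mstar a).
Proof. by move=> Oa i j; rewrite mxE; exact: Onc_star. Qed.

Lemma mdmul_MF c f : MF f -> mdmul c f = (c 0)%:A *: f.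
Proof.
move=> Mf; have [Of _] := Mf; rewrite -{1}[f]mul1mx mdmul_mul//; last exact: (@MF1 _ _ G k).1.
suff -> : mdmul c (1%:M : 'M[O]_k) = (c 0)%:A *: 1%:M by rewrite -scalemxAl mul1mx.
apply/matrixP => i j; rewrite !mxE -scalerAl mul1r; case: eqP => _.
  have : word2 (cs_S G) [::] [::] = 1 by rewrite /word2 /word !big_nil star1 mulr1.
  by move=> <-; rewrite dmul_w2.
by rewrite mulr0n dmul0// scaler0.
Qed.

Section unitary.
Variable u : 'M[O]_k.
Hypothesis hu : modular_unitary u.

Let Ou : in_MOnc u. Proof. by case: hu. Qed.
Let us := mstar u.
Let Ous : in_MOnc us. Proof. exact: MOnc_star. Qed.
Let uus : u *m us = 1%:M. Proof. by case: hu => _ []. Qed.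
Let usu : us *m u = 1%:M. Proof. by case: hu => _ []. Qed.

Definition mslice c : 'M[O]_k := u *m mdmul c us.
Local Notation W := mslice.

Let us_mslice c : us *m W c = mdmul c us.
Proof. by rewrite /W mulmxA usu mul1mx. Qed.

Let mslice_sum (I : Type) (r : seq I) (z : I -> R[i]) (c : I -> int -> R[i]) :
  W (fun j => \sum_(i <- r) z i * c i j) = \sum_(i <- r) (z i)%:A *: W (c i).
Proof.
by rewrite /W mdmul_sumc// mulmx_sumr; apply: eq_bigr => i _; rewrite mulmx_scaler.
Qed.

Let mslice1 : W (fun=> 1) = 1%:M.
Proof. by rewrite /W mdmul1. Qed.

Let mslice_mul c d : MF (W d) -> W c *m W d = W (fun j => c j * d j).
Proof.
by move=> MW; rewrite {1}/W -mulmxA -mdmul_mul// us_mslice mdmul_mdmul.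
Qed.

(** Modularity enters here: a factor n^j in the symbol multiplies the slice on the left by
    [u *m msigma (mstar u)], a matrix over the fixed point algebra. *)
Let mslice_nj c : MF (W c) -> MF (W (fun j => (n%:R ^ j : R)%:C * c j)).
Proof.
move=> MW; rewrite -mslice_mul//; apply: MF_mul => //.
case: hu => _ _ h _; split; last by rewrite /W -msigmaE.
by apply: MOnc_mul => //; exact: mdmul_Onc.
Qed.

Let mslice_addZ z c d : MF (W c) -> MF (W d) -> MF (W (fun j => z * c j + d j)).
Proof.
move=> Mc Md; rewrite /W mdmul_addc// mdmul_scalec// mulmxDr mulmx_scaler.
by apply: MF_add => //; exact: MF_scale.
Qed.

Let injn i j : (n%:R ^ i : R) = n%:R ^ j -> i = j.
Proof.
move=> h; apply: (@ieexprIz R n%:R) => //; first by rewrite ltr0n; lia.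
by rewrite pnatr_eq1; lia.
Qed.

(* The indicator function of l is, on the finite support of u, the Lagrange
   interpolation polynomial in n^j. *)
Lemma MF_mslice_delta l : MF (W (fun j => (j == l)%:R)).
Proof.
have [N hN] := MOnc_support Ous.
pose L (r : seq int) j : R[i] := \prod_(i <- r) ((n%:R ^ j : R)%:C - (n%:R ^ i : R)%:C).
have lag (r : seq int) : MF (W (L r)).
  elim: r => [|i r IH].
    have -> : L [::] = fun=> 1 by apply/funext => j; rewrite /L big_nil.
    by rewrite mslice1; exact: MF1.
  have := mslice_addZ (- (n%:R ^ i : R)%:C) IH (mslice_nj IH).
  congr (MF (W _)); apply/funext => j; rewrite /L big_cons; ring.
(* All degrees of the window except [l]. If [l] lies outside the window nothing is removed, and both
   [L r] and the indicator function vanish on the window. *)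
pose r := [seq i%:Z - N%:Z | i <- iota 0 N.*2.+1 & i%:Z - N%:Z != l].
have lr : L r l != 0.
  rewrite prodf_seq_neq0; apply/allP => i /mapP[j]; rewrite mem_filter => /andP[jl _] ->.
  by rewrite implyTb subr_eq0; apply: contraNN jl => /eqP/complexI/injn ->.
have := MF_scale (L r l)^-1 (lag r).
rewrite /W -mulmx_scaler -mdmul_scalec//.
rewrite (mdmul_ext (d := fun j => (j == l)%:R) Ous hN) => [//|j jN].
have [->|jl] := eqVneq j l; first by rewrite mulVf.
suff -> : L r j = 0 by rewrite mulr0.
apply/eqP; rewrite prodf_seq_eq0; apply/hasP; exists j; last by rewrite /= subrr.
apply/mapP; exists (absz (j + N%:Z)); last lia.
rewrite mem_filter mem_iota; apply/andP; split; last lia.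
by apply: contraNN jl; lia.
Qed.

Lemma modular_decomposition : exists (N : nat) (q : int -> 'M[O]_k),
  [/\ forall l, MF (q l),
      forall l m, q l *m q m = if l == m then q m else 0,
      forall l, mstar (q l) = q l,
      \sum_(i < N.*2.+1) q (i%:Z - N%:Z) = 1%:M
    & u *m der us = \sum_(i < N.*2.+1) ((i%:Z - N%:Z)%:~R)%:A *: q (i%:Z - N%:Z)].
Proof.
have [N hN] := MOnc_support Ous.
pose dl l j : R[i] := (j == l)%:R; pose q l := W (dl l).
have Mq l : MF (q l) by exact: MF_mslice_delta.
have decomp c : W c = \sum_(i < N.*2.+1) (c (i%:Z - N%:Z))%:A *: q (i%:Z - N%:Z).
  rewrite -mslice_sum; congr (u *m _); apply: (mdmul_ext Ous hN) => j jN.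
  have jo : (absz (j + N%:Z)%R < N.*2.+1)%N by lia.
  rewrite (bigD1 (Ordinal jo))//= big1 => [|i ij].
    have -> : (absz (j + N%:Z))%:Z - N%:Z = j by lia.
    by rewrite /dl eqxx mulr1 addr0.
  rewrite /dl; case: eqP => [e|_]; last by rewrite mulr0.
  by move/eqP: ij; case; apply: val_inj => /=; lia.
have sum1 : \sum_(i < N.*2.+1) q (i%:Z - N%:Z) = 1%:M.
  rewrite -mslice1 decomp; apply: eq_bigr => i _.
  by rewrite scale1r scale1r.
have orth l m : q l *m q m = if l == m then q m else 0.
  rewrite mslice_mul; last exact: Mq.
  case: (l =P m) => [->|lm].
    congr (u *m mdmul _ _); apply/funext => j; rewrite /dl.
    by case: eqP; rewrite ?mulr1 ?mulr0.
  rewrite -(mulmx0 _ u) -(mdmul_0 Ous); congr (u *m mdmul _ _); apply/funext => j.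
  rewrite /dl; case: eqP => [->|_]; last by rewrite mul0r.
  by case: eqP; rewrite ?mulr0.
exists N, q; split=> // [l|].
  have Ms m : MF (mstar (q m)) by exact: MF_star.
  (* Given this, multiplying [mstar (q l)] by the sum of all [q m] leaves only [mstar (q l) *m q l],
     which is self-adjoint. *)
  suff h m : m != l -> mstar (q l) *m q m = 0.
    have e : mstar (q l) = mstar (q l) *m q l.
      transitivity (mstar (q l) *m W (dl l)); last by [].
      rewrite -{1}[mstar (q l)]mulmx1 -sum1 decomp !mulmx_sumr.
      apply: eq_bigr => i _; rewrite mulmx_scaler /dl.
      by case: eqP => [_|/eqP/h ->]; rewrite ?scaler0// scale1r scale1r.
    by rewrite e -{2}[q l]mstarK -mstar_mul -e mstarK.
  (* The product equals [mstar (w l) *m w m], of degree m - l because [w m] is homogeneous of degree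
     [m]. Being over the fixed point algebra it also has degree 0, so [der] multiplies it both by m
     - l and by 0. *)
  move=> ml.
  pose w m := us *m q m.
  have wE i : w i = mdmul (dl i) us by exact: us_mslice.
  have Ow i : in_MOnc (w i) by rewrite wE; exact: mdmul_Onc.
  have dw i : der (w i) = (i%:~R)%:A *: w i.
    rewrite wE mdmul_mdmul// -mdmul_scalec//; congr mdmul; apply/funext => j.
    by rewrite /dl; case: eqP => [->//|_]; rewrite !mulr0.
  have e : mstar (q l) *m q m = mstar (w l) *m w m.
    by rewrite /w mstar_mul mstarK -mulmxA (mulmxA u) uus mul1mx.
  have dws : der (mstar (w l)) = (- l%:~R)%:A *: mstar (w l).
    rewrite mdmul_star//.
    have -> : (fun j : int => ((- j)%:~R : R[i])^*) = (fun j => -1 * j%:~R).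
      by apply/funext => j; rewrite mulN1r -intrN rmorph_int.
    by rewrite mdmul_scalec// dw !mstarZ conjCN conjC1 rmorph_int scalermxA mulN1r.
  have := mdmul_MF (fun j => j%:~R) (MF_mul (Ms l) (Mq m)).
  rewrite e mulr0z scale0r scale0r mdmulM//; last 2 first.
  - by move=> i j; rewrite intrD.
  - exact: MOnc_star.
  rewrite dw dws -scalemxAl mulmx_scaler -scalerDl -scalerDl -intrN -intrD => z0.
  have nz : (- l + m)%:~R != 0 :> R[i] by rewrite intr_eq0; move: ml; lia.
  by rewrite -[LHS]scale1r -[X in X *: _]scale1r -(mulVf nz) -scalermxA z0 scaler0.
by rewrite -[LHS]/(W _) decomp.
Qed.

End unitary.
End modular.

(** * The algebra spanned by the spectral projections of u[D, u*] and D *)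

Section joint.
Context {R : realType} {n : nat} {G : cuntz_system R n} {k m : nat}.
Hypothesis n2 : (2 <= n)%N.
Local Notation O := (cs_O G).
Local Notation H := (cs_H G).
Local Notation Hk := {ffun 'I_k -> H}.
Local Notation mPhik := (@mPhik _ _ G k).
Local Notation mM := (mM G k).
Local Notation mD := (mD G k).
Local Notation hattau := (@hattau _ _ G k).
Local Notation fdg := (@fdg _ _ G k).
Variables (q : 'I_m -> 'M[O]_k) (l : 'I_m -> int).
Hypothesis Mq : forall i, MF (q i).
Hypothesis q_orth : forall i j, q i *m q j = if i == j then q j else 0.
Hypothesis q_star : forall i, mstar (q i) = q i.
Hypothesis q_sum : \sum_i q i = 1%:M.
Implicit Types (x y : Hk) (c d : 'I_m -> int -> R) (t : R).

Definition jproj (p : 'I_m * int) : Hk -> Hk := mrep (q p.1) \o mPhik p.2.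
Local Notation Q := jproj.

Let mPhik_q i j x : mPhik j (mrep (q i) x) = mrep (q i) (mPhik j x).
Proof. by case: (Mq i) => Oq Fq; exact: mPhik_mrep_fix. Qed.

Let mrep_q i i' x : mrep (q i) (mrep (q i') x) = if i == i' then mrep (q i') x else 0.
Proof.
transitivity (mrep (q i *m q i') x); first by rewrite mrepM.
by rewrite q_orth; case: eqP => // _; rewrite mrep0.
Qed.

Let sum_mrep_q x : \sum_i mrep (q i) x = x.
Proof.
transitivity ((\sum_i mrep (q i)) x); first by rewrite sumfE.
by rewrite -mrep_sum q_sum mrep1.
Qed.

Lemma odec_jproj : odec Q.
Proof.
split=> [[i j]|[i j] [i' j'] x /= h|x h].
- rewrite /Q /=; have [bP iP aP] := @mPhik_proj _ _ G k j.
  split; first exact: bounded_comp (mrep_bounded _) bP.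
    apply/funext => x /=.
    by rewrite mPhik_q mrep_q eqxx mPhik_orth eqxx.
  move=> x y; rewrite /= mrep_adj q_star aP mPhik_q//.
- rewrite /Q /= mPhik_q mrep_q mPhik_orth.
  case: (i =P i') h => [-> h|//]; case: eqP => [jj|_]; last exact: (lin0 (mrep_lin _)).
  by move: h; rewrite jj eqxx.
- apply: (odec_eq (@odec_mPhik _ _ G k)) => j; rewrite (lin0 (@mPhik_lin _ _ G k j)).
  rewrite -[LHS]sum_mrep_q big1// => i _; exact: (h (i, j)).
Qed.

(* The operator with the eigenvalue c i j on the range of q_i Phi_j. *)
Definition jdiag c : Hk -> Hk := \sum_i fdg (q i) (c i).
Local Notation J := jdiag.

Definition bounded_fam c : Prop := forall i, bounded_seq (c i).

Lemma jproj_diag c p x : bounded_fam c -> Q p (J c x) = (c p.1 p.2)%:C *: Q p x.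
Proof.
move=> bc; case: p => i j; rewrite /Q /= /J sumfE (lin_sum (@mPhik_lin _ _ G k j)).
rewrite (lin_sum (mrep_lin _)) (bigD1 i)//= big1 => [|i' ii'].
  by rewrite mPhik_fdg// (linZ (mrep_lin _)) mrep_q eqxx addr0.
rewrite mPhik_fdg// (linZ (mrep_lin _)) mrep_q eq_sym (negPf ii').
by rewrite scaler0.
Qed.

Lemma mM_jdiag c : bounded_fam c -> mM (J c).
Proof. by move=> bc; apply: (mM_sum n2) => i _; exact: mM_fdg. Qed.

Lemma jdiag_eq c (A : Hk -> Hk) : bounded_fam c ->
  (forall p x, Q p (A x) = (c p.1 p.2)%:C *: Q p x) -> A = J c.
Proof.
move=> bc h; apply/funext => x; apply: (odec_eq odec_jproj) => p.
by rewrite h jproj_diag.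
Qed.

Lemma jproj_lin p : linear (Q p).
Proof. by case: odec_jproj => /(_ p)/proj_lin. Qed.

Let bounded_seqM (c d : int -> R) : bounded_seq c -> bounded_seq d ->
  bounded_seq (fun j => c j * d j).
Proof.
move=> [C hC] [E hE]; exists (`|C| * `|E|) => j; rewrite normrM ler_pM//.
  exact: le_trans (hC j) (ler_norm _).
exact: le_trans (hE j) (ler_norm _).
Qed.

Let bounded_seqD (c d : int -> R) : bounded_seq c -> bounded_seq d ->
  bounded_seq (fun j => c j + d j).
Proof.
move=> [C hC] [E hE]; exists (C + E) => j.
by apply: le_trans (ler_normD _ _) _; rewrite lerD.
Qed.

Lemma bounded_famM c d : bounded_fam c -> bounded_fam d ->
  bounded_fam (fun i j => c i j * d i j).
Proof. by move=> bc bd i; exact: bounded_seqM. Qed.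

Lemma bounded_famD c d : bounded_fam c -> bounded_fam d ->
  bounded_fam (fun i j => c i j + d i j).
Proof. by move=> bc bd i; exact: bounded_seqD. Qed.

Lemma jdiag_comp c d : bounded_fam c -> bounded_fam d ->
  J c \o J d = J (fun i j => c i j * d i j).
Proof.
move=> bc bd; apply: jdiag_eq => [|p x]; first exact: bounded_famM.
by rewrite /= !jproj_diag// scalerA -rmorphM.
Qed.

Lemma jdiag_add c d : bounded_fam c -> bounded_fam d ->
  J c + J d = J (fun i j => c i j + d i j).
Proof.
move=> bc bd; apply: jdiag_eq => [|p x]; first exact: bounded_famD.
by rewrite addfE (linD (jproj_lin p)) !jproj_diag// -scalerDl -rmorphD.
Qed.

Lemma jdiag_sub c d : bounded_fam c -> bounded_fam d ->
  J c - J d = J (fun i j => c i j - d i j).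
Proof.
move=> bc bd; apply: jdiag_eq => [|p x].
  apply: bounded_famD => // i; case: (bd i) => C hC; exists C => j.
  by rewrite normrN.
by rewrite addfE oppfE (linB (jproj_lin p)) !jproj_diag// -scalerBl -rmorphB.
Qed.

Lemma jdiag1 : J (fun _ _ => 1) = id.
Proof.
symmetry; apply: jdiag_eq => [i|p x]; first by exists 1 => j; rewrite normr1.
by rewrite scale1r.
Qed.

Lemma jdiag_adj c : bounded_fam c -> adjoint_of (J c) (J c).
Proof.
by move=> bc; apply: adjoint_sum => i; rewrite -{2}q_star; exact: fdg_adj.
Qed.

Let qq i : q i = q i *m mstar (q i).
Proof. by rewrite q_star q_orth eqxx. Qed.

Lemma jdiag_pos c : bounded_fam c -> (forall i j, 0 <= c i j) -> pos_part mM (J c).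
Proof.
by move=> bc c0; apply: (mM_pos_sum n2) => i _; rewrite qq; exact: fdg_pos.
Qed.

Definition weight i : R := complex.Re (mpsi (q i)).

Lemma weight_ge0 i : 0 <= weight i.
Proof. by rewrite /weight qq; exact/ge0_Re_ge0/mpsi_bb_ge0. Qed.

Lemma mpsi_weight i : mpsi (q i) = (weight i)%:C.
Proof. by rewrite /weight qq; exact/ge0_Re/mpsi_bb_ge0. Qed.

Lemma hattau_jdiag c : bounded_fam c -> (forall i j, 0 <= c i j) ->
  hattau (J c) = (\sum_i (weight i)%:E * \esum_(j in [set: int]) (c i j)%:E)%E.
Proof.
move=> bc c0; rewrite /J hattau_sum//; last first.
  by move=> i _; rewrite qq; exact: fdg_pos.
by apply: eq_bigr => i _; rewrite /weight qq hattau_fdg.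
Qed.

Lemma jdiag_projection c : bounded_fam c -> (forall i j, c i j * c i j = c i j) ->
  projection (J c).
Proof.
move=> bc h; split; [exact/mM_bounded/mM_jdiag| |exact: jdiag_adj].
by rewrite jdiag_comp//; congr J; apply/funext => i; apply/funext => j.
Qed.

Lemma jdiag_bool (e : 'I_m -> int -> bool) : bounded_fam (fun i j => (e i j)%:R).
Proof. by move=> i; exists 1 => j; case: (e i j); rewrite ?normr1 ?normr0. Qed.

Lemma corner_kernel_jdiag (e f : 'I_m -> int -> bool) :
  corner_kernel (J (fun i j => (e i j)%:R)) (J (fun i j => (f i j)%:R)) =
  J (fun i j => (f i j && ~~ e i j)%:R).
Proof.
have be := jdiag_bool e; have bf := jdiag_bool f.
have bg := jdiag_bool (fun i j => f i j && ~~ e i j).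
apply: proj_onto_eq; first exact/mM_bounded/mM_jdiag.
- move=> x; split=> /=.
    split; apply: (odec_eq odec_jproj) => p; rewrite !jproj_diag//.
      by rewrite scalerA -rmorphM; case: (f _ _); rewrite ?mul1r ?mul0r.
    rewrite (lin0 (jproj_lin p)).
    by case: (f _ _); case: (e _ _); rewrite ?scale0r ?scaler0// scale1r scale0r.
  move=> y [fy ey]; have -> : y = J (fun i j => (f i j && ~~ e i j)%:R) y.
    apply: (odec_eq odec_jproj) => p; rewrite jproj_diag//.
    have h1 := congr1 (Q p) fy; have h2 := congr1 (Q p) ey.
    rewrite (lin0 (jproj_lin p)) !jproj_diag// in h1 h2.
    move: h1 h2; case: (f _ _); case: (e _ _) => //=; rewrite ?scale1r ?scale0r//.
  rewrite (jdiag_adj bg) (linB (mM_lin (mM_jdiag bg))) proj_idem ?subrr ?dot0r//.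
  by apply: jdiag_projection => // i j; case: (_ && _); rewrite ?mulr1 ?mulr0.
- move=> x y [fx ex] [fy ey]; have lf := mM_lin (mM_jdiag bf).
  have le := mM_lin (mM_jdiag be).
  rewrite fx in ex; rewrite fy in ey.
  split; rewrite (linB lf) fx fy//.
  by rewrite (linB le) ex ey subrr.
Qed.

(** ** The path from D to u D u* *)

Definition lspec : 'M[O]_k := \sum_i ((l i)%:~R)%:A *: q i.

Definition jeig t i (j : int) : R := j%:~R + t * (l i)%:~R.

Let Dt t := add_partial mD (t%:C *: mrep lspec).

Let q_lspec i : q i *m lspec = ((l i)%:~R)%:A *: q i.
Proof.
rewrite mulmx_sumr (bigD1 i)//= big1 => [|j ji].
  by rewrite mulmx_scaler q_orth eqxx addr0.
by rewrite mulmx_scaler q_orth eq_sym (negPf ji) scaler0.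
Qed.

Let MF_lspec : MF lspec.
Proof. by apply: MF_sum => i _; exact: MF_scale. Qed.

Let jproj_lspec p x : Q p (mrep lspec x) = ((l p.1)%:~R : R[i]) *: Q p x.
Proof.
case: p => i j; rewrite /Q /=; case: (MF_lspec) => Ol Fl; rewrite mPhik_mrep_fix//.
rewrite -[LHS]/((mrep (q i) \o mrep lspec) (mPhik j x)) -mrepM q_lspec mrepZ.
by rewrite scalefE.
Qed.

Let jeigC t p : (jeig t p.1 p.2)%:C = p.2%:~R + t%:C * (l p.1)%:~R :> R[i].
Proof. by rewrite /jeig rmorphD rmorphM/= !rmorph_int. Qed.

Let Dt_app t x : dom mD x -> forall p, Q p (Dt t x) = (jeig t p.1 p.2)%:C *: Q p x.
Proof.
move=> dx p; rewrite /= (linD (jproj_lin p)) scalefE (linZ (jproj_lin p)) jproj_lspec.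
rewrite jeigC scalerDl scalerA; congr (_ + _); rewrite /Q /= mD_comp//.
exact: (linZ (mrep_lin _)).
Qed.

(** [mrep lspec] is bounded, so the domain stays that of [mD], and the projections [jproj]
    diagonalize the sum with eigenvalues [jeig t]. *)
Lemma fcalc_path t (f : R -> R) (C : R) : measurable_fun setT f ->
  (forall r : R, `|f r| <= C) ->
  fcalc (Dt t) f = J (fun i j => f (jeig t i j)).
Proof.
move=> mf hf; have bf : bounded_fam (fun i j => f (jeig t i j)) by move=> i; exists C.
apply: (odec_fcalc (@complete_Hk _ _ G k) odec_jproj (lam := fun p => jeig t p.1 p.2)) => //.
- move=> x; split=> [dx|[y hy]]; first by exists (Dt t x); exact: Dt_app.
  apply/mD_domP; exists (y - t%:C *: mrep lspec x) => j.
  rewrite -[LHS]sum_mrep_q -[RHS]sum_mrep_q; apply: eq_bigr => i _.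
  rewrite -[LHS]/(Q (i, j) _) (linB (jproj_lin _)) hy (linZ (jproj_lin _)) jproj_lspec.
  rewrite jeigC /= scalerDl scalerA addrK; symmetry; exact: (linZ (mrep_lin _)).
- exact: Dt_app.
- exact/mM_bounded/mM_jdiag.
- by move=> p x; rewrite jproj_diag.
Qed.

Definition nneg t i j : bool := 0 <= jeig t i j.

Lemma nonneg_proj_path t : nonneg_proj (Dt t) = J (fun i j => (nneg t i j)%:R).
Proof.
rewrite /nonneg_proj (@fcalc_path t _ 1).
- congr J; apply/funext => i; apply/funext => j; rewrite indicE /nneg.
  by rewrite mem_setE in_itv /= andbT.
- exact: measurable_indic.
- by move=> y; rewrite indicE; case: (_ \in _); rewrite ?normr1 ?normr0.
Qed.

Variable N : nat.
Hypothesis lN : forall i, (absz (l i) <= N)%N.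

(** [t * l i] has modulus at most [N], so no eigenvalue with [j] outside the window changes sign
    along the path; this makes the index computations finite sums. *)
Let nneg_far t i j : 0 <= t <= 1 -> (N < absz j)%N -> nneg t i j = (0 <= j).
Proof.
move=> /andP[t0 t1] Nj; rewrite /nneg /jeig.
have hl : `|(l i)%:~R : R| <= N%:R.
  by rewrite -intr_norm (_ : N%:R = (N%:Z)%:~R)// ler_int -abszE lez_nat.
have : `|t * (l i)%:~R| <= N%:R.
  by rewrite normrM ger0_norm//; have := normr_ge0 ((l i)%:~R : R); nra.
rewrite ler_norml => /andP[h1 h2]; apply/idP/idP => h.
  rewrite leNgt; apply/negP => j0.
  have : (j%:~R : R) <= (- N.+1%:Z)%:~R by rewrite ler_int; lia.
  by rewrite rmorphN /= -pmulrn -natr1; lra.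
have : (N.+1%:Z)%:~R <= (j%:~R : R) by rewrite ler_int; lia.
by rewrite -pmulrn -natr1; lra.
Qed.

Let count t i : R := \sum_(j < N.*2.+1) (nneg t i (j%:Z - N%:Z))%:R.

Let hattau_corner (e : 'I_m -> int -> bool) :
  (forall i j, (N < absz j)%N -> e i j = false) ->
  hattau (J (fun i j => (e i j)%:R)) =
  (\sum_i weight i * \sum_(j < N.*2.+1) (e i (j%:Z - N%:Z))%:R)%:E.
Proof.
move=> he; rewrite hattau_jdiag//; last exact: jdiag_bool.
rewrite -sumEFin; apply: eq_bigr => i _; rewrite (@esum_int_fin _ _ N)// => j Nj.
by rewrite he.
Qed.

Let breuer t t' (P := fun t => J (fun i j => (nneg t i j)%:R)) :
  0 <= t <= 1 -> 0 <= t' <= 1 -> breuer_fredholm mM hattau (P t) (P t') /\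
  breuer_index hattau (P t) (P t') = \sum_i weight i * (count t' i - count t i).
Proof.
move=> ht ht'; have b s : bounded_fam (fun i j => (nneg s i j)%:R) by exact: jdiag_bool.
have be := jdiag_bool (fun i j => nneg t i j && nneg t' i j).
have far1 i j : (N < absz j)%N -> nneg t' i j && ~~ nneg t i j = false.
  by move=> Nj; rewrite !nneg_far// andbN.
have far2 i j : (N < absz j)%N -> nneg t i j && ~~ nneg t' i j = false.
  by move=> Nj; rewrite !nneg_far// andbN.
have eE : J (fun i j => (nneg t i j && nneg t' i j)%:R) = P t \o P t'.
  rewrite jdiag_comp//; congr J; apply/funext => i; apply/funext => j.
  by rewrite -natrM mulnb.
split; last first.
  rewrite /breuer_index !corner_kernel_jdiag !hattau_corner// /fine -sumrB.
  apply: eq_bigr => i _; rewrite -mulrBr -!sumrB; congr (_ * _); apply: eq_bigr => j _.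
  by case: (nneg t _ _); case: (nneg t' _ _); rewrite /= ?subr0 ?subrr ?sub0r.
split.
- by rewrite corner_kernel_jdiag hattau_corner// ltry.
- by rewrite corner_kernel_jdiag hattau_corner// ltry.
exists (J (fun i j => (nneg t i j && nneg t' i j)%:R)); split.
- exact: mM_jdiag.
- by apply: jdiag_projection => // i j; case: (_ && _); rewrite ?mulr1 ?mulr0.
- rewrite jdiag_comp//; congr J; apply/funext => i; apply/funext => j.
  by rewrite -natrM mulnb andbA andbb.
- rewrite jdiag_sub//.
  have -> : (fun i j => (nneg t i j)%:R - (nneg t i j && nneg t' i j)%:R) =
      (fun i j => (nneg t i j && ~~ nneg t' i j)%:R : R).
    apply/funext => i; apply/funext => j.
    by case: (nneg t _ _); case: (nneg t' _ _); rewrite /= ?subr0 ?subrr.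
  by rewrite hattau_corner// ltry.
(* The two projections commute, so their product is [E] itself and [y = x] serves. *)
- by move=> x; exists x; rewrite eE.
Qed.

Let sum_geq (M a : nat) : (\sum_(j < M) (a <= j)%N = M - a)%N.
Proof.
elim: M => [|M IH]; first by rewrite big_ord0 sub0n.
by rewrite big_ord_recr/= IH; case: leqP => h; lia.
Qed.

Let count_diff i : count 1 i - count 0 i = (l i)%:~R.
Proof.
(* At both ends of the path the eigenvalues are the integers j + c, with c = 0 and c = [l i]; in the
   window, N + 1 + c of them are nonnegative. *)
have h t (c : int) : (forall j, nneg t i j = (0 <= j + c)) -> (absz c <= N)%N ->
    count t i = (N.+1%:Z + c)%:~R.
  move=> hc cN; transitivity ((\sum_(j < N.*2.+1) (absz (N%:Z - c)%R <= j))%N%:R : R).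
    by rewrite natr_sum; apply: eq_bigr => j _; rewrite hc; congr (_ %:R); lia.
  by rewrite sum_geq pmulrn; congr (_%:~R); lia.
rewrite (h 1 (l i)) ?(h 0 0)//.
- by rewrite -intrB; congr (_%:~R); lia.
- by move=> j; rewrite /nneg /jeig mul0r !addr0 ler0z.
- by move=> j; rewrite /nneg /jeig mul1r -intrD ler0z.
Qed.

Let fine_partition (d : R) : 0 < d -> exists s, itv_partition 0 1 s /\ mesh_lt 0 s d.
Proof.
move=> d0; pose M := Num.truncn d^-1.
pose s : seq R := [seq i.+1%:R / M.+1%:R | i <- iota 0 M.+1].
have ss : size s = M.+1 by rewrite size_map size_iota.
have ns i : (i <= M.+1)%N -> nth 0 (0 :: s) i = i%:R / M.+1%:R.
  case: i => [|i] iM /=; first by rewrite mul0r.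
  by rewrite (nth_map 0%N) ?size_iota// nth_iota.
have M0 : 0 < M.+1%:R :> R by rewrite ltr0n.
have dM : M.+1%:R^-1 < d by rewrite invf_plt ?posrE// truncnS_gt.
have step i : (i < size s)%N -> nth 0 (0 :: s) i.+1 - nth 0 (0 :: s) i = M.+1%:R^-1.
  by rewrite ss => iM; rewrite !ns// 1?ltnW// -mulrBl -(natr1 i) addrAC subrr add0r mul1r.
exists s; split; last by move=> i /step ->.
split; last first.
  rewrite -[last 0 s]/(last 0 (0 :: s)) -nth_last -[(size _).-1]/(size s) ss ns//.
  by rewrite divff// gt_eqF.
apply/(pathP 0) => i /step h; rewrite -subr_gt0 -[nth 0 s i]/(nth 0 (0 :: s) i.+1) h.
by rewrite invr_gt0.
Qed.

(** Each index is a difference of values of [count], so the sum telescopes for every partition and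
    any mesh bound serves. Uniqueness of the chosen value requires that partitions of arbitrarily
    small mesh exist. *)
Lemma spectral_flow_path :
  spectral_flow mM hattau Dt = \sum_i weight i * (l i)%:~R.
Proof.
have key s : itv_partition 0 1 s ->
    let P i := nonneg_proj (Dt (nth 0 (0 :: s) i)) in
    (forall i, (i < size s)%N -> breuer_fredholm mM hattau (P i) (P i.+1)) /\
    \sum_(i < size s) breuer_index hattau (P i) (P i.+1) = \sum_i weight i * (l i)%:~R.
  move=> hs P; have b i : (i <= size s)%N -> 0 <= nth 0 (0 :: s) i <= 1.
    move=> iS; rewrite (set_nth_default 1)//.
    by apply/andP; split; [exact: itv_partition_nth_ge|exact: itv_partition_nth_le].
  split=> [i iS|].
    rewrite /P !nonneg_proj_path; apply: (breuer _ _).1; apply: b => //.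
    exact: ltnW.
  have e i : (i < size s)%N -> breuer_index hattau (P i) (P i.+1) =
      \sum_j weight j * (count (nth 0 (0 :: s) i.+1) j - count (nth 0 (0 :: s) i) j).
    by move=> iS; rewrite /P !nonneg_proj_path; apply: (breuer _ _).2; apply: b => //; exact: ltnW.
  rewrite (eq_bigr _ (fun (i : 'I_(size s)) _ => e i (ltn_ord i))) exchange_big.
  apply: eq_bigr => j _; rewrite -mulr_sumr; congr (_ * _).
  rewrite -(big_mkord xpredT (fun i => count (nth 0 (0 :: s) i.+1) j - count (nth 0 (0 :: s) i) j)).
  rewrite telescope_sumr// (itv_partition_nth_size _ hs) /=.
  exact: count_diff.
apply: xget_unique => [|v [d d0 hd]]; first exists 1 => // s hs _.
  by have [h1 h2] := key s hs; split; [exact: h1|rewrite h2].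
have [s [hs ms]] := fine_partition d0.
have [_ ->] := hd s hs ms; exact: (key s hs).2.
Qed.

End joint.

(** * Logarithmic means of nonincreasing functions *)

Section log_mean.
Context {R : realType}.
Local Notation leb := (@lebesgue_measure R).
Implicit Types (s t x y : R).

Lemma brk1_sqr x : brk 1 x ^+ 2 * (1 + x ^+ 2) = 1.
Proof.
have p : 0 < 1 + x ^+ 2 by have := sqr_ge0 x; lra.
have e := lnK p; rewrite brkE expr2 -[X in _ * X]e -!expRD.
rewrite -[RHS]expR0; congr expR; set l := ln _; by field.
Qed.

Lemma brk_0 s : brk s 0 = 1.
Proof. by rewrite /brk expr0n addr0 powR1. Qed.

(* The last term is integrable over [0, +oo[, so that it does not contribute to the
   logarithmic mean in the limit. *)
Let upper (m : nat) x : m%:R <= x < m.+1%:R ->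
  brk 1 m%:R <= (1 + x)^-1 + 8 * (1 + x)^-2.
Proof.
move=> /andP[mx xm]; have w1 := @brk_le1 R 1 m%:R ler01; have w0 := brk_gt0 1 (m%:R : R).
have := brk1_sqr (m%:R : R); move: (brk _ _) w1 w0 => w w1 w0 w2.
have m0 : 0 <= m%:R :> R by [].
rewrite -natr1 in xm; have y0 : 0 < 1 + x by lra.
have -> : (1 + x)^-1 + 8 * (1 + x)^-2 = (1 + x + 8) / (1 + x) ^+ 2 by field; lra.
rewrite ler_pdivlMr ?exprn_gt0//; have [m1|m1] := leP 1%N m; last first.
  have e : m%:R = 0 :> R by move: m1; case: (m).
  by rewrite e in mx xm; nra.
have m1' : 1 <= m%:R :> R by rewrite ler1n.
have wm : w * m%:R <= 1 by move: w2; nra.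
have : (1 + x) ^+ 2 <= m%:R * (1 + x + 8).
  by have [h|h] := leP x 2; nra.
by nra.
Qed.

(** Since m <= x, the number 1 + (m + 1)^2 is at most (2 + x)^2. *)
Let lower (m : nat) x : m%:R <= x < m.+1%:R -> (2 + x)^-1 <= brk 1 m.+1%:R.
Proof.
move=> /andP[mx xm]; have w0 := brk_gt0 1 (m.+1%:R : R).
have := brk1_sqr (m.+1%:R : R); move: (brk _ _) w0 => w w0 w2.
have m0 : 0 <= m%:R :> R by [].
rewrite -natr1 in xm w2; have y0 : 0 < 2 + x by lra.
rewrite -div1r ler_pdivrMr//.
have h : 1 + (m%:R + 1) ^+ 2 <= (2 + x) ^+ 2 by nra.
have : w ^+ 2 * (1 + (m%:R + 1) ^+ 2) <= (w * (2 + x)) ^+ 2.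
  by rewrite exprMn; apply: ler_wpM2l h; exact: sqr_ge0.
rewrite w2.
have : 0 < w * (2 + x) by rewrite mulr_gt0.
by nra.
Qed.

Section ftc.
(** The derivatives are required on an open half-line containing [0, +oo[, so that they are
    two-sided at the endpoint 0. *)
Variables (F f f' : R -> R) (c : R).
Hypothesis c0 : c < 0.
Hypothesis dF : forall x, c < x -> is_derive x 1 F (f x).
Hypothesis df : forall x, c < x -> is_derive x 1 f (f' x).

Let cont (g g' : R -> R) x : is_derive x 1 g (g' x) -> {for x, continuous g}.
Proof. by move=> [dg _]; apply/differentiable_continuous/derivable1_diffP. Qed.

Let cf t : {within `[0, t], continuous f}.
Proof.
apply: continuous_in_subspaceT => x; rewrite inE /= in_itv /= => /andP[x0 _].
by apply: cont (df _); exact: lt_le_trans x0.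
Qed.

Lemma ftc_integrable t : leb.-integrable `[0, t] (EFin \o f).
Proof.
by apply: continuous_compact_integrable; [exact: segment_compact|exact: cf].
Qed.

Lemma ftc_Rintegral t : 0 < t -> \int[leb]_(s in `[0, t]) f s = F t - F 0.
Proof.
move=> t0; rewrite /Rintegral (@continuous_FTC2 _ f F)//.
- split.
  + move=> x; rewrite in_itv /= => /andP[x0 _].
    by case: (dF (lt_trans c0 x0)).
  + by apply: cvg_at_right_filter; apply: (@cont _ f); exact: dF.
  + by apply: cvg_at_left_filter; apply: (@cont _ f); apply/dF/(lt_trans c0).
- move=> x; rewrite in_itv /= => /andP[x0 _].
  by rewrite derive1E (@derive_val _ _ _ _ _ _ _ (dF (lt_trans c0 x0))).
Qed.

End ftc.

Let lin_der a b x : is_derive x 1 (fun x => a + b * x) b.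
Proof.
have := is_deriveD (is_derive_cst a x 1) (is_deriveZ b (is_derive_id x (1 : R))).
by rewrite add0r /GRing.scale /= mulr1.
Qed.

Let ln_der a b x : 0 < a + b * x ->
  is_derive x 1 (fun x => ln (a + b * x)) (b * (a + b * x)^-1).
Proof.
by move=> p; rewrite mulrC;
  exact: (@is_derive1_comp _ (@ln R) (fun x => a + b * x) _ _ _
    (is_derive1_ln p) (lin_der a b x)).
Qed.

Let inv_der a b x : 0 < a + b * x ->
  is_derive x 1 (fun x => (a + b * x)^-1) (- b * (a + b * x)^-2).
Proof.
move=> p; have p' : a + b * x != 0 by rewrite gt_eqF.
have := @is_deriveV _ (fun x => a + b * x) x b 1 p' (lin_der a b x).
by rewrite /GRing.scale /= mulNr mulrC mulNr.
Qed.

Section nonincreasing.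
Variable mu : R -> R.
Hypothesis mu_ge0 : forall s, 0 <= mu s.
Hypothesis mu_mono : forall s t, 0 <= s -> s <= t -> mu t <= mu s.

Definition lmean t : R := (ln (1 + t))^-1 * \int[leb]_(s in `[0, t]) mu s.

Lemma mu_integrable t : leb.-integrable `[0, t] (EFin \o mu).
Proof.
apply: measurable_bounded_integrable => //.
- rewrite [X in (X < _)%E](lebesgue_measure_itv `[0, t]) /=.
  by case: ifP => _; rewrite ?ltry// -EFinB ltry.
(* Monotonicity of [mu] is known on [0, +oo[; cutting the argument at 0 makes the function monotone
   on the whole line. *)
- apply: (@eq_measurable_fun _ _ _ _ _ (fun s => mu (Num.max s 0))).
    move=> s; rewrite inE /= in_itv /= => /andP[s0 _].
    by rewrite max_l.
  apply: nonincreasing_measurable => // s s' ss'; apply: mu_mono.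
    by rewrite le_max lexx orbT.
  by rewrite ge_max !le_max ss' lexx !orbT.
- exists (mu 0); split; first exact: num_real.
  move=> M hM s /=; rewrite in_itv /= => /andP[s0 _].
  by rewrite ger0_norm// ltW// (le_lt_trans _ hM)// mu_mono.
Qed.

Let I t := \int[leb]_(s in `[0, t]) mu s.

Let I_ge0 t : 0 <= I t.
Proof. by apply: Rintegral_ge0 => s _. Qed.

Let I_mono t t' : t <= t' -> I t <= I t'.
Proof.
move=> tt'; have fin t0 : (\int[leb]_(s in `[0%R, t0]) (mu s)%:E)%E \is a fin_num.
  by apply: integrable_fin_num => //; exact: mu_integrable.
apply: fine_le; [exact: fin|exact: fin|].
apply: ge0_subset_integral => //.
- by case/integrableP: (mu_integrable t').
- by move=> s _ /=; rewrite lee_fin.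
- by move=> s /=; rewrite !in_itv /= => /andP[-> /le_trans]; exact.
Qed.

Lemma measurable_lmean : measurable_fun (`]0, +oo[ : set R) lmean.
Proof.
apply: (@eq_measurable_fun _ _ _ _ _ (fun t => (ln (1 + t)) `^ (-1) * I t)).
  move=> t; rewrite inE /= in_itv /= andbT => t0.
  by rewrite /lmean powR_inv1// ln_ge0//; lra.
apply: measurable_funM; last by apply: nondecreasing_measurable => //; exact: I_mono.
apply: (measurableT_comp (measurable_powR _)).
apply: (measurableT_comp (@measurable_ln R)).
exact: measurable_funD.
Qed.

Let ln_gt0 t : 0 < t -> 0 < ln (1 + t).
Proof. by move=> t0; apply: exp.ln_gt0; lra. Qed.

Lemma lmean_ge0 t : 0 < t -> 0 <= lmean t.
Proof. by move=> t0; rewrite /lmean mulr_ge0// ?I_ge0// invr_ge0 ltW// ln_gt0. Qed.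

Let le_ln (a b t : R) : 0 < a -> 0 <= b -> 0 < t ->
  ln (a + b * t) <= ln (1 + t) + ln (a + b).
Proof.
move=> a0 b0 t0; rewrite -lnM ?posrE; [|lra|lra].
by rewrite ler_ln ?posrE; nra.
Qed.

(** The hypothesis bounds [mu s] by a step function of s / (2 be). [upper] replaces it by a function
    with an explicit primitive, whose leading term is 2 be times a logarithm; the remaining terms
    are bounded and become [K] after division by the logarithm. *)
Lemma lmean_upper (be C : R) : 0 < be -> 0 <= C ->
  (forall (m : nat) s, 0 <= s -> 2 * m%:R * be <= s -> mu s <= C * brk 1 m%:R) ->
  exists K, forall t, 0 < t -> lmean t <= 2 * be * C + K / ln (1 + t).
Proof.
move=> be0 C0 hmu; pose b := (2 * be)^-1; have b0 : 0 < b by rewrite invr_gt0; lra.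
have beb : 2 * be * b = 1 by rewrite divff// gt_eqF//; lra.
pose F x := 2 * be * ln (1 + b * x) - 16 * be * (1 + b * x)^-1.
pose f x := (1 + b * x)^-1 + 8 * (1 + b * x)^-2.
pose f' x := - b * (1 + b * x)^-2 - 16 * b * (1 + b * x)^-3.
have c0 : - (2 * be) < 0 by lra.
have cb x : - (2 * be) < x -> 0 < 1 + b * x.
  move=> h; have : b * - (2 * be) < b * x by rewrite ltr_pM2l.
  by lra.
have dF x : - (2 * be) < x -> is_derive x 1 F (f x).
  move=> /cb p; have h := is_deriveB (is_deriveZ (2 * be) (ln_der p))
    (is_deriveZ (16 * be) (inv_der p)).
  apply: (is_derive_eq h); rewrite /GRing.scale /= /f.
  move: (1 + b * x) p => y p; have y0 : y != 0 by rewrite gt_eqF.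
  transitivity ((2 * be * b) * y^-1 + 8 * (2 * be * b) * y^-2); first by ring.
  by rewrite beb; ring.
have df x : - (2 * be) < x -> is_derive x 1 f (f' x).
  move=> /cb p; have h := inv_der p.
  have hh := is_deriveD h (is_deriveZ 8 (is_deriveM h h)).
  have -> : f = (fun y => (1 + b * y)^-1) +
      (8 \*: ((fun y => (1 + b * y)^-1) * (fun y => (1 + b * y)^-1))).
    by apply/funext => y; rewrite /f expr2 invfM.
  apply: (is_derive_eq hh); rewrite /GRing.scale /= /f'.
  by field; rewrite gt_eqF.
exists (C * (2 * be * ln (1 + b) + 16 * be)) => t t0.
rewrite /lmean mulrC ler_pdivrMr ?ln_gt0// mulrDl divfK ?gt_eqF ?ln_gt0//.
have fi := ftc_integrable c0 df t.
apply: (@le_trans _ _ (C * (F t - F 0))).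
  rewrite -(ftc_Rintegral c0 dF df t0) -RintegralZl//.
  apply: le_Rintegral => //; first exact: mu_integrable.
    by have := @integrableZl _ _ _ leb _ (measurable_itv `[0, t]) C _ fi.
  move=> s /=; rewrite in_itv /= => /andP[s0 _].
  have bs : 0 <= b * s by rewrite mulr_ge0// ltW.
  have hm := truncn_itv bs; have [hm1 hm2] := andP hm.
  apply: le_trans (hmu (Num.truncn (b * s)) s s0 _) _.
    have : 2 * be * (Num.truncn (b * s))%:R <= 2 * be * (b * s) by rewrite ler_pM2l//; lra.
    by rewrite (mulrA (2 * be)) beb; lra.
  by rewrite ler_wpM2l// upper.
have := le_ln ltr01 (ltW b0) t0; rewrite /F mulr0 addr0 ln1 invr1.
have : 0 < (1 + b * t)^-1 by rewrite invr_gt0; nra.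
set z := _^-1; set l1 := ln _; set l2 := ln _; set l3 := ln _ => z0 hl.
apply: (@le_trans _ _ (C * (2 * be * (l2 + l3) + 16 * be))); last by lra.
by rewrite ler_wpM2l//; nra.
Qed.

Lemma lmean_lower (be : R) : 0 < be ->
  (forall (m : nat) s, 0 <= s -> s < 2 * m%:R * be -> brk 1 m%:R <= mu s) ->
  exists K, forall t, 0 < t -> 2 * be + K / ln (1 + t) <= lmean t.
Proof.
move=> be0 hmu; pose b := (2 * be)^-1; have b0 : 0 < b by rewrite invr_gt0; lra.
have beb : 2 * be * b = 1 by rewrite divff// gt_eqF//; lra.
pose F x := 2 * be * ln (2 + b * x).
pose f x := (2 + b * x)^-1.
have c0 : - (2 * be) < 0 by lra.
have cb x : - (2 * be) < x -> 0 < 2 + b * x.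
  move=> h; have : b * - (2 * be) < b * x by rewrite ltr_pM2l.
  by lra.
have dF x : - (2 * be) < x -> is_derive x 1 F (f x).
  move=> /cb p; have h := is_deriveZ (2 * be) (ln_der p).
  by apply: (is_derive_eq h); rewrite /GRing.scale /= /f mulrA beb mul1r.
have df x : - (2 * be) < x -> is_derive x 1 f (- b * (2 + b * x)^-2).
  by move=> /cb p; exact: inv_der p.
exists (- (2 * be) * (ln (1 + (2 * be)) + ln 2)) => t t0.
rewrite /lmean [leRHS]mulrC ler_pdivlMr ?ln_gt0// mulrDl divfK ?gt_eqF ?ln_gt0//.
have fi := ftc_integrable c0 df t.
apply: (@le_trans _ _ (F t - F 0)); last first.
  rewrite -(ftc_Rintegral c0 dF df t0).
  apply: le_Rintegral => //; first exact: mu_integrable.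
  move=> s /=; rewrite in_itv /= => /andP[s0 _].
  have bs : 0 <= b * s by rewrite mulr_ge0// ltW.
  have hm := truncn_itv bs; have [hm1 hm2] := andP hm.
  apply: le_trans (lower hm) _; apply: hmu => //.
  have : 2 * be * (b * s) < 2 * be * (Num.truncn (b * s)).+1%:R by rewrite ltr_pM2l//; lra.
  by rewrite (mulrA (2 * be)) beb; lra.
rewrite /F mulr0 addr0.
have : ln (1 + t) <= ln (2 + b * t) + ln (1 + 2 * be).
  rewrite -lnM ?posrE; [|nra|nra].
  by rewrite ler_ln ?posrE; nra.
by set l1 := ln _; set l2 := ln _; set l3 := ln _; set l4 := ln _; nra.
Qed.

(** For t >= 1 this is [lmean_upper]. Near 0 the error term there blows up, and [mu <= C] together
    with ln (1 + t) >= t / 2 is used instead. *)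
Lemma lmean_bounded (be C : R) : 0 < be -> 0 <= C ->
  (forall (m : nat) s, 0 <= s -> 2 * m%:R * be <= s -> mu s <= C * brk 1 m%:R) ->
  exists M, forall t, 0 < t -> lmean t <= M.
Proof.
move=> be0 C0 hmu; have [K hK] := lmean_upper be0 C0 hmu.
have l2 : 0 < ln (2 : R) by apply: exp.ln_gt0; lra.
exists (2 * be * C + `|K| / ln 2 + 2 * C) => t t0.
have [t1|t1] := leP 1 t.
  apply: le_trans (hK t t0) _; rewrite -addrA lerD2l.
  apply: (@le_trans _ _ (`|K| / ln 2)); last by rewrite lerDl; lra.
  apply: (@le_trans _ _ (`|K| / ln (1 + t))).
    by rewrite ler_pM2r ?invr_gt0 ?ln_gt0// ler_norm.
  rewrite ler_wpM2l// lef_pV2 ?posrE ?ln_gt0// ler_ln ?posrE; lra.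
apply: (@le_trans _ _ (2 * C)); last first.
  by rewrite lerDr addr_ge0// ?divr_ge0// ?(ltW l2)// mulr_ge0//; lra.
rewrite /lmean mulrC ler_pdivrMr ?ln_gt0//.
have lt : t / 2 <= ln (1 + t).
  have -> : ln (1 + t) = - ln ((1 + t)^-1) by rewrite lnV ?opprK// posrE; lra.
  have e : (1 + t)^-1 = 1 + - (t / (1 + t)) by field; lra.
  have h1 : t / 2 <= t / (1 + t) by rewrite ler_wpM2l ?(ltW t0)// lef_pV2 ?posrE; lra.
  have h2 : t / (1 + t) < 1 by rewrite ltr_pdivrMr; lra.
  have h3 : -1 < - (t / (1 + t)) by lra.
  by have := le_ln1Dx h3; rewrite -e; lra.
apply: (@le_trans _ _ (C * t)); last by nra.
have mu0 s : 0 <= s -> mu s <= C.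
  move=> s0; have := hmu 0%N s s0; rewrite mulr0 mul0r brk_0 mulr1; exact.
have -> : C * t = \int[leb]_(s in `[0, t]) C.
  rewrite Rintegral_cst//; congr (_ * _).
  by rewrite [X in fine X](lebesgue_measure_itv `[0, t]) /= lte_fin t0 oppr0 adde0.
apply: le_Rintegral => //; first exact: mu_integrable.
  apply: measurable_bounded_integrable => //.
    rewrite [X in (X < _)%E](lebesgue_measure_itv `[0, t]) /=.
    by case: ifP => _; rewrite ?ltry// -EFinB ltry.
  exists C; split; first exact: num_real.
  by move=> M CM s _ /=; rewrite ger0_norm// ltW.
by move=> s /=; rewrite in_itv /= => /andP[s0 _]; exact: mu0.
Qed.

End nonincreasing.

Lemma cvg_div_ln (A K : R) : A + K / ln (1 + t) @[t --> +oo] --> A.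
Proof.
apply/cvgrPdist_le => e e0; near=> t.
have t0 : expR ((`|K| + 1) / e) < t by near: t; apply: nbhs_pinfty_gt; exact: num_real.
have h : (`|K| + 1) / e <= ln (1 + t).
  rewrite -ler_expR lnK ?posrE; have := expR_gt0 ((`|K| + 1) / e); lra.
have p : 0 < (`|K| + 1) / e by rewrite divr_gt0//; have := normr_ge0 K; lra.
have l0 : 0 < ln (1 + t) by lra.
rewrite opprD addrA subrr add0r normrN normrM normfV (gtr0_norm l0) ler_pdivrMr//.
have : `|K| + 1 <= e * ln (1 + t) by rewrite mulrC -ler_pdivrMr.
by lra.
Unshelve. all: by end_near.
Qed.

End log_mean.

(** * Singular values and Dixmier traces *)

Section singular_values.
Context {R : realType} {V : innerType R}.
Implicit Types (T E : V -> V) (N : set (V -> V)) (s t c : R).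

Let nonneg_inf (A : set R) : (forall x, A x -> 0 <= x) -> 0 <= inf A.
Proof.
move=> h; have [->|A0] := eqVneq A set0; first by rewrite inf0.
by apply: lb_le_inf => [|x Ax]; [exact/set0P|exact: h].
Qed.

Lemma opnorm_ge0 T : 0 <= opnorm T.
Proof. by apply: nonneg_inf => c []. Qed.

Lemma opnorm_le T c : 0 <= c -> (forall x, vnorm (T x) <= c * vnorm x) -> opnorm T <= c.
Proof. by move=> c0 h; apply: inf_lbound => //; exists 0 => d []. Qed.

Lemma opnorm_ge T c x : bounded_op T -> 0 < vnorm x -> c * vnorm x <= vnorm (T x) ->
  c <= opnorm T.
Proof.
move=> bT x0 h; apply: lb_le_inf => [|d [d0 hd]].
  by have [M M0 hM] := bounded_ge0 bT; exists M.
by rewrite -(ler_pM2r x0) (le_trans h).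
Qed.

Variables (N : set (V -> V)) (phi : (V -> V) -> \bar R).
Local Notation sv := (sing_value N phi).

Lemma sing_value_ge0 T s : 0 <= sv T s.
Proof. by apply: nonneg_inf => c [E [_ _ _ ->]]; exact: opnorm_ge0. Qed.

Lemma sing_value_le T E s c : N E -> projection E -> (phi (id - E)%R <= s%:E)%E ->
  0 <= c -> (forall x, vnorm (T (E x)) <= c * vnorm x) -> sv T s <= c.
Proof.
move=> NE pE hE c0 h; apply: le_trans (opnorm_le c0 h).
apply: inf_lbound; last by exists E.
by exists 0 => d [E' [_ _ _ ->]]; exact: opnorm_ge0.
Qed.

Hypothesis N_id : N id.
Hypothesis phi_0 : phi 0 = 0%E.

Let idB : (id - id : V -> V) = 0. Proof. exact: subrr. Qed.

Lemma sing_value_ge T s c : 0 <= s ->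
  (forall E, N E -> projection E -> (phi (id - E)%R <= s%:E)%E -> c <= opnorm (T \o E)) ->
  c <= sv T s.
Proof.
move=> s0 h; apply: lb_le_inf => [|d [E [NE pE hE ->]]]; last exact: h.
exists (opnorm (T \o id)), id; split=> //; first exact: proj_id.
by rewrite idB phi_0 lee_fin.
Qed.

Lemma sing_value_mono T s t : 0 <= s -> s <= t -> sv T t <= sv T s.
Proof.
move=> s0 st; apply: sing_value_ge => // E NE pE hE; apply: inf_lbound.
  by exists 0 => d [E' [_ _ _ ->]]; exact: opnorm_ge0.
by exists E; split=> //; apply: le_trans hE _; rewrite lee_fin.
Qed.

End singular_values.

(** * States that extend the limit at infinity *)

Section states.
Context {R : realType}.
Variable omega : (R -> R) -> R.
Hypothesis omegaD : forall f g, Linfty f -> Linfty g -> omega (f + g) = omega f + omega g.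
Hypothesis omegaZ : forall (c : R) f, Linfty f -> omega (fun t => c * f t) = c * omega f.
Hypothesis omega_pos : forall f, Linfty f ->
  {ae lebesgue_measure, forall t : R, 0 < t -> 0 <= f t} -> 0 <= omega f.
Hypothesis omega_lim : forall f (l : R), Linfty f -> f t @[t --> +oo] --> l -> omega f = l.

Let Linfty_bounded (f : R -> R) (M : R) : measurable_fun (`]0, +oo[ : set R) f ->
  (forall t, 0 < t -> `|f t| <= M) -> Linfty f.
Proof. by move=> mf hM; split=> //; exists M; exact: aeW. Qed.

(** The bound [A + K / ln (1 + t)] can be unbounded near 0 and is then outside [Linfty]. It is
    replaced by a function that equals [A + e] far out and is a larger constant before, whose value
    under [omega] is its limit. *)
Lemma state_le (f : R -> R) (M A K : R) : measurable_fun (`]0, +oo[ : set R) f ->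
  (forall t, 0 < t -> `|f t| <= M) ->
  (forall t, 0 < t -> f t <= A + K / ln (1 + t)) -> omega f <= A.
Proof.
move=> mf hM hA; apply/ler_addgt0Pr => e e0.
have [T0 [_ hT]] : \forall t \near +oo, A + K / ln (1 + t) <= A + e.
  have /cvgrPdist_le/(_ e e0) := @cvg_div_ln R A K.
  apply: filterS => t; rewrite ler_norml => /andP[h _]; lra.
(* Chosen so that [A + e + B] dominates the bound [M] of [f]. *)
pose B := `|M| + `|A + e|; have B0 : 0 <= B by rewrite addr_ge0.
pose g t := A + e + B * \1_(`]-oo, T0] : set R) t.
have mg : measurable_fun (`]0, +oo[ : set R) g.
  apply: measurable_funTS; apply: measurable_funD => //.
  by apply: measurable_funM => //; exact: measurable_indic.
have gE t : g t = if t <= T0 then A + e + B else A + e.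
  rewrite /g indicE mem_setE in_itv /=.
  by case: ifP; rewrite ?mulr1 ?mulr0 ?addr0.
have gb t : 0 < t -> `|g t| <= `|A + e| + B.
  move=> _; rewrite gE; case: ifP => _; last by rewrite lerDl.
  by apply: le_trans (ler_normD _ _) _; rewrite (ger0_norm B0).
have Lf := Linfty_bounded mf hM; have Lg := Linfty_bounded mg gb.
have LN : Linfty (fun t => -1 * f t).
  apply: (@Linfty_bounded _ M); first exact: measurable_funM.
  by move=> t t0; rewrite mulN1r normrN hM.
have og : omega g = A + e.
  apply: omega_lim => //; apply: cvg_near_cst.
  exists T0; split; first exact: num_real.
  by move=> t tT; rewrite gE leNgt tT.
have : 0 <= omega (g + (fun t => -1 * f t)).
  apply: omega_pos.
    apply: (@Linfty_bounded _ (`|A + e| + B + M)); first exact: measurable_funD mg LN.1.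
    move=> t t0; apply: le_trans (ler_normD _ _) _.
    by rewrite lerD ?gb// mulN1r normrN hM.
  apply: aeW => t t0; rewrite addfE mulN1r subr_ge0 gE.
  case: (leP t T0) => [_|/hT]; last exact: le_trans (hA t t0).
  apply: le_trans (ler_norm _) _; apply: le_trans (hM t t0) _; rewrite /B.
  by have := ler_norm M; have := ler_norm (- (A + e)); rewrite normrN; lra.
by rewrite omegaD// omegaZ// og mulN1r subr_ge0.
Qed.

Lemma state_ge (f : R -> R) (M A K : R) : measurable_fun (`]0, +oo[ : set R) f ->
  (forall t, 0 < t -> `|f t| <= M) ->
  (forall t, 0 < t -> A + K / ln (1 + t) <= f t) -> A <= omega f.
Proof.
move=> mf hM hA; rewrite -lerN2 -mulN1r -omegaZ; last exact: Linfty_bounded hM.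
apply: (@state_le _ M (- A) (- K)) => [|t t0|t t0].
- exact: measurable_funM.
- by rewrite mulN1r normrN hM.
- by have := hA t t0; rewrite mulN1r mulNr; lra.
Qed.

End states.

(** By additivity the value at the constant 1 is the sum of the values at the unit vectors, so no
    upper bound can be strict. Natural coefficients match the additivity on positive operators and
    the integer eigenvalues of u[D, u^*]. *)
Lemma additive_extremal (R : numDomainType) (m : nat) (g : ('I_m -> nat) -> R)
    (w : 'I_m -> R) : (forall a b, g (fun i => a i + b i)%N = g a + g b) ->
  (forall i, g (fun j => (j == i) : nat) <= w i) -> \sum_i w i <= g (fun=> 1%N) ->
  forall a, g a = \sum_i (a i)%:R * w i.
Proof.
move=> gD g_le g_ge; pose dl i (j : 'I_m) : nat := j == i.
have g0 : g (fun=> 0%N) = 0.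
  by apply: (@addrI _ (g (fun=> 0%N))); rewrite -gD addr0.
have mul i (p : nat) : g (fun j => p * dl i j)%N = p%:R * g (dl i).
  elim: p => [|p IH]; first by rewrite mul0r -[RHS]g0.
  by rewrite -natr1 mulrDl mul1r -IH -gD; congr g; apply/funext => j; rewrite mulSnr.
have h (a : 'I_m -> nat) (r : seq 'I_m) :
    g (fun j => \sum_(i <- r) a i * dl i j)%N = \sum_(i <- r) (a i)%:R * g (dl i).
  elim: r => [|i r IH].
    by rewrite big_nil -[RHS]g0; congr g; apply/funext => j; rewrite big_nil.
  rewrite big_cons -IH -mul -gD; congr g; apply/funext => j.
  by rewrite big_cons.
have g_lin a : g a = \sum_i (a i)%:R * g (dl i).
  rewrite -h; congr g; apply/funext => i; rewrite (bigD1 i)//= big1 => [|j ji].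
    by rewrite /dl eqxx muln1 addn0.
  by rewrite /dl eq_sym (negPf ji) muln0.
move=> a; rewrite g_lin; apply: eq_bigr => i _; congr (_ * _).
have g1 : g (fun=> 1%N) = \sum_i g (dl i).
  by rewrite g_lin; apply: eq_bigr => j _; rewrite mul1r.
have hle : \sum_i g (dl i) <= \sum_i w i by apply: ler_sum => j _; exact: g_le.
have e : \sum_i (w i - g (dl i)) = 0.
  by rewrite sumrB; apply/eqP; rewrite subr_eq0 eq_le hle -g1 g_ge.
have p j : true -> 0 <= w j - g (dl j) by move=> _; rewrite subr_ge0; exact: g_le.
by apply/esym/eqP; rewrite -subr_eq0 (psumr_eq0P p e).
Qed.

(** * Singular values and the Dixmier trace of diagonal operators *)

Section dixmier.
Context {R : realType} {n : nat} {G : cuntz_system R n} {k m : nat}.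
Hypothesis n2 : (2 <= n)%N.
Local Notation O := (cs_O G).
Local Notation H := (cs_H G).
Local Notation Hk := {ffun 'I_k -> H}.
Local Notation mPhik := (@mPhik _ _ G k).
Local Notation mM := (mM G k).
Local Notation hattau := (@hattau _ _ G k).
Local Notation fdg := (@fdg _ _ G k).
Local Notation mdg := (@mdg _ _ G k).
Variable q : 'I_m -> 'M[O]_k.
Hypothesis Mq : forall i, MF (q i).
Hypothesis q_orth : forall i j, q i *m q j = if i == j then q j else 0.
Hypothesis q_star : forall i, mstar (q i) = q i.
Hypothesis q_sum : \sum_i q i = 1%:M.
Local Notation J := (jdiag q).
Local Notation weight := (weight q).
Local Notation sv := (sing_value mM hattau).
Implicit Types (x y : Hk) (c d : 'I_m -> int -> R) (s t : R).

Let rj (j : int) : R := brk 1 j%:~R.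

Let rj_gt0 j : 0 < rj j. Proof. exact: brk_gt0. Qed.

Let rj_le (i j : int) : (absz i <= absz j)%N -> rj j <= rj i.
Proof.
move=> ij; have hi := brk1_sqr (i%:~R : R); have hj := brk1_sqr (j%:~R : R).
have : (i%:~R : R) ^+ 2 <= j%:~R ^+ 2.
  rewrite -(real_normK (num_real (i%:~R : R))) -(real_normK (num_real (j%:~R : R))).
  by rewrite ler_sqr ?nnegrE// -!intr_norm ler_int; lia.
have := rj_gt0 i; have := rj_gt0 j; rewrite /rj.
have w0 := sqr_ge0 (i%:~R : R); move: (brk _ _) (brk _ _) hi hj w0 => u v.
move: (i%:~R ^+ 2) (j%:~R ^+ 2) => w z hi hj w0 v0 u0 wz; rewrite leNgt; apply/negP => uv.
have : u ^+ 2 < v ^+ 2 by nra.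
by nra.
Qed.

Definition decays c (C : R) : Prop := 0 <= C /\ forall i j, 0 <= c i j <= C * rj j.

Lemma decays_bounded c C : decays c C -> bounded_fam c.
Proof.
move=> [C0 h] i; exists C => j; have /andP[c0 cr] := h i j.
by rewrite ger0_norm// (le_trans cr)// ler_piMr// brk_le1.
Qed.

Let window_count (N : nat) :
  (\esum_(j in [set: int]) ((absz j < N)%N%:R : R)%:E <= (2 * N%:R)%:E)%E.
Proof.
case: N => [|N]; first by rewrite esum1// mulr0.
rewrite (@esum_int_fin _ _ N)//; last by move=> j Nj; rewrite ltnNge Nj.
rewrite lee_fin -natrM; apply: (@le_trans _ _ (\sum_(i < N.*2.+1) 1)).
  by apply: ler_sum => i _; rewrite lern1 leq_b1.
by rewrite sumr_const card_ord ler_nat; lia.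
Qed.

Let hattau_window (S : pred 'I_m) (N : nat) :
  (hattau (J (fun i j => (S i && (absz j < N)%N)%:R)) <=
   (2 * N%:R * \sum_(i | S i) weight i)%:E)%E.
Proof.
rewrite hattau_jdiag//; last exact: jdiag_bool.
rewrite mulr_sumr [X in (_ <= X%:E)%E]big_mkcond /= -sumEFin; apply: lee_sum => i _.
have w0 : 0 <= weight i by exact: weight_ge0.
case: ifP => Si; last first.
  by rewrite esum1 ?mule0// => j _; rewrite andFb.
by rewrite mulrC EFinM lee_wpmul2l// window_count.
Qed.

(** The test projection removes the window [|j| < N] in the blocks of [S]. The removed part has
    trace at most 2 N be, and the eigenvalues that remain are at most [C * brk 1 N]. *)
Lemma sing_value_window (S : pred 'I_m) c C (be : R) (N : nat) s : decays c C ->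
  (forall i j, ~~ S i -> c i j = 0) -> \sum_(i | S i) weight i <= be ->
  0 <= s -> 2 * N%:R * be <= s -> sv (J c) s <= C * brk 1 N%:R.
Proof.
move=> dc hS hbe s0 hs; have bc := decays_bounded dc; have [C0 hc] := dc.
pose e i j := S i && (absz j < N)%N.
have be1 := @jdiag_bool R _ (fun i j => ~~ e i j).
have br : 0 <= C * brk 1 N%:R by rewrite mulr_ge0// ltW// brk_gt0.
apply: (@sing_value_le _ _ _ _ _ (J (fun i j => (~~ e i j)%:R))) => //.
- exact: mM_jdiag.
- by apply: jdiag_projection => // i j; case: (~~ _); rewrite ?mulr1 ?mulr0.
- have -> : id - J (fun i j => (~~ e i j)%:R) = J (fun i j => (e i j)%:R).
    rewrite -(jdiag1 Mq q_orth q_star q_sum) jdiag_sub//; last first.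
      by move=> i; exists 1 => j; rewrite normr1.
    congr J; apply/funext => i; apply/funext => j.
    by case: (e i j); rewrite /= ?subr0 ?subrr.
  apply: le_trans (hattau_window S N) _; rewrite lee_fin; apply: le_trans hs.
  by rewrite ler_wpM2l// mulr_ge0.
- move=> x.
  apply: (odec_norm_le (@complete_Hk _ _ G k) (odec_jproj Mq q_orth q_star q_sum)) => // p.
  rewrite !jproj_diag// scalerA -rmorphM vnormZ normcR ler_wpM2r ?vnorm_ge0//.
  case: p => i j /=; rewrite /e; case Si : (S i) => /=; last first.
    by rewrite hS ?Si// mul0r normr0.
  case: ltnP => /= jN; first by rewrite mulr0 normr0.
  have /andP[c0 cr] := hc i j; rewrite mulr1 ger0_norm// (le_trans cr)// ler_wpM2l//.
  exact: (@rj_le N%:Z).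
Qed.

Let jdiag_mdg (c : int -> R) : J (fun _ => c) = mdg c.
Proof. by rewrite /jdiag -fdg_suml q_sum; apply/funext => x; rewrite /fdg /= mrep1. Qed.

(* The spectral projection Q of D for |j| <= N is central in M: if Q E were 0, then
   Q would lie below id - E, contradicting hattau Q > s. *)
Lemma sing_value_lower (N : nat) s : 0 <= s -> s < 2 * N%:R * \sum_i weight i ->
  brk 1 N%:R <= sv (J (fun _ => rj)) s.
Proof.
move=> s0 hs; apply: sing_value_ge => //; [exact: mM_id|exact: hattau_0|].
move=> E ME pE hE; pose e (j : int) : R := (absz j <= N)%N%:R.
have be : bounded_seq e.
  by exists 1 => j; rewrite /e; case: (_ <= _)%N; rewrite ?normr1 ?normr0.
have bef : @bounded_fam R m (fun _ => e) by [].
have br : bounded_seq rj by exists 1 => j; rewrite ger0_norm ?brk_le1// ltW.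
have brf : @bounded_fam R m (fun _ => rj) by [].
pose Q := mdg e; have MQ : mM Q by exact: mM_mdg.
have QJ : Q = J (fun _ => e) by rewrite jdiag_mdg.
have pQ : projection Q.
  rewrite QJ; apply: jdiag_projection => // i j.
  by rewrite /e; case: (_ <= _)%N; rewrite ?mulr1 ?mulr0.
have lE := mM_lin ME; have lQ := mM_lin MQ.
have QE x : Q (E x) = E (Q x).
  apply: (odec_eq (@odec_mPhik _ _ G k)) => j.
  by rewrite mPhik_mdg// -!(mM_comm _ _ ME) mPhik_mdg// (linZ lE).
have [x Qx] : exists x, Q (E x) != 0.
  apply/not_existsP => h; move: hE; apply/negP; rewrite -ltNge.
  have {}h x : Q (E x) = 0 by apply: contrapT => /eqP; exact: h.
  have hQ : (s%:E < hattau Q)%E.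
    rewrite QJ hattau_jdiag//.
    apply: (@lt_le_trans _ _ (\sum_i weight i * (2 * N%:R))%:E).
      by rewrite lte_fin -mulr_suml mulrC.
    rewrite -sumEFin; apply: lee_sum => i _; rewrite EFinM lee_wpmul2l//.
      by rewrite lee_fin; exact: weight_ge0.
    have e0 j : 0 <= e j by [].
    apply: le_trans (esum_int_ge N e0); rewrite lee_fin.
    rewrite (eq_bigr (fun _ => 1)) => [|i' _]; last first.
      by rewrite /e (_ : (_ <= _)%N = true)//; have := ltn_ord i'; lia.
    by rewrite sumr_const card_ord -natrM ler_nat; lia.
  apply: lt_le_trans hQ _; apply: hattau_le => //.
  - by split=> //; exact: proj_pos.
  - by apply: mM_sub => //; exact: mM_id.
  have -> : id - E - Q = id - (E + Q) by rewrite opprD addrA.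
  apply/proj_pos/proj_compl; split.
  + exact/mM_bounded/mM_add.
  + apply/funext => x; rewrite /= !addfE (linD lE) (linD lQ) h -QE h.
    by rewrite !proj_idem// addr0 add0r.
  + by apply: adjoint_add; [case: pE|case: pQ].
(* [Q (E x)] is a nonzero vector in the ranges of both projections: [E] fixes it, and the operator
   acts on it with eigenvalues at least [brk 1 N]. *)
have Ey : E (Q (E x)) = Q (E x) by rewrite -QE proj_idem.
have y0 : 0 < vnorm (Q (E x)).
  rewrite lt_neqAle vnorm_ge0 andbT eq_sym; apply: contraNN Qx => /eqP/vnorm_eq0 ->.
  exact: eqxx.
apply: (opnorm_ge _ y0); first exact/mM_bounded/mM_comp/ME/mM_jdiag.
rewrite /= Ey -ler_pdivlMl ?brk_gt0// jdiag_mdg.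
apply: (odec_norm_le (@complete_Hk _ _ G k) (@odec_mPhik _ _ G k)) => [|j].
  by rewrite invr_ge0 ltW// brk_gt0.
rewrite [X in _ <= _ * vnorm X]mPhik_mdg// vnormZ normcR gtr0_norm// mulrA.
rewrite /Q mPhik_mdg// /e; case: leqP => jN; last first.
  by rewrite mulr0n scale0r vnorm0 mulr0.
rewrite mulr1n scale1r ler_peMl ?vnorm_ge0// mulrC ler_pdivlMr ?brk_gt0// mul1r.
exact: (@rj_le j N%:Z).
Qed.

Hypothesis weight_gt0 : 0 < \sum_i weight i.

Let sv_ge0 c s : 0 <= sv (J c) s.
Proof. exact: sing_value_ge0. Qed.

Let sv_mono c s t : 0 <= s -> s <= t -> sv (J c) t <= sv (J c) s.
Proof. by apply: sing_value_mono; [exact: mM_id|exact: hattau_0]. Qed.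

Let log_mean_bounded c C : decays c C ->
  exists M, forall t, 0 < t -> `|log_mean mM hattau (J c) t| <= M.
Proof.
move=> dc; have [C0 _] := dc.
have [|M hM] := lmean_bounded (@sv_ge0 c) (@sv_mono c) weight_gt0 C0.
  by move=> N s s0; apply: (sing_value_window (S := predT) dc) => //.
by exists M => t t0; rewrite ger0_norm; [exact: hM|exact: lmean_ge0].
Qed.

Lemma L1oo_jdiag c C : decays c C -> L1oo_pos mM hattau (J c).
Proof.
move=> dc; have bc := decays_bounded dc; have [C0 hc] := dc.
have [|MJ pJ] := jdiag_pos n2 Mq q_orth q_star bc.
  by move=> i j; have /andP[] := hc i j.
split=> //; split=> //; have [M hM] := log_mean_bounded dc.
by exists M => t t0; apply: le_trans (ler_norm _) (hM t t0).
Qed.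

Variable omega : (R -> R) -> R.
Hypothesis homega : dixmier_state mM hattau omega.

Let Jn (a : 'I_m -> nat) : Hk -> Hk := J (fun i j => (a i)%:R * rj j).

Let decays_n (a : 'I_m -> nat) : decays (fun i j => (a i)%:R * rj j) (\sum_i a i)%:R.
Proof.
split=> // i j; rewrite mulr_ge0 ?(ltW (rj_gt0 j))//= ler_wpM2r ?(ltW (rj_gt0 j))//.
by rewrite ler_nat (bigD1 i)//= leq_addr.
Qed.

Let g (a : 'I_m -> nat) : R := omega (log_mean mM hattau (Jn a)).

Let g_add a b : g (fun i => a i + b i)%N = g a + g b.
Proof.
have [_ _ add] := homega; rewrite -add; [|exact: L1oo_jdiag (decays_n _)..].
congr (omega (log_mean _ _ _)); rewrite /Jn jdiag_add//; last 2 first.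
- exact: decays_bounded (decays_n _).
- exact: decays_bounded (decays_n _).
congr J; apply/funext => i; apply/funext => j.
by rewrite natrD mulrDl.
Qed.

Let dl (i i' : 'I_m) : nat := (i' == i).

Let g_le i : g (dl i) <= 2 * weight i.
Proof.
have [[oD oZ oP _] oL _] := homega.
have dc : decays (fun i' j => (dl i i')%:R * rj j) 1.
  split=> // i' j; rewrite mulr_ge0 ?(ltW (rj_gt0 j))//= ler_wpM2r ?(ltW (rj_gt0 j))//.
  by rewrite lern1 leq_b1.
apply/ler_addgt0Pr => e e0; have w0 := weight_ge0 Mq q_orth q_star i.
(* [weight i] may be 0, as [q i] may be, whereas [lmean_upper] needs a positive constant. *)
pose be := weight i + e / 2; have be0 : 0 < be by rewrite /be; lra.
have [|K hK] := lmean_upper (@sv_ge0 _) (@sv_mono _) be0 ler01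
  (mu := sv (Jn (dl i))).
  move=> N s s0; apply: (sing_value_window (S := pred1 i) dc) => //.
    by move=> i' j; rewrite /= /dl => /negPf ->; rewrite mul0r.
  by rewrite big_pred1_eq /be; lra.
have [M hM] := log_mean_bounded dc.
apply: le_trans (state_le oD oZ oP oL (measurable_lmean (@sv_ge0 _) (@sv_mono _)) hM hK) _.
by rewrite /be; lra.
Qed.

Let g_ge : 2 * \sum_i weight i <= g (fun=> 1%N).
Proof.
have [[oD oZ oP _] oL _] := homega.
have [M hM] := log_mean_bounded (decays_n (fun=> 1%N)).
have [|K hK] := lmean_lower (@sv_ge0 _) (@sv_mono _) weight_gt0 (mu := sv (Jn (fun=> 1%N))).
  move=> N s s0 hs; have -> : Jn (fun=> 1%N) = J (fun _ => rj).
    by congr J; apply/funext => i; apply/funext => j; rewrite mul1r.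
  exact: sing_value_lower.
exact: (state_ge oD oZ oP oL (measurable_lmean (@sv_ge0 _) (@sv_mono _)) hM hK).
Qed.

Let gE a : g a = \sum_i (a i)%:R * (2 * weight i).
Proof. by apply: additive_extremal => //; rewrite -mulr_sumr; exact: g_ge. Qed.

Let complex_diff (x y z w : R) : z = x - y -> z%:C = (x - y) +i* (w - w).
Proof. by move=> ->; rewrite subrr. Qed.

Lemma dixmier_jdiag (l : 'I_m -> int) :
  dixmier_trace mM hattau omega (J (fun i j => (l i)%:~R * brk 1 j%:~R)) =
  (2 * \sum_i weight i * (l i)%:~R)%:C.
Proof.
have [_ _ add] := homega.
pose lp i := if 0 <= l i then absz (l i) else 0%N.
pose ln i := if 0 <= l i then 0%N else absz (l i).
have lE i : (l i)%:~R = (lp i)%:R - (ln i)%:R :> R.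
  by rewrite !pmulrn -intrB /lp /ln; congr (_%:~R); case: leP; lia.
have LJ a : L1oo_pos mM hattau (Jn a) by exact: L1oo_jdiag (decays_n a).
apply: lin_extE => [A [[MA _] pA]|//|]; first by split=> //; exact: mM_lin.
(* The real part comes from the positive and the negative part of [l]; the imaginary part is written
   as a difference of equal terms. *)
exists (Jn lp), (Jn ln), (Jn lp), (Jn lp); split=> //.
  rewrite subrr scaler0 addr0 /Jn jdiag_sub//; last 2 first.
  - exact: decays_bounded (decays_n _).
  - exact: decays_bounded (decays_n _).
  by congr J; apply/funext => i; apply/funext => j; rewrite lE mulrBl.
apply: complex_diff; rewrite -[RHS]/(g lp - g ln) !gE -sumrB mulr_sumr.
by apply: eq_bigr => i _; rewrite lE; ring.
Qed.

End dixmier.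

(** * Spectral data of a modular unitary *)

Section spectral_data.
Context {R : realType} {n : nat} {G : cuntz_system R n} {k : nat}.
Hypothesis n2 : (2 <= n)%N.
Local Notation O := (cs_O G).
Local Notation mM := (mM G k).
Local Notation hattau := (@hattau _ _ G k).

Lemma mpsi1 : mpsi (1%:M : 'M[O]_k) = k%:R.
Proof.
rewrite /mpsi (eq_bigr (fun=> 1)) => [|i _]; first by rewrite sumr_const card_ord.
by rewrite mxE eqxx Phi_fix ?tau1//; exact: Fix1.
Qed.

Lemma fdg_scaler (z : R) (f : 'M[O]_k) (c : int -> R) : MF f -> bounded_seq c ->
  fdg f (fun j => z * c j) = z%:C *: fdg f c.
Proof.
move=> Mf bc; symmetry; apply: fdg_eq => // [|j x].
  by case: bc => C hC; exists (`|z| * C) => j; rewrite normrM ler_wpM2l.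
by rewrite scalefE (linZ (@mPhik_lin _ _ G k j)) mPhik_fdg// scalerA -rmorphM.
Qed.

Variable u : 'M[O]_k.
Hypothesis hu : modular_unitary u.

(** All quantities of the theorem are brought to one number, the sum of the integers [l i] weighted
    by the traces of the projections [q i]; comparing them afterwards is arithmetic. *)
Lemma modular_flow : exists (m : nat) (q : 'I_m -> 'M[O]_k) (l : 'I_m -> int),
  [/\ u_comm u = mrep (lspec q l), in_MOnc (lspec q l) /\ MF (lspec q l),
      mpsi (lspec q l) = (\sum_i weight q i * (l i)%:~R)%:C,
      sf_u u = \sum_i weight q i * (l i)%:~R
    & (0 < k)%N -> forall omega : (R -> R) -> R, dixmier_state mM hattau omega ->
      dixmier_trace mM hattau omega (u_comm u \o resolvent_pow G k 1) =
      (2 * \sum_i weight q i * (l i)%:~R)%:C].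
Proof.
have [N [p [Mp p_orth p_star p_sum p_spec]]] := modular_decomposition n2 hu.
pose l (i : 'I_(N.*2.+1)) := i%:Z - N%:Z; pose q i := p (l i).
have Mq i : MF (q i) by exact: Mp.
have l_inj i j : (l i == l j) = (i == j).
  by apply/eqP/eqP => [|->//]; move=> /addIr[/val_inj].
have q_orth i j : q i *m q j = if i == j then q j else 0.
  by rewrite /q p_orth l_inj.
have q_star i : mstar (q i) = q i by exact: p_star.
have Ou : in_MOnc u by case: hu.
have Ml : MF (lspec q l) by apply: MF_sum => i _; exact: MF_scale.
have ucE : u_comm u = mrep (lspec q l).
  have Ous := MOnc_star Ou.
  by rewrite /u_comm commutator_mrep// -mrepM p_spec.
exists N.*2.+1, q, l; split=> //.
- by split=> //; case: Ml.
- rewrite /lspec mpsi_sum rmorph_sum; apply: eq_bigr => i _.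
  by rewrite mpsiZ (mpsi_weight Mq q_orth q_star) rmorphM/= rmorph_int mulrC.
- rewrite /sf_u ucE; apply: (spectral_flow_path n2 Mq q_orth q_star p_sum (N := N)) => i.
  by rewrite /l; have := ltn_ord i; lia.
- move=> k0 omega homega.
  (* The weights add up to [mpsi 1], which is [k]. *)
  have w0 : 0 < \sum_i weight q i.
    have : (\sum_i weight q i)%:C = k%:R.
      rewrite -mpsi1 -p_sum mpsi_sum rmorph_sum; apply: eq_bigr => i _.
      exact: esym (mpsi_weight Mq q_orth q_star i).
    by move=> h; rewrite -ltcR h ltr0n.
  rewrite -(dixmier_jdiag n2 Mq q_orth q_star p_sum w0 homega).
  congr dixmier_trace; rewrite ucE mrep_resolvent// /lspec fdg_suml.
  apply: eq_bigr => i _; rewrite fdg_scaler//; last exact: brk_bounded.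
  by rewrite fdg_scalel rmorph_int.
Qed.

End spectral_data.

Theorem theorem5p5 (R : realType) (n k : nat) (hn : (2 <= n)%N) (hk : (1 <= k)%N)
    (G : cuntz_system R n) (u : 'M[cs_O G]_k) (hu : modular_unitary u)
    (heta : forall e : R, 0 < e -> eta_term (uDu u) e - eta_term (mD G k) e = 0)
    (hker : (hattau (kernel_proj (mD G k)) - hattau (kernel_proj (uDu u)) = 0)%E) :
  (let F := fun s : R =>
     (s - 1)%:C * hattau_ext (u_comm u \o resolvent_pow G k s) in
   let T := u_comm u \o resolvent_pow G k 1 in
   exists2 a : 'M[cs_O G]_k, mrep a = u_comm u &
     [/\ cvg (F s @[s --> 1^'+]),
         (sf_u u)%:C = 2^-1 * lim (F s @[s --> 1^'+]),
         forall omega : (R -> R) -> R, dixmier_state (mM G k) hattau omega ->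
           2^-1 * lim (F s @[s --> 1^'+]) =
           2^-1 * dixmier_trace (mM G k) hattau omega T
       & 2^-1 * lim (F s @[s --> 1^'+]) = mpsi a]) /\
  [/\ forall a0 a1 : 'M[cs_O G]_k, in_MOnc a0 -> in_MOnc a1 ->
        cvg (theta_at a0 a1 s @[s --> 1^'+]),
      forall (c : R[i]) (a b a1 : 'M[cs_O G]_k),
        in_MOnc a -> in_MOnc b -> in_MOnc a1 ->
        theta (c%:A *: a + b) a1 = c * theta a a1 + theta b a1 /\
        theta a1 (c%:A *: a + b) = c * theta a1 a + theta a1 b,
      forall a0 a1 a2 : 'M[cs_O G]_k, in_MOnc a0 -> in_MOnc a1 -> in_MOnc a2 ->
        b_sigma theta a0 a1 a2 = 0
    & forall a0 : 'M[cs_O G]_k, in_MOnc a0 -> B_sigma theta a0 = 0].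
Proof.
have {hk} k0 : (0 < k)%N by [].
split; last first.
  split=> [a0 a1 O0 O1|c a b a1 Oa Ob O1|a0 a1 a2 O0 O1 O2|a0 O0].
  - by apply: cvgP; exact: theta_cvg.
  - exact: theta_lin.
  - exact: theta_b_sigma.
  - exact: theta_B_sigma.
have [m [q [l [ucE [Ol Ml] mpsiE sfE dixE]]]] := modular_flow hn hu.
(* The other expressions are all matched with half of this limit, [mpsi (lspec q l)]. *)
move=> F T; have cF : F s @[s --> 1^'+] --> 2 * mpsi (lspec q l).
  by rewrite /F ucE; exact: hattau_residue.
have limE := residue_lim cF; exists (lspec q l); first exact: esym ucE.
split; [exact: cvgP cF| | |exact: limE].
- by rewrite limE sfE mpsiE.
- move=> omega homega; rewrite limE dixE// mpsiE rmorphM/= rmorph_nat.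
  by rewrite mulrA mulVf ?mul1r// pnatr_eq0.
Qed.
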